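(* Let $T\in V_\ell$ for some $\ell\in\{1,2,3\}$. Then $\mathcal{L}_\ell(T)$ is completely reducible if and only if $Q_\ell(T)\neq0$.
   Context: Let $\tau\in\mathbb{C}$ with $\mathrm{Im}\,\tau>0$, $\Lambda_\tau=\mathbb{Z}+\mathbb{Z}\tau$, $E_\tau=\mathbb{C}/\Lambda_\tau$; $\wp,\zeta$ are the Weierstrass functions of $\Lambda_\tau$ ($\zeta'=-\wp$, $\zeta$ odd). Put $\omega_0=0,\omega_1=1,\omega_2=\tau,\omega_3=1+\tau$, $\eta_0=0$, $\eta_i=\zeta(z+\omega_i)-\zeta(z)$ for $i=1,2,3$. For $\ell\in\{1,2,3\}$ let $\varepsilon^{(\ell)}_0=\varepsilon^{(\ell)}_\ell=1$ and $\varepsilon^{(\ell)}_j=-1$ for $j\in\{1,2,3\}\setminus\{\ell\}$. $V_\ell$ is identified with $\mathbb{C}$: $T\in V_\ell$ stands for the parameter $(\varepsilon_0^{(\ell)}T,\varepsilon_1^{(\ell)}T,\varepsilon_2^{(\ell)}T,\varepsilon_3^{(\ell)}T,\,T^2-\eta_{3-\ell}T)$, and $\mathcal{L}_\ell(T)$ is the equation $y''(z)=q_\ell(z;T)y(z)$ with $$q_\ell(z;T)=\tfrac34\sum_{k=0}^3\wp(z-\tfrac{\omega_k}{2})+T\sum_{k=0}^3\varepsilon_k^{(\ell)}\zeta(z-\tfrac{\omega_k}{2})+T^2-\eta_{3-\ell}T.$$ (All its solutions are free of logarithmic singularities.) Spectral polynomial: with $$F^{(\ell)}(z;T)=-\sum_{k=0}^3\varepsilon_k^{(\ell)}\zeta(z-\tfrac{\omega_k}{2})+2T+\eta_{3-\ell},$$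 $Q_\ell(T)=\big((F^{(\ell)})'\big)^2-2(F^{(\ell)})''F^{(\ell)}+4q_\ell(z;T)(F^{(\ell)})^2$, where $'$ is $d/dz$; this is independent of $z$ and is a polynomial in $T$. Monodromy matrices: fix $z_0\in\mathbb{C}$ such that $z_0+\mathbb{R}$ and $z_0+\tau\mathbb{R}$ contain no singularities of $q_\ell$, and let $y_1,y_2$ be linearly independent solutions near $z_0$; $M_1,M_2$ are defined by $(y_1,y_2)^t(z+1)=M_1(y_1,y_2)^t(z)$ near $z_0+\mathbb{R}$ and $(y_1,y_2)^t(z+\tau)=M_2(y_1,y_2)^t(z)$ near $z_0+\tau\mathbb{R}$. They commute. The equation is completely reducible if $M_1,M_2$ can be simultaneously diagonalized. *)

(* Defs.v *)
(* Concrete complex numbers of Coquelicot. *)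
From Stdlib Require Import Reals ZArith.
From Coquelicot Require Import Coquelicot.

Local Open Scope C_scope.

(* Convergence of complex sequences is componentwise; the value is only
   meaningful when both real sequences converge. *)
Definition C_lim_seq (u : nat -> C) : C :=
  (real (Lim_seq (fun n => Re (u n))), real (Lim_seq (fun n => Im (u n)))).

Definition lattice_point (tau : C) (m n : Z) : C := IZR m + IZR n * tau.

(* Sum of f over the points m + n tau <> 0 with |m|, |n| <= N; the indices
   i, j run from 0 to 2N inclusive and m = i - N, n = j - N. *)
Definition lattice_partial_sum (tau : C) (f : C -> C) (N : nat) : C :=
  sum_n (G := C_AbelianMonoid) (fun i =>
    sum_n (G := C_AbelianMonoid) (fun j =>
      let m := (Z.of_nat i - Z.of_nat N)%Z in
      let n := (Z.of_nat j - Z.of_nat N)%Z in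
      if ((m =? 0) && (n =? 0))%Z%bool then RtoC 0
      else f (lattice_point tau m n))
    (2 * N)) (2 * N).

(* The two Weierstrass series below converge absolutely (their terms are
   O(|w|^-3)), so summing over growing squares is only a choice of ordering. *)
Definition lattice_sum (tau : C) (f : C -> C) : C :=
  C_lim_seq (lattice_partial_sum tau f).

Definition wp (tau z : C) : C :=
  1 / (z * z) +
  lattice_sum tau (fun w => 1 / ((z - w) * (z - w)) - 1 / (w * w)).

Definition wzeta (tau z : C) : C :=
  1 / z + lattice_sum tau (fun w => 1 / (z - w) + 1 / w + z / (w * w)).

Definition omega (tau : C) (k : nat) : C :=
  match k with
  | 0 => 0
  | 1 => 1
  | 2 => tau
  | _ => 1 + tau
  end.

(* zeta (z + omega_k) - zeta z does not depend on z; it is evaluated here at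
   z = - omega_k / 2, which is not a lattice point for k = 1, 2, 3. *)
Definition eta (tau : C) (k : nat) : C :=
  match k with
  | 0 => 0
  | _ => let z := - (omega tau k / 2) in
         wzeta tau (z + omega tau k) - wzeta tau z
  end.

Definition eps (l k : nat) : C :=
  if ((k =? 0) || (k =? l))%nat%bool then 1 else -1.

Definition sum4 (f : nat -> C) : C := sum_n (G := C_AbelianMonoid) f 3.

Definition q (tau : C) (l : nat) (T z : C) : C :=
  3 / 4 * sum4 (fun k => wp tau (z - omega tau k / 2))
  + T * sum4 (fun k => eps l k * wzeta tau (z - omega tau k / 2))
  + (T * T - eta tau (3 - l) * T).

Definition singular (tau z : C) : Prop :=
  exists (k : nat) (m n : Z),
    (k <= 3)%nat /\ z = omega tau k / 2 + lattice_point tau m n.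

Definition F (tau : C) (l : nat) (T z : C) : C :=
  - sum4 (fun k => eps l k * wzeta tau (z - omega tau k / 2))
  + 2 * T + eta tau (3 - l).

(* The right-hand side defining the spectral polynomial, at a given z. *)
Definition Q (tau : C) (l : nat) (T z : C) : C :=
  let f := F tau l T in
  let f' := C_derive f in
  let f'' := C_derive f' in
  f' z * f' z - 2 * (f'' z * f z) + 4 * (q tau l T z * (f z * f z)).

Definition solution_near (tau : C) (l : nat) (T : C) (y : C -> C) (p : C)
  : Prop :=
  exists y' : C -> C,
    locally p (fun z =>
      is_derive y z (y' z) /\ is_derive y' z (q tau l T z * y z)).

(* P holds on some open neighbourhood of the line z0 + w R. *)
Definition near_line (z0 w : C) (P : C -> Prop) : Prop :=
  forall t : R, locally (z0 + t * w) P.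

Definition lin_indep_near (z0 : C) (y1 y2 : C -> C) : Prop :=
  forall a b : C, locally z0 (fun z => a * y1 z + b * y2 z = 0) ->
    a = 0 /\ b = 0.

Definition col2 (a b : C) : @matrix C 2 1 :=
  mk_matrix 2 1 (fun i _ => match i with 0%nat => a | _ => b end).

(* The lines z0 + R and z0 + tau R meet only at z0, so thin tubes around them
   have a simply connected union. Hence the analytic continuations of a
   solution germ at z0 along the two lines are given by one function y1
   (resp. y2); its values away from the tubes are irrelevant. *)
Definition is_monodromy (tau : C) (l : nat) (T z0 : C) (y1 y2 : C -> C)
    (M1 M2 : @matrix C 2 2) : Prop :=
  (forall t : R, ~ singular tau (z0 + t * 1) /\ ~ singular tau (z0 + t * tau))
  /\ (forall t : R,
        solution_near tau l T y1 (z0 + t * 1) /\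
        solution_near tau l T y2 (z0 + t * 1) /\
        solution_near tau l T y1 (z0 + t * tau) /\
        solution_near tau l T y2 (z0 + t * tau))
  /\ lin_indep_near z0 y1 y2
  /\ near_line z0 1 (fun z =>
       col2 (y1 (z + 1)) (y2 (z + 1)) = Mmult M1 (col2 (y1 z) (y2 z)))
  /\ near_line z0 tau (fun z =>
       col2 (y1 (z + tau)) (y2 (z + tau)) = Mmult M2 (col2 (y1 z) (y2 z))).

Definition diagonal2 (D : @matrix C 2 2) : Prop :=
  coeff_mat zero D 0 1 = zero /\ coeff_mat zero D 1 0 = zero.

Definition simultaneously_diagonalizable (M1 M2 : @matrix C 2 2) : Prop :=
  exists P P' : @matrix C 2 2,
    Mmult P P' = Mone /\ Mmult P' P = Mone /\
    diagonal2 (Mmult (Mmult P M1) P') /\ diagonal2 (Mmult (Mmult P M2) P').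

(* Main.v *)
Require Import Defs.
From Stdlib Require Import Reals Lra Lia Psatz ZArith Classical ClassicalEpsilon.
From Coquelicot Require Import Coquelicot.

(** The equation L_l(T) is y'' = q y, and the function f = F of the statement is
    elliptic and lies in the symmetric square of the solution space:
    f''' = 4 q f' + 2 q' f.  Hence, for solutions u, v,

      gram (u, v) = f u' v' - f'/2 (u v' + u' v) + (f''/2 - q f) u v

    does not depend on z.  As f and q have the periods 1 and tau, the
    monodromy matrices preserve this symmetric form; they also preserve the
    Wronskian W, and the form has discriminant W^2 Q / 4 ([gram_det]).

    If Q <> 0, the form is nondegenerate, so M_1 and M_2 lie in its special
    orthogonal group, which is a torus: they commute with one and the same
    matrix with two distinct eigenvalues ([nondegenerate_diagonalizable]).

    If Q = 0 and the form has rank one, matrices of determinant one which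
    preserve it and are diagonalizable are 1 or -1 ([degenerate_scalar]).
    A vector of the kernel gives a solution Y with f' Y = 2 f Y', so f is a
    multiple of Y^2.  The other solutions would be Y times a primitive of 1/Y^2;
    without any division, V = 2 Y' + X Y is a solution, with the explicit X of
    [Xfun], a sum of zeta functions plus a linear function.  Scalar monodromy
    multiplies Y and V by the same sign, so X has periods 1 and tau
    ([degenerate_X_periodic]).  If the form vanishes, f = 0 along the lines,
    hence X' = 0 there, with the same conclusion ([zero_form_X_periodic]).
    But a sum of zeta functions plus a linear function has a single simple
    pole modulo the half-periods and is never elliptic
    ([quasi_periods_independent], a weak form of Legendre's relation).

    All this rests on algebraic relations.  Write f = A_l + 2 T; here A_l is odd,
    has simple poles with residues - eps_k at the half-periods omega_k / 2, and
    is multiplied by eps_k under translation by omega_k / 2.  With P the sum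
    of the four translates of wp, and with (l, m, n) a permutation of
    (1, 2, 3), one has

      P = A_l^2 + c_l,   A_l' = A_m A_n,   c_1 + c_2 + c_3 = 0,

    so that (A_l')^2 is a quartic in A_l, q = 3/4 P - T A_l + T^2, and
    Q = (4 T^2 + c_l - c_m) (4 T^2 + c_l - c_n).  Both kinds of relation are instances
    of [product_principle]: if u and v have simple poles, and w has a double pole
    that cancels the pole of u v, and if half-period translations multiply
    each of them by 1 or -1, then w - u v is constant by a Liouville theorem.  Its
    value can be read off at 0, and it is 0 if w - u v is multiplied
    by -1 under some half-period; this is also the source of
    c_1 + c_2 + c_3 = 0.

    The Liouville theorem ([liouville]) comes from the maximum
    principle for the real part, which follows from the mean value property on
    circles, proved by differentiating under the integral sign.  The functions
    zeta and wp are handled through square partial sums: quadratic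
    bounds on the remainder, term by term, give the derivatives, and the
    quasi-periodicity of zeta is a telescoping sum whose boundary terms are O(1/N). *)

Local Open Scope C_scope.

(** * Complex differentiation *)

Definition cderiv (f : C -> C) (z l : C) : Prop :=
  @is_derive C_AbsRing C_NormedModule f z l.

Lemma Cminus_0 (x y : C) : x - y = 0 -> x = y.
Proof. intros E. replace x with ((x - y) + y) by ring. rewrite E. ring. Qed.

Lemma Cminus_eq (x y : C) : x = y -> x - y = 0.
Proof. intros ->. ring. Qed.

Lemma Cmod_minus_pos (x y : C) : x <> y -> (0 < Cmod (x - y))%R.
Proof. intros n. apply Cmod_gt_0. intros E. now apply n, Cminus_0. Qed.

Lemma C_integral (x y : C) : x * y = 0 -> x = 0 \/ y = 0.
Proof.
intros E. destruct (Ceq_dec x 0) as [|n]; [now left|right].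
replace y with ((x * y) / x) by (field; trivial). rewrite E. field. trivial.
Qed.

Lemma locally_Cmod (z : C) (P : C -> Prop) :
  locally z P <-> exists d : R, (0 < d)%R /\ forall w, (Cmod (w - z) < d)%R -> P w.
Proof.
split.
- intros [e H]. exists e. split; [apply cond_pos|].
  intros w Hw. apply H. apply C_NormedModule_mixin_compat1. exact Hw.
- intros [d [d0 H]].
  assert (Hs : (0 < sqrt 2)%R) by (apply sqrt_lt_R0; lra).
  assert (He : (0 < d / sqrt 2)%R) by (apply Rdiv_lt_0_compat; assumption).
  exists (mkposreal _ He). intros w Hw. apply H.
  apply C_NormedModule_mixin_compat2 in Hw. simpl in Hw.
  replace (sqrt 2 * (d / sqrt 2))%R with d in Hw by (field; lra).
  exact Hw.
Qed.

Lemma cderiv_eps (f : C -> C) (z l : C) :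
  cderiv f z l <-> forall e : R, (0 < e)%R -> exists d : R, (0 < d)%R /\
    forall w, (Cmod (w - z) < d)%R ->
      (Cmod (f w - f z - (w - z) * l) <= e * Cmod (w - z))%R.
Proof.
split.
- intros [_ H] e e0.
  specialize (H z (fun P HP => HP) (mkposreal e e0)).
  destruct H as [d H]. exists d. split; [apply cond_pos|].
  intros w Hw. exact (H w Hw).
- intros H. split; [apply is_linear_scal_l|].
  intros x Hx.
  assert (E : z = x) by exact (is_filter_lim_locally_unique (V := AbsRing_NormedModule C_AbsRing) z x Hx).
  subst x.
  intros e. destruct (H e (cond_pos e)) as [d [d0 Hd]].
  exists (mkposreal d d0). intros w Hw. exact (Hd w Hw).
Qed.

(** The form in which derivatives of lattice sums arise: a term-by-term remainder
    estimate is quadratic. *)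
Lemma cderiv_quadratic (f : C -> C) (z l : C) (d K : R) :
  (0 < d)%R ->
  (forall w, (Cmod (w - z) < d)%R ->
     (Cmod (f w - f z - (w - z) * l) <= K * (Cmod (w - z) * Cmod (w - z)))%R) ->
  cderiv f z l.
Proof.
intros d0 H. apply cderiv_eps. intros e e0.
pose (k := (Rabs K + 1)%R).
assert (k0 : (0 < k)%R) by (unfold k; pose proof (Rabs_pos K); lra).
assert (ek : (0 < e / k)%R) by (apply Rdiv_lt_0_compat; assumption).
exists (Rmin d (e / k)). split; [apply Rmin_pos; assumption|].
intros w Hw.
assert (Hw1 := Rlt_le_trans _ _ _ Hw (Rmin_l _ _)).
assert (Hw2 := Rlt_le_trans _ _ _ Hw (Rmin_r _ _)).
apply Rle_trans with (1 := H w Hw1).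
assert (Hc := Cmod_ge_0 (w - z)). set (c := Cmod (w - z)) in *.
rewrite <- Rmult_assoc. apply Rmult_le_compat_r; trivial.
assert (K <= k)%R by (unfold k; pose proof (Rle_abs K); lra).
apply Rle_trans with (k * c)%R; [apply Rmult_le_compat_r; trivial|].
replace e with (k * (e / k))%R by (field; lra).
apply Rmult_le_compat_l; lra.
Qed.

Lemma cderiv_unique (f : C -> C) (z l l' : C) :
  cderiv f z l -> cderiv f z l' -> l = l'.
Proof.
intros H H'. rewrite <- (is_C_derive_unique _ _ _ H). exact (is_C_derive_unique _ _ _ H').
Qed.

Lemma cderiv_ext_loc (f g : C -> C) (z l : C) :
  locally z (fun w => f w = g w) -> cderiv f z l -> cderiv g z l.
Proof.
intros Hl Hf. apply locally_Cmod in Hl. destruct Hl as [d [d0 Hl]].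
rewrite cderiv_eps in Hf |- *. intros e e0.
destruct (Hf e e0) as [d' [d0' Hd]].
exists (Rmin d d'). split; [apply Rmin_pos; assumption|].
intros w Hw. rewrite <- !Hl.
- apply Hd. eapply Rlt_le_trans; [exact Hw|apply Rmin_r].
- replace (z - z) with (RtoC 0) by ring. rewrite Cmod_0. exact d0.
- eapply Rlt_le_trans; [exact Hw|apply Rmin_l].
Qed.

Lemma cderiv_eq (f : C -> C) (z l l' : C) : l = l' -> cderiv f z l -> cderiv f z l'.
Proof. now intros ->. Qed.

Lemma cderiv_ext (f g : C -> C) (z l : C) :
  (forall w, f w = g w) -> cderiv f z l -> cderiv g z l.
Proof.
intros H. apply cderiv_ext_loc. apply locally_Cmod. exists 1%R. split; [lra|auto].
Qed.

Lemma cderiv_const (c z : C) : cderiv (fun _ => c) z 0.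
Proof. exact (is_derive_const (K := C_AbsRing) (V := C_NormedModule) c z). Qed.

(** The complex numbers carry two normed-module structures over themselves, with
    different uniform structures; product and composition rules use the second. *)
Lemma cderiv_absring (f : C -> C) (z l : C) :
  cderiv f z l <->
  @is_derive C_AbsRing (AbsRing_NormedModule C_AbsRing) f z l.
Proof.
split; intros [_ H]; (split; [apply is_linear_scal_l|exact H]).
Qed.

Lemma cderiv_id (z : C) : cderiv (fun w => w) z 1.
Proof. apply cderiv_absring. exact (is_derive_id (K := C_AbsRing) z). Qed.

Lemma cderiv_plus (f g : C -> C) (z a b : C) :
  cderiv f z a -> cderiv g z b -> cderiv (fun w => f w + g w) z (a + b).
Proof. exact (is_derive_plus (K := C_AbsRing) (V := C_NormedModule) f g z a b). Qed.

Lemma cderiv_opp (f : C -> C) (z a : C) :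
  cderiv f z a -> cderiv (fun w => - f w) z (- a).
Proof. exact (is_derive_opp (K := C_AbsRing) (V := C_NormedModule) f z a). Qed.

Lemma cderiv_minus (f g : C -> C) (z a b : C) :
  cderiv f z a -> cderiv g z b -> cderiv (fun w => f w - g w) z (a - b).
Proof. exact (is_derive_minus (K := C_AbsRing) (V := C_NormedModule) f g z a b). Qed.

Lemma cderiv_mult (f g : C -> C) (z a b : C) :
  cderiv f z a -> cderiv g z b ->
  cderiv (fun w => f w * g w) z (a * g z + f z * b).
Proof.
rewrite !cderiv_absring. intros Hf Hg.
exact (is_derive_mult (K := C_AbsRing) f g z a b Hf Hg Cmult_comm).
Qed.

Lemma cderiv_scal (c : C) (f : C -> C) (z a : C) :
  cderiv f z a -> cderiv (fun w => c * f w) z (c * a).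
Proof.
intros H. apply (cderiv_eq _ _ (0 * f z + c * a)); [ring|].
apply (cderiv_mult (fun _ => c) f); [apply cderiv_const|exact H].
Qed.

Lemma cderiv_comp (f g : C -> C) (z a b : C) :
  cderiv g z b -> cderiv f (g z) a -> cderiv (fun w => f (g w)) z (b * a).
Proof.
rewrite (cderiv_absring g). intros Hg Hf.
exact (is_derive_comp (K := C_AbsRing) (V := C_NormedModule) f g z a b Hf Hg).
Qed.

Lemma cderiv_shift (f : C -> C) (z c a : C) :
  cderiv f (z + c) a -> cderiv (fun w => f (w + c)) z a.
Proof.
intros H. apply (cderiv_eq _ _ (1 * a)); [ring|].
apply (cderiv_comp f (fun w => w + c)); [|exact H].
apply (cderiv_eq _ _ (1 + 0)); [ring|].
apply cderiv_plus; [apply cderiv_id|apply cderiv_const].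
Qed.

(** Continuity stated with the modulus, since the canonical neighbourhoods are
    products of intervals. *)
Definition ccont (f : C -> C) (z : C) : Prop :=
  forall e : R, (0 < e)%R -> exists d : R, (0 < d)%R /\
    forall w, (Cmod (w - z) < d)%R -> (Cmod (f w - f z) < e)%R.

Lemma cderiv_ccont (f : C -> C) (z l : C) : cderiv f z l -> ccont f z.
Proof.
intros H e e0. rewrite cderiv_eps in H.
destruct (H 1%R Rlt_0_1) as [d [d0 Hd]].
pose (k := (1 + Cmod l)%R).
assert (k0 : (0 < k)%R) by (unfold k; pose proof (Cmod_ge_0 l); lra).
exists (Rmin d (e / k)). split; [apply Rmin_pos; trivial; now apply Rdiv_lt_0_compat|].
intros w Hw.
assert (Hw1 := Rlt_le_trans _ _ _ Hw (Rmin_l _ _)).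
assert (Hw2 := Rlt_le_trans _ _ _ Hw (Rmin_r _ _)).
replace (f w - f z) with ((f w - f z - (w - z) * l) + (w - z) * l) by ring.
eapply Rle_lt_trans; [apply Cmod_triangle|].
rewrite Cmod_mult. specialize (Hd w Hw1).
apply Rle_lt_trans with (k * Cmod (w - z))%R; [unfold k; lra|].
replace e with (k * (e / k))%R by (field; lra).
apply Rmult_lt_compat_l; lra.
Qed.

Lemma ccont_plus (f g : C -> C) (z : C) :
  ccont f z -> ccont g z -> ccont (fun w => f w + g w) z.
Proof.
intros Hf Hg e e0.
destruct (Hf (e/2)%R ltac:(lra)) as [d [d0 Hd]].
destruct (Hg (e/2)%R ltac:(lra)) as [d' [d0' Hd']].
exists (Rmin d d'). split; [now apply Rmin_pos|]. intros w Hw.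
specialize (Hd w (Rlt_le_trans _ _ _ Hw (Rmin_l _ _))).
specialize (Hd' w (Rlt_le_trans _ _ _ Hw (Rmin_r _ _))).
replace (f w + g w - (f z + g z)) with ((f w - f z) + (g w - g z)) by ring.
eapply Rle_lt_trans; [apply Cmod_triangle|]. lra.
Qed.

Lemma ccont_const (c z : C) : ccont (fun _ => c) z.
Proof. apply (cderiv_ccont _ _ _ (cderiv_const c z)). Qed.

Lemma ccont_bounded (f : C -> C) (z : C) : ccont f z ->
  exists d : R, (0 < d)%R /\
    forall w, (Cmod (w - z) < d)%R -> (Cmod (f w) <= Cmod (f z) + 1)%R.
Proof.
intros H. destruct (H 1%R Rlt_0_1) as [d [d0 Hd]]. exists d. split; trivial.
intros w Hw. specialize (Hd w Hw).
replace (f w) with (f z + (f w - f z)) by ring.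
eapply Rle_trans; [apply Cmod_triangle|]. lra.
Qed.

Lemma ccont_mult (f g : C -> C) (z : C) :
  ccont f z -> ccont g z -> ccont (fun w => f w * g w) z.
Proof.
intros Hf Hg e e0.
destruct (ccont_bounded _ _ Hf) as [d1 [d10 Hd1]].
assert (Hfz := Cmod_ge_0 (f z)). assert (Hgz := Cmod_ge_0 (g z)).
set (A := (Cmod (f z) + 1)%R) in *. set (B := (Cmod (g z) + 1)%R).
destruct (Hf (e / 2 / B)%R) as [d2 [d20 Hd2]].
{ apply Rdiv_lt_0_compat; unfold B; lra. }
destruct (Hg (e / 2 / A)%R) as [d3 [d30 Hd3]].
{ apply Rdiv_lt_0_compat; unfold A; lra. }
exists (Rmin d1 (Rmin d2 d3)). split; [repeat apply Rmin_pos; trivial|].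
intros w Hw.
specialize (Hd1 w (Rlt_le_trans _ _ _ Hw (Rmin_l _ _))).
assert (Hw' := Rlt_le_trans _ _ _ Hw (Rmin_r _ _)).
specialize (Hd2 w (Rlt_le_trans _ _ _ Hw' (Rmin_l _ _))).
specialize (Hd3 w (Rlt_le_trans _ _ _ Hw' (Rmin_r _ _))).
replace (f w * g w - f z * g z) with (f w * (g w - g z) + (f w - f z) * g z) by ring.
eapply Rle_lt_trans; [apply Cmod_triangle|]. rewrite !Cmod_mult.
assert (Ha : (Cmod (f w) * Cmod (g w - g z) < e / 2)%R).
{ apply Rle_lt_trans with (A * Cmod (g w - g z))%R.
  - apply Rmult_le_compat_r; [apply Cmod_ge_0|exact Hd1].
  - replace (e/2)%R with (A * (e/2/A))%R by (field; unfold A; lra).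
    apply Rmult_lt_compat_l; [unfold A; lra|exact Hd3]. }
assert (Hb : (Cmod (f w - f z) * Cmod (g z) <= e / 2)%R).
{ replace (e/2)%R with (e/2/B * B)%R by (field; unfold B; lra).
  apply Rmult_le_compat; try apply Cmod_ge_0; [lra|unfold B; lra]. }
lra.
Qed.

Lemma ccont_opp (f : C -> C) (z : C) : ccont f z -> ccont (fun w => - f w) z.
Proof.
intros H e e0. destruct (H e e0) as [d [d0 Hd]]. exists d. split; trivial.
intros w Hw. replace (- f w - - f z) with (-(f w - f z)) by ring.
rewrite Cmod_opp. auto.
Qed.

Lemma ccont_shift (f : C -> C) (z c : C) :
  ccont f (z + c) -> ccont (fun w => f (w + c)) z.
Proof.
intros H e e0. destruct (H e e0) as [d [d0 Hd]]. exists d. split; trivial.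
intros w Hw. apply Hd. now replace (w + c - (z + c)) with (w - z) by ring.
Qed.

Lemma rderiv_eps (f : R -> R) (z l : R) :
  is_derive f z l <-> forall e : R, (0 < e)%R -> exists d : R, (0 < d)%R /\
    forall w, (Rabs (w - z) < d)%R ->
      (Rabs (f w - f z - (w - z) * l) <= e * Rabs (w - z))%R.
Proof.
split.
- intros [_ H] e e0.
  specialize (H z (fun P HP => HP) (mkposreal e e0)).
  destruct H as [d H]. exists d. split; [apply cond_pos|].
  intros w Hw. exact (H w Hw).
- intros H. split; [apply is_linear_scal_l|].
  intros x Hx.
  assert (E : z = x) by exact (is_filter_lim_locally_unique (V := AbsRing_NormedModule R_AbsRing) z x Hx).
  subst x.
  intros e. destruct (H e (cond_pos e)) as [d [d0 Hd]].
  exists (mkposreal d d0). intros w Hw. exact (Hd w Hw).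
Qed.

Lemma Cmod_le_sum (a b : R) : (Cmod (a, b) <= Rabs a + Rabs b)%R.
Proof.
replace ((a, b) : C) with (RtoC a + RtoC b * Ci)
  by (unfold RtoC, Ci, Cplus, Cmult; simpl; f_equal; ring).
eapply Rle_trans; [apply Cmod_triangle|].
rewrite Cmod_mult, Cmod_Ci, !Cmod_R. lra.
Qed.

(** Chain rule along a real curve.  The real part suffices, because the
    imaginary part of f is the real part of - Ci * f; this device is used throughout. *)
Lemma cderiv_curve (f : C -> C) (l : C) (x y : R -> R) (t x' y' : R) :
  is_derive x t x' -> is_derive y t y' ->
  cderiv f (x t, y t) l ->
  is_derive (fun s => Re (f (x s, y s))) t (Re ((x', y') * l)).
Proof.
intros Hx Hy Hf. rewrite cderiv_eps in Hf. rewrite rderiv_eps in Hx, Hy |- *.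
intros e e0.
pose (g := fun s => (x s, y s) : C). pose (g' := (x', y') : C).
assert (Hg : forall e1 : R, (0 < e1)%R -> exists d : R, (0 < d)%R /\
  forall s, (Rabs (s - t) < d)%R ->
   (Cmod (g s - g t - RtoC (s - t) * g') <= e1 * Rabs (s - t))%R).
{ intros e1 e10. destruct (Hx (e1/2)%R ltac:(lra)) as [d [d0 Hd]].
  destruct (Hy (e1/2)%R ltac:(lra)) as [d' [d0' Hd']].
  exists (Rmin d d'). split; [now apply Rmin_pos|]. intros s Hs.
  specialize (Hd s (Rlt_le_trans _ _ _ Hs (Rmin_l _ _))).
  specialize (Hd' s (Rlt_le_trans _ _ _ Hs (Rmin_r _ _))).
  replace (g s - g t - RtoC (s - t) * g') with
    ((x s - x t - (s - t) * x', y s - y t - (s - t) * y')%R : C)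
    by (unfold g, g', Cminus, Cplus, Copp, Cmult, RtoC; simpl; f_equal; ring).
  eapply Rle_trans; [apply Cmod_le_sum|]. lra. }
pose (k := (1 + Cmod g')%R).
assert (k0 : (0 < k)%R) by (unfold k; pose proof (Cmod_ge_0 g'); lra).
pose (m := (1 + Cmod l)%R).
assert (m0 : (0 < m)%R) by (unfold m; pose proof (Cmod_ge_0 l); lra).
destruct (Hf (e / 2 / k)%R) as [d1 [d10 Hd1]].
{ apply Rdiv_lt_0_compat; lra. }
destruct (Hg 1%R Rlt_0_1) as [d2 [d20 Hd2]].
destruct (Hg (e / 2 / m)%R) as [d3 [d30 Hd3]].
{ apply Rdiv_lt_0_compat; lra. }
exists (Rmin (d1 / k) (Rmin d2 d3)).
split; [repeat apply Rmin_pos; trivial; now apply Rdiv_lt_0_compat|].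
intros s Hs.
assert (Hs1 := Rlt_le_trans _ _ _ Hs (Rmin_l _ _)).
assert (Hs' := Rlt_le_trans _ _ _ Hs (Rmin_r _ _)).
specialize (Hd2 s (Rlt_le_trans _ _ _ Hs' (Rmin_l _ _))).
specialize (Hd3 s (Rlt_le_trans _ _ _ Hs' (Rmin_r _ _))).
assert (Hb : (Cmod (g s - g t) <= k * Rabs (s - t))%R).
{ replace (g s - g t) with ((g s - g t - RtoC (s - t) * g') + RtoC (s - t) * g') by ring.
  eapply Rle_trans; [apply Cmod_triangle|]. rewrite Cmod_mult, Cmod_R. unfold k. lra. }
assert (Hb1 : (Cmod (g s - g t) < d1)%R).
{ apply Rle_lt_trans with (1 := Hb). replace d1 with (k * (d1 / k))%R by (field; lra).
  apply Rmult_lt_compat_l; trivial. }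
specialize (Hd1 _ Hb1). fold (g s) (g t) in *.
replace (Re (f (g s)) - Re (f (g t)) - (s - t) * Re ((x', y') * l))%R with
  (Re ((f (g s) - f (g t) - (g s - g t) * l) + (g s - g t - RtoC (s - t) * g') * l)).
2:{ unfold g'. unfold Re, Cminus, Cplus, Copp, Cmult, RtoC; simpl; ring. }
eapply Rle_trans; [apply re_le_Cmod|].
eapply Rle_trans; [apply Cmod_triangle|]. rewrite (Cmod_mult _ l).
assert (h1 : (Cmod (f (g s) - f (g t) - (g s - g t) * l) <= e / 2 * Rabs (s - t))%R).
{ apply Rle_trans with (1 := Hd1).
  replace (e / 2 * Rabs (s - t))%R with (e / 2 / k * (k * Rabs (s - t)))%R by (field; lra).
  apply Rmult_le_compat_l; trivial. apply Rlt_le, Rdiv_lt_0_compat; lra. }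
assert (h2 : (Cmod (g s - g t - RtoC (s - t) * g') * Cmod l <= e / 2 * Rabs (s - t))%R).
{ replace (e / 2 * Rabs (s - t))%R with (e / 2 / m * Rabs (s - t) * m)%R by (field; lra).
  apply Rmult_le_compat; try apply Cmod_ge_0; trivial. unfold m; lra. }
lra.
Qed.

Lemma cderiv_line (f : C -> C) (l z w : C) (t : R) :
  cderiv f (z + t * w) l ->
  is_derive (fun s : R => Re (f (z + s * w))) t (Re (w * l)).
Proof.
intros H.
assert (E : forall s : R, z + s * w = ((Re z + s * Re w)%R, (Im z + s * Im w)%R)).
{ intros s. unfold Cplus, Cmult, RtoC, Re, Im; simpl. f_equal; ring. }
apply (is_derive_ext (fun s => Re (f ((Re z + s * Re w)%R, (Im z + s * Im w)%R)))).
{ intros s. now rewrite E. }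
replace (w * l) with ((Re w, Im w) * l) by now rewrite <- surjective_pairing.
apply cderiv_curve; [auto_derive; trivial; ring|auto_derive; trivial; ring|].
now rewrite <- E.
Qed.

Lemma Re_Im_eq (a b : C) : Re a = Re b -> Im a = Im b -> a = b.
Proof. destruct a, b; simpl. now intros -> ->. Qed.

Lemma Im_Re (a : C) : Im a = Re (- Ci * a).
Proof. unfold Im, Re, Ci, Copp, Cmult; simpl. ring. Qed.

Lemma cderiv_zero_line (f : C -> C) (z w : C) :
  (forall t : R, (0 <= t <= 1)%R -> cderiv f (z + t * w) 0) ->
  f (z + w) = f z.
Proof.
intros H.
assert (K : forall g : C -> C,
  (forall t : R, (0 <= t <= 1)%R -> cderiv g (z + t * w) 0) -> Re (g (z + w)) = Re (g z)).
{ intros g Hg.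
  destruct (MVT_gen (fun s : R => Re (g (z + s * w))) 0 1 (fun _ => 0%R)) as [c [_ Hc]].
  - intros x Hx. rewrite Rmin_left, Rmax_right in Hx by lra.
    assert (Hx' : (0 <= x <= 1)%R) by lra.
    assert (D := cderiv_line _ _ _ _ _ (Hg x Hx')).
    now replace (Re (w * 0)) with 0%R in D by (unfold Re, Cmult; simpl; ring).
  - intros x Hx. rewrite Rmin_left, Rmax_right in Hx by lra.
    apply continuity_pt_filterlim.
    apply (ex_derive_continuous (V := R_NormedModule) (fun s : R => Re (g (z + s * w)))).
    eexists. apply (cderiv_line _ _ _ _ _ (Hg x Hx)).
  - replace (z + 1%R * w) with (z + w) in Hc by ring.
    replace (z + 0%R * w) with z in Hc by ring. lra. }
apply Re_Im_eq.
- now apply K.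
- rewrite !Im_Re. apply (K (fun u => - Ci * f u)).
  intros t Ht. apply (cderiv_eq _ _ (- Ci * 0)); [ring|]. apply cderiv_scal. auto.
Qed.

Lemma cderiv_inv (z : C) : z <> 0 -> cderiv (fun w => / w) z (- / (z * z)).
Proof.
intros Hz. assert (m0 : (0 < Cmod z)%R) by now apply Cmod_gt_0.
apply (cderiv_quadratic _ _ _ (Cmod z / 2) (2 / (Cmod z * Cmod z * Cmod z))); [lra|].
intros w Hw.
assert (hw : (Cmod z / 2 <= Cmod w)%R).
{ assert (Cmod z <= Cmod w + Cmod (w - z))%R; [|lra].
  replace z with (w + - (w - z)) at 1 by ring.
  eapply Rle_trans; [apply Cmod_triangle|]. rewrite Cmod_opp. lra. }
assert (Hw0 : w <> 0) by (apply Cmod_gt_0; lra).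
replace (/ w - / z - (w - z) * - / (z * z)) with
  ((w - z) * (w - z) * / (w * z * z)) by (field; auto).
assert (w * z * z <> 0) by (repeat apply Cmult_neq_0; auto).
rewrite !Cmod_mult, Cmod_inv, !Cmod_mult by trivial.
rewrite Rmult_comm. apply Rmult_le_compat_r.
{ apply Rmult_le_pos; apply Cmod_ge_0. }
replace (2 / (Cmod z * Cmod z * Cmod z))%R with (/ (Cmod z / 2 * Cmod z * Cmod z))%R by (field; lra).
apply Rinv_le_contravar; [repeat apply Rmult_lt_0_compat; lra|].
repeat apply Rmult_le_compat_r; trivial; lra.
Qed.

(** * Sums over growing squares *)

(** Sum over - N <= m <= N; the indices are shifted as in the partial sums that define
    wp and wzeta, so that those are definitionally [box_sum]s. *)
Definition zsum (N : nat) (g : Z -> C) : C :=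
  sum_n (G := C_AbelianMonoid) (fun i => g (Z.of_nat i - Z.of_nat N)%Z) (2 * N).

Definition box_sum (N : nat) (g : Z -> Z -> C) : C :=
  zsum N (fun m => zsum N (g m)).

Lemma sum_n_head (g : nat -> C) (n : nat) :
  sum_n (G := C_AbelianMonoid) g (S n) =
  g 0%nat + sum_n (G := C_AbelianMonoid) (fun i => g (S i)) n.
Proof.
induction n as [|n IH].
- rewrite sum_Sn, !sum_O. reflexivity.
- rewrite sum_Sn, IH, (sum_Sn (fun i => g (S i))). symmetry. apply Cplus_assoc.
Qed.

Lemma zsum_0 (g : Z -> C) : zsum 0 g = g 0%Z.
Proof. unfold zsum. simpl. rewrite sum_O. reflexivity. Qed.

Lemma zsum_S (N : nat) (g : Z -> C) :
  zsum (S N) g = g (- Z.of_nat (S N))%Z + zsum N g + g (Z.of_nat (S N)).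
Proof.
unfold zsum. replace (2 * S N)%nat with (S (S (2 * N))) by lia.
rewrite sum_Sn, sum_n_head. change plus with Cplus.
rewrite (sum_n_ext (fun i => g (Z.of_nat (S i) - Z.of_nat (S N))%Z)
  (fun i => g (Z.of_nat i - Z.of_nat N)%Z)) by (intros; f_equal; lia).
replace (Z.of_nat (S (S (2 * N))) - Z.of_nat (S N))%Z with (Z.of_nat (S N)) by lia.
reflexivity.
Qed.

Lemma zsum_ext (N : nat) (g h : Z -> C) :
  (forall m, (Z.abs m <= Z.of_nat N)%Z -> g m = h m) -> zsum N g = zsum N h.
Proof.
induction N as [|N IH]; intros H.
- rewrite !zsum_0. apply H. lia.
- rewrite !zsum_S, IH, !H; trivial; try lia. intros m Hm. apply H. lia.
Qed.

Lemma zsum_plus (N : nat) (g h : Z -> C) :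
  zsum N (fun m => g m + h m) = zsum N g + zsum N h.
Proof.
induction N as [|N IH]; [now rewrite !zsum_0|]. rewrite !zsum_S, IH. ring.
Qed.

Lemma zsum_scal (N : nat) (c : C) (g : Z -> C) :
  zsum N (fun m => c * g m) = c * zsum N g.
Proof.
induction N as [|N IH]; [now rewrite !zsum_0|]. rewrite !zsum_S, IH. ring.
Qed.

Lemma zsum_rev (N : nat) (g : Z -> C) : zsum N (fun m => g (- m)%Z) = zsum N g.
Proof.
induction N as [|N IH]; [now rewrite !zsum_0|]. rewrite !zsum_S, IH, Z.opp_involutive. ring.
Qed.

Lemma zsum_telescope (N : nat) (g : Z -> C) :
  zsum N (fun m => g (m - 1)%Z - g m) = g (- Z.of_nat N - 1)%Z - g (Z.of_nat N).
Proof.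
induction N as [|N IH]; [now rewrite zsum_0|]. rewrite zsum_S, IH.
replace (Z.of_nat (S N) - 1)%Z with (Z.of_nat N) by lia.
replace (- Z.of_nat (S N))%Z with (- Z.of_nat N - 1)%Z by lia. ring.
Qed.

Lemma zsum_delta (N : nat) (c : C) :
  zsum N (fun m => if (m =? 0)%Z then c else 0) = c.
Proof.
induction N as [|N IH]; [now rewrite zsum_0|]. rewrite zsum_S, IH.
destruct (Z.eqb_spec (- Z.of_nat (S N)) 0); [lia|].
destruct (Z.eqb_spec (Z.of_nat (S N)) 0); [lia|]. ring.
Qed.

Lemma zsum_bound (N : nat) (g : Z -> C) (B : R) :
  (forall m, (Z.abs m <= Z.of_nat N)%Z -> (Cmod (g m) <= B)%R) ->
  (Cmod (zsum N g) <= (2 * INR N + 1) * B)%R.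
Proof.
induction N as [|N IH]; intros H.
- rewrite zsum_0. simpl. rewrite Rmult_0_r, Rplus_0_l, Rmult_1_l. apply H. lia.
- rewrite zsum_S, S_INR.
  assert (H1 := H (- Z.of_nat (S N))%Z ltac:(lia)).
  assert (H2 := H (Z.of_nat (S N)) ltac:(lia)).
  assert (H3 : (Cmod (zsum N g) <= (2 * INR N + 1) * B)%R).
  { apply IH. intros m Hm. apply H. lia. }
  eapply Rle_trans; [apply Cmod_triangle|].
  assert (H4 := Cmod_triangle (g (- Z.of_nat (S N))%Z) (zsum N g)). lra.
Qed.

Definition clim (u : nat -> C) (l : C) : Prop :=
  is_lim_seq (fun n => Re (u n)) (Re l) /\ is_lim_seq (fun n => Im (u n)) (Im l).

Lemma clim_C_lim_seq (u : nat -> C) (l : C) : clim u l -> C_lim_seq u = l.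
Proof.
intros [H1 H2]. unfold C_lim_seq.
rewrite (is_lim_seq_unique _ _ H1), (is_lim_seq_unique _ _ H2).
now destruct l.
Qed.

Lemma clim_unique (u : nat -> C) (l l' : C) : clim u l -> clim u l' -> l = l'.
Proof. intros H H'. now rewrite <- (clim_C_lim_seq _ _ H), (clim_C_lim_seq _ _ H'). Qed.

Lemma clim_ext (u v : nat -> C) (l : C) : (forall n, u n = v n) -> clim u l -> clim v l.
Proof.
intros E [H1 H2]. split.
- apply is_lim_seq_ext with (2 := H1). intros n. now rewrite E.
- apply is_lim_seq_ext with (2 := H2). intros n. now rewrite E.
Qed.

Lemma clim_const (c : C) : clim (fun _ => c) c.
Proof. split; apply is_lim_seq_const. Qed.

Lemma clim_plus (u v : nat -> C) (l k : C) :
  clim u l -> clim v k -> clim (fun n => u n + v n) (l + k).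
Proof.
intros [H1 H2] [K1 K2]. split.
- exact (is_lim_seq_plus' _ _ _ _ H1 K1).
- exact (is_lim_seq_plus' _ _ _ _ H2 K2).
Qed.

Lemma clim_scal (c : C) (u : nat -> C) (l : C) :
  clim u l -> clim (fun n => c * u n) (c * l).
Proof.
intros [H1 H2]. split.
- apply (is_lim_seq_minus' _ _ _ _ (is_lim_seq_scal_l _ (Re c) _ H1) (is_lim_seq_scal_l _ (Im c) _ H2)).
- apply (is_lim_seq_plus' _ _ _ _ (is_lim_seq_scal_l _ (Re c) _ H2) (is_lim_seq_scal_l _ (Im c) _ H1)).
Qed.

Lemma clim_minus (u v : nat -> C) (l k : C) :
  clim u l -> clim v k -> clim (fun n => u n - v n) (l - k).
Proof.
intros Hu Hv. replace (l - k) with (l + (- (1)) * k) by ring.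
apply clim_ext with (fun n => u n + (- (1)) * v n); [intros; ring|].
apply clim_plus; trivial. now apply clim_scal.
Qed.

Lemma clim_zero (u : nat -> C) (v : nat -> R) :
  (forall n, (Cmod (u n) <= v n)%R) -> is_lim_seq v 0%R -> clim u 0.
Proof.
intros H Hv.
assert (Hv' : is_lim_seq (fun n => (- v n)%R) 0%R).
{ rewrite <- Ropp_0. now apply is_lim_seq_opp in Hv. }
split; apply is_lim_seq_le_le with (2 := Hv') (3 := Hv); intros n.
- assert (K := re_le_Cmod (u n)). specialize (H n).
  apply Rabs_le_between. lra.
- assert (K := re_le_Cmod (- Ci * u n)). rewrite <- Im_Re in K.
  rewrite Cmod_mult, Cmod_opp, Cmod_Ci in K. specialize (H n).
  apply Rabs_le_between. lra.
Qed.

(** The factor 2 comes from bounding the two components separately. *)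
Lemma clim_bound (u : nat -> C) (l : C) (B : R) :
  clim u l -> (forall n, (Cmod (u n) <= B)%R) -> (Cmod l <= 2 * B)%R.
Proof.
intros [H1 H2] H.
destruct l as [a b]. eapply Rle_trans; [apply Cmod_le_sum|].
assert (K1 : (Rabs a <= B)%R).
{ assert (L := is_lim_seq_abs _ _ H1). simpl in L.
  refine (is_lim_seq_le (fun n => Rabs (Re (u n))) (fun _ => B) (Rabs a) B _ L (is_lim_seq_const B)).
  intros n. eapply Rle_trans; [apply re_le_Cmod|apply H]. }
assert (K2 : (Rabs b <= B)%R).
{ assert (L := is_lim_seq_abs _ _ H2). simpl in L.
  refine (is_lim_seq_le (fun n => Rabs (Im (u n))) (fun _ => B) (Rabs b) B _ L (is_lim_seq_const B)).
  intros n. rewrite Im_Re. eapply Rle_trans; [apply re_le_Cmod|].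
  rewrite Cmod_mult, Cmod_opp, Cmod_Ci, Rmult_1_l. apply H. }
lra.
Qed.

(** The shell of the lattice between two consecutive squares has O(N) points with
    terms O(N^-3), which gives increments O(N^-2). *)
Lemma clim_fast (u : nat -> C) (D : R) :
  (forall n, (Cmod (u (S n) - u n) <= D / ((INR n + 1) * (INR n + 1)))%R) ->
  (exists l, clim u l) /\ forall n, (Cmod (u n - u 0%nat) <= 2 * D)%R.
Proof.
intros H.
assert (D0 : (0 <= D)%R).
{ assert (K := Rle_trans _ _ _ (Cmod_ge_0 _) (H 0%nat)). simpl in K.
  replace (D / ((0 + 1) * (0 + 1)))%R with D in K by field. exact K. }
assert (T : forall n k, (Cmod (u (n + k)%nat - u n) <=
   2 * D * (/ (INR n + 1) - / (INR (n + k) + 1)))%R).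
{ intros n k. induction k as [|k IH].
  - rewrite Nat.add_0_r. replace (u n - u n) with (RtoC 0) by ring. rewrite Cmod_0. lra.
  - replace (n + S k)%nat with (S (n + k)) by lia. rewrite S_INR.
    replace (u (S (n + k)) - u n) with ((u (S (n + k)) - u (n + k)%nat) + (u (n + k)%nat - u n)) by ring.
    eapply Rle_trans; [apply Cmod_triangle|].
    specialize (H (n + k)%nat). set (x := INR (n + k)) in *.
    assert (x0 : (0 <= x)%R) by apply pos_INR.
    assert (D / ((x + 1) * (x + 1)) <= 2 * D * (/ (x + 1) - / (x + 1 + 1)))%R; [|lra].
    replace (2 * D * (/ (x + 1) - / (x + 1 + 1)))%R with (D * (2 / ((x + 1) * (x + 1 + 1))))%R by (field; lra).
    apply Rmult_le_compat_l; trivial.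
    replace (2 / ((x + 1) * (x + 1 + 1)))%R with (/ ((x + 1) * ((x + 1 + 1) / 2)))%R by (field; lra).
    apply Rinv_le_contravar; [apply Rmult_lt_0_compat; lra|].
    apply Rmult_le_compat_l; lra. }
split.
- assert (Cau : forall v : nat -> R,
    (forall n k, (Rabs (v (n + k)%nat - v n) <= Cmod (u (n + k)%nat - u n))%R) -> ex_finite_lim_seq v).
  { intros v Hv. apply ex_lim_seq_cauchy_corr. intros e.
    destruct (nfloor_ex (2 * D / e)%R) as [N [_ HN]].
    { apply Rmult_le_pos; [lra|]. apply Rlt_le, Rinv_0_lt_compat, cond_pos. }
    assert (K : forall n k, (N <= n)%nat -> (Rabs (v (n + k)%nat - v n) < e)%R).
    { intros n k Hn. eapply Rle_lt_trans; [apply Hv|]. eapply Rle_lt_trans; [apply T|].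
      assert (INR N <= INR n)%R by now apply le_INR.
      assert (0 < / (INR (n + k) + 1))%R by (apply Rinv_0_lt_compat; pose proof (pos_INR (n+k)); lra).
      apply Rle_lt_trans with (2 * D * / (INR N + 1))%R.
      - apply Rmult_le_compat_l; [lra|].
        assert (/ (INR n + 1) <= / (INR N + 1))%R; [|lra].
        apply Rinv_le_contravar; pose proof (pos_INR N); lra.
      - pose proof (pos_INR N). pose proof (cond_pos e).
        apply Rmult_lt_reg_r with (INR N + 1)%R; [lra|].
        rewrite Rmult_assoc, Rinv_l, Rmult_1_r by lra.
        apply Rmult_lt_reg_r with (/ e)%R; [now apply Rinv_0_lt_compat|].
        replace (e * (INR N + 1) * / e)%R with (INR N + 1)%R by (field; lra). exact HN. }
    exists N. intros n m Hn Hm. destruct (Nat.le_ge_cases n m) as [L|L].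
    - replace m with (n + (m - n))%nat by lia. rewrite Rabs_minus_sym. now apply K.
    - replace n with (m + (n - m))%nat by lia. now apply K. }
  destruct (Cau (fun n => Re (u n))) as [a Ha].
  { intros n k. apply (re_le_Cmod (u (n + k)%nat - u n)). }
  destruct (Cau (fun n => Im (u n))) as [b Hb].
  { intros n k. replace (Im (u (n + k)%nat) - Im (u n))%R with (Im (u (n + k)%nat - u n)) by reflexivity.
    rewrite Im_Re. eapply Rle_trans; [apply re_le_Cmod|].
    rewrite Cmod_mult, Cmod_opp, Cmod_Ci. lra. }
  exists (a, b). split; assumption.
- intros n. specialize (T 0%nat n). simpl in T. eapply Rle_trans; [exact T|].
  assert (0 < / (INR n + 1))%R by (apply Rinv_0_lt_compat; pose proof (pos_INR n); lra).
  rewrite Rplus_0_l, Rinv_1. rewrite <- (Rmult_1_r (2 * D)) at 2.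
  apply Rmult_le_compat_l; lra.
Qed.

(** Comparable to the modulus of m + n tau, and integer valued. *)
Definition zsize (m n : Z) : R := IZR (Z.abs m + Z.abs n).

Definition nonzero_index (m n : Z) : Prop := ((m =? 0) && (n =? 0))%Z%bool = false.

Lemma nonzero_index_zsize (m n : Z) : nonzero_index m n -> (1 <= zsize m n)%R.
Proof.
unfold nonzero_index, zsize. intros H. apply IZR_le.
destruct (Z.eqb_spec m 0); destruct (Z.eqb_spec n 0); simpl in H; try discriminate; lia.
Qed.

Lemma lattice_partial_sum_box (tau : C) (f : C -> C) (N : nat) :
  lattice_partial_sum tau f N = box_sum N (fun m n =>
    if ((m =? 0) && (n =? 0))%Z%bool then 0 else f (lattice_point tau m n)).
Proof. reflexivity. Qed.

Lemma box_sum_S (N : nat) (g : Z -> Z -> C) :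
  box_sum (S N) g = box_sum N g
   + (zsum (S N) (g (- Z.of_nat (S N))%Z) + zsum (S N) (g (Z.of_nat (S N)))
   + (zsum N (fun m => g m (- Z.of_nat (S N))%Z) + zsum N (fun m => g m (Z.of_nat (S N))))).
Proof.
unfold box_sum. rewrite zsum_S.
rewrite (zsum_ext N (fun m => zsum (S N) (g m))
  (fun m => (g m (- Z.of_nat (S N))%Z + zsum N (g m)) + g m (Z.of_nat (S N))))
  by (intros; apply zsum_S).
rewrite !zsum_plus. ring.
Qed.

(** The difference consists of four sides, each with at most 2 N + 3 points. *)
Lemma box_sum_bound_S (N : nat) (g : Z -> Z -> C) (K : R) :
  (forall m n, nonzero_index m n -> (Cmod (g m n) <= K / (zsize m n * zsize m n * zsize m n))%R) ->
  (Cmod (box_sum (S N) g - box_sum N g) <= (12 * K) / ((INR N + 1) * (INR N + 1)))%R.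
Proof.
intros H. rewrite box_sum_S.
match goal with |- (Cmod (?a + ?b - ?a) <= _)%R => replace (a + b - a) with b by ring end.
assert (K0 : (0 <= K)%R).
{ assert (k := Rle_trans _ _ _ (Cmod_ge_0 _) (H 1%Z 0%Z eq_refl)). unfold zsize in k; simpl in k.
  lra. }
set (x := (INR N + 1)%R). assert (x1 : (1 <= x)%R) by (unfold x; pose proof (pos_INR N); lra).
assert (B : forall m n, (x <= zsize m n)%R -> (Cmod (g m n) <= K / (x * x * x))%R).
{ intros m n Hs.
  assert (nz : nonzero_index m n).
  { unfold nonzero_index. destruct (Z.eqb_spec m 0); destruct (Z.eqb_spec n 0); trivial.
    subst. unfold zsize in Hs. simpl in Hs. lra. }
  apply Rle_trans with (1 := H m n nz). apply Rmult_le_compat_l; trivial.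
  apply Rinv_le_contravar; [repeat apply Rmult_lt_0_compat; lra|].
  repeat apply Rmult_le_compat; repeat apply Rmult_le_pos; lra. }
assert (Hx : x = IZR (Z.of_nat (S N))) by (unfold x; now rewrite <- S_INR, INR_IZR_INZ).
assert (B1 : (Cmod (zsum (S N) (g (- Z.of_nat (S N))%Z)) <= (2 * INR (S N) + 1) * (K / (x*x*x)))%R).
{ apply zsum_bound. intros m Hm. apply B. rewrite Hx. unfold zsize. apply IZR_le. lia. }
assert (B2 : (Cmod (zsum (S N) (g (Z.of_nat (S N)))) <= (2 * INR (S N) + 1) * (K / (x*x*x)))%R).
{ apply zsum_bound. intros m Hm. apply B. rewrite Hx. unfold zsize. apply IZR_le. lia. }
assert (B3 : (Cmod (zsum N (fun m => g m (- Z.of_nat (S N))%Z)) <= (2 * INR N + 1) * (K / (x*x*x)))%R).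
{ apply zsum_bound. intros m Hm. apply B. rewrite Hx. unfold zsize. apply IZR_le. lia. }
assert (B4 : (Cmod (zsum N (fun m => g m (Z.of_nat (S N)))) <= (2 * INR N + 1) * (K / (x*x*x)))%R).
{ apply zsum_bound. intros m Hm. apply B. rewrite Hx. unfold zsize. apply IZR_le. lia. }
rewrite S_INR in B1, B2. fold x in B1, B2.
replace (2 * INR N + 1)%R with (2 * x - 1)%R in B3, B4 by (unfold x; ring).
set (y := (K / (x * x * x))%R) in *.
assert (y0 : (0 <= y)%R).
{ apply Rmult_le_pos; trivial. apply Rlt_le, Rinv_0_lt_compat. repeat apply Rmult_lt_0_compat; lra. }
replace (12 * K / (x * x))%R with (12 * x * y)%R by (unfold y; field; lra).
assert (T := Cmod_triangle).
eapply Rle_trans; [apply T|].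
eapply Rle_trans; [apply Rplus_le_compat; apply T|].
assert (y <= x * y)%R by (rewrite <- (Rmult_1_l y) at 1; apply Rmult_le_compat_r; lra).
lra.
Qed.

(** The rate of decay common to all lattice sums in use; the constant is explicit because
    remainder estimates need a sum bounded by a multiple of it. *)
Definition lsummable (tau : C) (f : C -> C) (K : R) : Prop :=
  forall m n, nonzero_index m n ->
    (Cmod (f (lattice_point tau m n)) <= K / (zsize m n * zsize m n * zsize m n))%R.

Lemma lattice_sum_correct (tau : C) (f : C -> C) (K : R) :
  lsummable tau f K -> clim (lattice_partial_sum tau f) (lattice_sum tau f).
Proof.
intros H.
destruct (clim_fast (lattice_partial_sum tau f) (12 * K)) as [[l Hl] _].
{ intros n. rewrite !lattice_partial_sum_box. apply box_sum_bound_S.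
  intros m k Hmk. unfold nonzero_index in Hmk. rewrite Hmk. now apply H. }
unfold lattice_sum. now rewrite (clim_C_lim_seq _ _ Hl).
Qed.

Lemma lattice_sum_bound (tau : C) (f : C -> C) (K : R) :
  lsummable tau f K -> (Cmod (lattice_sum tau f) <= 48 * K)%R.
Proof.
intros H.
destruct (clim_fast (lattice_partial_sum tau f) (12 * K)) as [_ B].
{ intros n. rewrite !lattice_partial_sum_box. apply box_sum_bound_S.
  intros m k Hmk. unfold nonzero_index in Hmk. rewrite Hmk. now apply H. }
replace (48 * K)%R with (2 * (2 * (12 * K)))%R by ring.
apply (clim_bound _ _ _ (lattice_sum_correct _ _ _ H)).
intros n. specialize (B n).
replace (lattice_partial_sum tau f n) with (lattice_partial_sum tau f n - lattice_partial_sum tau f 0); trivial.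
replace (lattice_partial_sum tau f 0) with (RtoC 0); [ring|].
rewrite lattice_partial_sum_box. unfold box_sum. now rewrite !zsum_0.
Qed.

Lemma lattice_partial_sum_ext (tau : C) (f g : C -> C) (N : nat) :
  (forall m n, nonzero_index m n -> f (lattice_point tau m n) = g (lattice_point tau m n)) ->
  lattice_partial_sum tau f N = lattice_partial_sum tau g N.
Proof.
intros H. rewrite !lattice_partial_sum_box. unfold box_sum.
apply zsum_ext. intros m _. apply zsum_ext. intros n _.
destruct ((m =? 0) && (n =? 0))%Z%bool eqn:E; trivial. now apply H.
Qed.

Lemma lattice_partial_sum_plus (tau : C) (f g : C -> C) (N : nat) :
  lattice_partial_sum tau (fun w => f w + g w) N =
  lattice_partial_sum tau f N + lattice_partial_sum tau g N.
Proof.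
rewrite !lattice_partial_sum_box. unfold box_sum. rewrite <- zsum_plus.
apply zsum_ext. intros m _. rewrite <- zsum_plus. apply zsum_ext. intros n _.
destruct ((m =? 0) && (n =? 0))%Z%bool; trivial. ring.
Qed.

Lemma lattice_partial_sum_scal (tau : C) (c : C) (f : C -> C) (N : nat) :
  lattice_partial_sum tau (fun w => c * f w) N = c * lattice_partial_sum tau f N.
Proof.
rewrite !lattice_partial_sum_box. unfold box_sum. rewrite <- zsum_scal.
apply zsum_ext. intros m _. rewrite <- zsum_scal. apply zsum_ext. intros n _.
destruct ((m =? 0) && (n =? 0))%Z%bool; trivial. ring.
Qed.

(** Turns an identity between terms into an identity between sums; applied with r the
    Taylor remainder, it yields derivatives of sums. *)
Lemma lattice_sum_combination (tau a b : C) (f g k r : C -> C) (Kf Kg Kk Kr : R) :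
  lsummable tau f Kf -> lsummable tau g Kg -> lsummable tau k Kk -> lsummable tau r Kr ->
  (forall m n, nonzero_index m n -> let w := lattice_point tau m n in
     r w = f w + a * g w + b * k w) ->
  lattice_sum tau f + a * lattice_sum tau g + b * lattice_sum tau k = lattice_sum tau r.
Proof.
intros Hf Hg Hk Hr E. apply clim_unique with (lattice_partial_sum tau r).
2: now apply lattice_sum_correct with Kr.
apply clim_ext with (fun N => lattice_partial_sum tau f N + a * lattice_partial_sum tau g N
   + b * lattice_partial_sum tau k N).
- intros N. rewrite (lattice_partial_sum_ext tau r (fun w => f w + a * g w + b * k w)) by trivial.
  now rewrite !lattice_partial_sum_plus, !lattice_partial_sum_scal.
- apply clim_plus; [apply clim_plus; [|apply clim_scal]|apply clim_scal];
    eapply lattice_sum_correct; eassumption.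
Qed.

(** * Holomorphy of zeta and wp *)

Definition in_lattice (tau z : C) : Prop := exists m n, z = lattice_point tau m n.

(** The regular parts of zeta and wp at 0 are holomorphic here; unlike the complement of
    the lattice, this set contains 0. *)
Definition off_lattice0 (tau z : C) : Prop :=
  forall m n, nonzero_index m n -> z <> lattice_point tau m n.

Lemma lattice_norm (tau : C) : (0 < Im tau)%R ->
  exists k : R, (0 < k)%R /\ forall x y : R,
    (k * (Rabs x + Rabs y) <= Cmod (RtoC x + RtoC y * tau))%R.
Proof.
intros ht. pose (K := (1 + (1 + Cmod tau) / Im tau)%R).
assert (ct := Cmod_ge_0 tau).
assert (K1 : (0 <= (1 + Cmod tau) / Im tau)%R) by (apply Rlt_le, Rdiv_lt_0_compat; lra).
exists (/ K)%R. split; [apply Rinv_0_lt_compat; unfold K; lra|].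
intros x y. set (z := RtoC x + RtoC y * tau). assert (cz := Cmod_ge_0 z).
assert (hy : (Rabs y * Im tau <= Cmod z)%R).
{ replace (Rabs y * Im tau)%R with (Rabs (Im z)).
  - rewrite Im_Re. eapply Rle_trans; [apply re_le_Cmod|].
    rewrite Cmod_mult, Cmod_opp, Cmod_Ci. lra.
  - unfold z, Im, Cplus, Cmult, RtoC; simpl.
    replace (0 + (y * snd tau + 0 * fst tau))%R with (y * snd tau)%R by ring.
    rewrite Rabs_mult, (Rabs_right (snd tau)); trivial. unfold Im in ht. lra. }
assert (hx : (Rabs x <= Cmod z + Rabs y * Cmod tau)%R).
{ rewrite <- (Cmod_R x), <- (Cmod_R y), <- Cmod_mult.
  replace (RtoC x) with (z - RtoC y * tau) by (unfold z; ring).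
  eapply Rle_trans; [apply Cmod_triangle|]. rewrite Cmod_opp. lra. }
apply Rmult_le_reg_l with K; [unfold K; lra|].
rewrite <- Rmult_assoc, Rinv_r, Rmult_1_l by (unfold K; lra).
assert (hy2 : (Rabs y <= Cmod z / Im tau)%R).
{ apply Rmult_le_reg_r with (Im tau); trivial. unfold Rdiv. rewrite Rmult_assoc, Rinv_l; lra. }
unfold K. unfold Rdiv in *.
assert (Rabs y * Cmod tau <= Cmod z * / Im tau * Cmod tau)%R by (apply Rmult_le_compat_r; lra).
lra.
Qed.

Lemma lattice_point_norm (tau : C) : (0 < Im tau)%R ->
  exists k : R, (0 < k)%R /\ forall m n, (k * zsize m n <= Cmod (lattice_point tau m n))%R.
Proof.
intros ht. destruct (lattice_norm tau ht) as [k [k0 H]]. exists k. split; trivial.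
intros m n. specialize (H (IZR m) (IZR n)).
unfold zsize. rewrite plus_IZR, !abs_IZR. exact H.
Qed.

Lemma C_coordinates (tau z : C) : (0 < Im tau)%R ->
  exists x y : R, z = RtoC x + RtoC y * tau.
Proof.
intros ht. pose (y := (Im z / Im tau)%R). exists (Re z - y * Re tau)%R, y.
apply Re_Im_eq; unfold y, Re, Im, Cplus, Cmult, RtoC in *; simpl; field; lra.
Qed.

(** Reduces the distance to the lattice to one coordinate at a time. *)
Lemma dist_Z (x : R) : (exists m, x = IZR m) \/
  exists d : R, (0 < d)%R /\ forall m, (d <= Rabs (x - IZR m))%R.
Proof.
destruct (archimed x) as [h1 h2]. set (k := up x) in *.
destruct (Req_dec (IZR k - x) 1) as [e|e].
- left. exists (k - 1)%Z. rewrite minus_IZR. lra.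
- right. exists (Rmin (IZR k - x) (1 - (IZR k - x))). split; [apply Rmin_pos; lra|].
  intros m. destruct (Z_le_gt_dec k m) as [L|L].
  + apply IZR_le in L. rewrite Rabs_minus_sym, Rabs_right by lra.
    eapply Rle_trans; [apply Rmin_l|]. lra.
  + assert (L' : (m <= k - 1)%Z) by lia. apply IZR_le in L'. rewrite minus_IZR in L'.
    rewrite Rabs_right by lra. eapply Rle_trans; [apply Rmin_r|]. lra.
Qed.

Lemma off_lattice0_dist (tau p : C) : (0 < Im tau)%R -> off_lattice0 tau p ->
  exists d : R, (0 < d)%R /\ forall m n, nonzero_index m n -> (d <= Cmod (p - lattice_point tau m n))%R.
Proof.
intros ht Hp. destruct (lattice_norm tau ht) as [k [k0 H]].
destruct (C_coordinates tau p ht) as [x [y E]].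
assert (D : forall m n, (k * (Rabs (x - IZR m) + Rabs (y - IZR n)) <= Cmod (p - lattice_point tau m n))%R).
{ intros m n. replace (p - lattice_point tau m n) with (RtoC (x - IZR m) + RtoC (y - IZR n) * tau); auto.
  rewrite E. unfold lattice_point. rewrite !RtoC_minus. ring. }
destruct (dist_Z x) as [[m0 Em]|[d [d0 Hd]]].
- destruct (dist_Z y) as [[n0 En]|[d [d0 Hd]]].
  + assert (Z0 : ~ nonzero_index m0 n0).
    { intros nz. apply (Hp m0 n0 nz). rewrite E, Em, En. reflexivity. }
    exists k. split; trivial. intros m n nz. eapply Rle_trans; [|apply D].
    assert (m0 = 0%Z /\ n0 = 0%Z) as [-> ->].
    { unfold nonzero_index in Z0. destruct (Z.eqb_spec m0 0); destruct (Z.eqb_spec n0 0);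
      simpl in Z0; auto; now destruct Z0. }
    assert (s := nonzero_index_zsize m n nz). unfold zsize in s. rewrite plus_IZR, !abs_IZR in s.
    rewrite Em, En, !Rminus_0_l, !Rabs_Ropp. rewrite <- (Rmult_1_r k) at 1.
    apply Rmult_le_compat_l; lra.
  + exists (k * d)%R. split; [now apply Rmult_lt_0_compat|]. intros m n _.
    eapply Rle_trans; [|apply D]. apply Rmult_le_compat_l; [lra|].
    specialize (Hd n). pose proof (Rabs_pos (x - IZR m)). lra.
- exists (k * d)%R. split; [now apply Rmult_lt_0_compat|]. intros m n _.
  eapply Rle_trans; [|apply D]. apply Rmult_le_compat_l; [lra|].
  specialize (Hd m). pose proof (Rabs_pos (y - IZR n)). lra.
Qed.

(** Close to p, every nonzero lattice point w satisfies |z - w| >= k |w|: for large w this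
    is the triangle inequality, for the others the distance from p to w is bounded below. *)
Lemma off_lattice0_bound (tau p : C) : (0 < Im tau)%R -> off_lattice0 tau p ->
  exists d k : R, (0 < d)%R /\ (0 < k)%R /\ forall z, (Cmod (z - p) < d)%R ->
    forall m n, nonzero_index m n ->
      (k * zsize m n <= Cmod (z - lattice_point tau m n))%R.
Proof.
intros ht Hp. destruct (off_lattice0_dist tau p ht Hp) as [d [d0 Hd]].
destruct (lattice_point_norm tau ht) as [k [k0 Hk]].
pose (M := (2 * (Cmod p + d / 2))%R).
assert (cp := Cmod_ge_0 p). assert (M0 : (0 < M)%R) by (unfold M; lra).
assert (dM : (0 < d / 2 / M)%R) by (apply Rdiv_lt_0_compat; lra).
pose (c := Rmin (1/2) (d / 2 / M)).
assert (c0 : (0 < c)%R) by (apply Rmin_pos; lra).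
assert (c12 : (c <= 1/2)%R) by apply Rmin_l.
assert (c2 : (c <= d / 2 / M)%R) by apply Rmin_r.
exists (d / 2)%R, (c * k)%R. repeat split; [lra|now apply Rmult_lt_0_compat|].
intros z Hz m n nz. specialize (Hd m n nz). specialize (Hk m n).
set (w := lattice_point tau m n) in *. assert (cw := Cmod_ge_0 w).
apply Rle_trans with (c * Cmod w)%R.
{ rewrite Rmult_assoc. apply Rmult_le_compat_l; lra. }
destruct (Rle_lt_dec (Cmod w) M) as [L|L].
- apply Rle_trans with (d / 2)%R.
  + apply Rle_trans with (d / 2 / M * M)%R; [|right; field; lra].
    apply Rmult_le_compat; lra.
  + assert (T := Cmod_triangle (z - w) (- (z - p))).
    replace (z - w + - (z - p)) with (p - w) in T by ring. rewrite Cmod_opp in T. lra.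
- assert (T := Cmod_triangle (- (z - w)) ((z - p) + p)).
  replace (- (z - w) + ((z - p) + p)) with w in T by ring. rewrite Cmod_opp in T.
  assert (T' := Cmod_triangle (z - p) p).
  assert (c * Cmod w <= 1/2 * Cmod w)%R by (apply Rmult_le_compat_r; lra).
  unfold M in L. lra.
Qed.

Lemma off_lattice0_open (tau p : C) : (0 < Im tau)%R -> off_lattice0 tau p ->
  exists d : R, (0 < d)%R /\ forall z, (Cmod (z - p) < d)%R -> off_lattice0 tau z.
Proof.
intros ht Hp. destruct (off_lattice0_bound tau p ht Hp) as [d [k [d0 [k0 H]]]].
exists d. split; trivial. intros z Hz m n nz E. specialize (H z Hz m n nz).
rewrite <- E in H. replace (z - z) with (RtoC 0) in H by ring. rewrite Cmod_0 in H.
assert (s := nonzero_index_zsize m n nz).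
assert (0 < k * zsize m n)%R by (apply Rmult_lt_0_compat; lra). lra.
Qed.

Lemma off_lattice0_0 (tau : C) : (0 < Im tau)%R -> off_lattice0 tau 0.
Proof.
intros ht m n nz E. destruct (lattice_point_norm tau ht) as [k [k0 H]].
specialize (H m n). rewrite <- E, Cmod_0 in H. assert (s := nonzero_index_zsize m n nz).
assert (0 < k * zsize m n)%R by (apply Rmult_lt_0_compat; lra). lra.
Qed.

Lemma Cmod_inv3 (a b c : C) (k s : R) : (0 < k)%R -> (1 <= s)%R ->
  (k * s <= Cmod a)%R -> (k * s <= Cmod b)%R -> (k * s <= Cmod c)%R ->
  (Cmod (/ (a * b * c)) <= / (k * k * k) / (s * s * s))%R.
Proof.
intros k0 s1 Ha Hb Hc. assert (ks : (0 < k * s)%R) by (apply Rmult_lt_0_compat; lra).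
assert (a <> 0) by (apply Cmod_gt_0; lra). assert (b <> 0) by (apply Cmod_gt_0; lra).
assert (c <> 0) by (apply Cmod_gt_0; lra).
rewrite Cmod_inv, !Cmod_mult by (repeat apply Cmult_neq_0; auto).
replace (/ (k * k * k) / (s * s * s))%R with (/ ((k * s) * (k * s) * (k * s)))%R by (field; lra).
apply Rinv_le_contravar; [repeat apply Rmult_lt_0_compat; lra|].
repeat apply Rmult_le_compat; repeat apply Rmult_le_pos; lra.
Qed.

Lemma Cmod_inv4 (a b c e : C) (k s : R) : (0 < k)%R -> (1 <= s)%R ->
  (k * s <= Cmod a)%R -> (k * s <= Cmod b)%R -> (k * s <= Cmod c)%R -> (k * s <= Cmod e)%R ->
  (Cmod (/ (a * b * c * e)) <= / (k * k * k * k) / (s * s * s))%R.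
Proof.
intros k0 s1 Ha Hb Hc He. assert (ks : (0 < k * s)%R) by (apply Rmult_lt_0_compat; lra).
assert (Ha0 : a <> 0) by (apply Cmod_gt_0; lra). assert (Hb0 : b <> 0) by (apply Cmod_gt_0; lra).
assert (Hc0 : c <> 0) by (apply Cmod_gt_0; lra). assert (He0 : e <> 0) by (apply Cmod_gt_0; lra).
replace (/ (a * b * c * e)) with (/ (a * b * c) * / e) by (field; auto).
rewrite Cmod_mult.
replace (/ (k * k * k * k) / (s * s * s))%R with ((/ (k * k * k) / (s * s * s)) * / k)%R by (field; lra).
apply Rmult_le_compat; try apply Cmod_ge_0.
- now apply Cmod_inv3.
- rewrite Cmod_inv by trivial. apply Rinv_le_contravar; trivial.
  apply Rle_trans with (k * s)%R; trivial. rewrite <- (Rmult_1_r k) at 1. apply Rmult_le_compat_l; lra.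
Qed.

Definition zeta_reg (tau z : C) : C :=
  lattice_sum tau (fun w => 1 / (z - w) + 1 / w + z / (w * w)).
Definition wp_reg (tau z : C) : C :=
  lattice_sum tau (fun w => 1 / ((z - w) * (z - w)) - 1 / (w * w)).
(** Up to the factor -2, the regular part of the derivative of wp. *)
Definition eis3 (tau z : C) : C :=
  lattice_sum tau (fun w => 1 / ((z - w) * (z - w) * (z - w))).

Lemma local_setup (tau p : C) : (0 < Im tau)%R -> off_lattice0 tau p ->
  exists d k : R, (0 < d)%R /\ (0 < k)%R /\ forall m n, nonzero_index m n ->
    (1 <= zsize m n)%R /\
    (k * zsize m n <= Cmod (lattice_point tau m n))%R /\
    forall z, (Cmod (z - p) < d)%R -> (k * zsize m n <= Cmod (z - lattice_point tau m n))%R.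
Proof.
intros ht Hp. destruct (off_lattice0_bound tau p ht Hp) as [d [k [d0 [k0 H]]]].
destruct (lattice_point_norm tau ht) as [k' [k0' H']].
exists d, (Rmin k k'). repeat split; trivial.
- now apply Rmin_pos.
- now apply nonzero_index_zsize.
- eapply Rle_trans; [|apply H']. apply Rmult_le_compat_r; [|apply Rmin_r].
  pose proof (nonzero_index_zsize _ _ H0). lra.
- intros z Hz. eapply Rle_trans; [|apply H; eassumption]. apply Rmult_le_compat_r; [|apply Rmin_l].
  pose proof (nonzero_index_zsize _ _ H0). lra.
Qed.

Lemma pos_neq0 (a : C) (k s : R) : (0 < k)%R -> (1 <= s)%R -> (k * s <= Cmod a)%R -> a <> 0.
Proof.
intros k0 s1 H. apply Cmod_gt_0. assert (0 < k * s)%R by (apply Rmult_lt_0_compat; lra). lra.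
Qed.

Lemma self_ball (p : C) (d : R) : (0 < d)%R -> (Cmod (p - p) < d)%R.
Proof. intros d0. replace (p - p) with (RtoC 0) by ring. now rewrite Cmod_0. Qed.

Lemma zeta_reg_summable (tau p : C) : (0 < Im tau)%R -> off_lattice0 tau p ->
  exists K, lsummable tau (fun w => 1 / (p - w) + 1 / w + p / (w * w)) K.
Proof.
intros ht Hp. destruct (local_setup tau p ht Hp) as [d [k [d0 [k0 H]]]].
exists (Cmod p * Cmod p * / (k * k * k))%R. intros m n nz.
destruct (H m n nz) as [s1 [hw hz]]. specialize (hz p (self_ball p d d0)).
set (w := lattice_point tau m n) in *. set (s := zsize m n) in *.
assert (w0 := pos_neq0 _ _ _ k0 s1 hw). assert (z0 := pos_neq0 _ _ _ k0 s1 hz).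
replace (1 / (p - w) + 1 / w + p / (w * w)) with (p * p * / (w * w * (p - w))) by (field; auto).
rewrite !Cmod_mult.
replace (Cmod p * Cmod p * / (k * k * k) / (s * s * s))%R
  with (Cmod p * Cmod p * (/ (k * k * k) / (s * s * s)))%R by (unfold Rdiv; ring).
apply Rmult_le_compat_l; [apply Rmult_le_pos; apply Cmod_ge_0|].
now apply Cmod_inv3.
Qed.

Lemma wp_reg_summable (tau p : C) : (0 < Im tau)%R -> off_lattice0 tau p ->
  exists K, lsummable tau (fun w => 1 / ((p - w) * (p - w)) - 1 / (w * w)) K.
Proof.
intros ht Hp. destruct (local_setup tau p ht Hp) as [d [k [d0 [k0 H]]]].
exists (2 * Cmod p * / (k * k * k))%R. intros m n nz.
destruct (H m n nz) as [s1 [hw hz]]. specialize (hz p (self_ball p d d0)).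
set (w := lattice_point tau m n) in *. set (s := zsize m n) in *.
assert (w0 := pos_neq0 _ _ _ k0 s1 hw). assert (z0 := pos_neq0 _ _ _ k0 s1 hz).
replace (1 / ((p - w) * (p - w)) - 1 / (w * w))
  with (p * (/ (w * (p - w) * (p - w)) + - / (w * w * (p - w)))) by (field; auto).
rewrite !Cmod_mult.
assert (B1 := Cmod_inv3 w (p - w) (p - w) k s k0 s1 hw hz hz).
assert (B2 := Cmod_inv3 w w (p - w) k s k0 s1 hw hw hz).
assert (T := Cmod_triangle (/ (w * (p - w) * (p - w))) (- / (w * w * (p - w)))).
rewrite Cmod_opp in T.
replace (2 * Cmod p * / (k * k * k) / (s * s * s))%R with (Cmod p * (2 * (/ (k * k * k) / (s * s * s))))%R
  by (field; lra).
apply Rmult_le_compat_l; [apply Cmod_ge_0|lra].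
Qed.

Lemma eis3_summable (tau p : C) : (0 < Im tau)%R -> off_lattice0 tau p ->
  exists K, lsummable tau (fun w => 1 / ((p - w) * (p - w) * (p - w))) K.
Proof.
intros ht Hp. destruct (local_setup tau p ht Hp) as [d [k [d0 [k0 H]]]].
exists (/ (k * k * k))%R. intros m n nz.
destruct (H m n nz) as [s1 [hw hz]]. specialize (hz p (self_ball p d d0)).
unfold Cdiv. rewrite Cmult_1_l. now apply Cmod_inv3.
Qed.

Lemma zeta_reg_deriv (tau p : C) : (0 < Im tau)%R -> off_lattice0 tau p ->
  cderiv (zeta_reg tau) p (- wp_reg tau p).
Proof.
intros ht Hp. destruct (local_setup tau p ht Hp) as [d [k [d0 [k0 H]]]].
destruct (off_lattice0_open tau p ht Hp) as [d' [d0' Ho]].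
apply (cderiv_quadratic _ _ _ (Rmin d d') (48 * / (k * k * k))); [now apply Rmin_pos|].
intros z Hz.
assert (Hz1 := Rlt_le_trans _ _ _ Hz (Rmin_l _ _)).
assert (Hz2 := Ho z (Rlt_le_trans _ _ _ Hz (Rmin_r _ _))).
destruct (zeta_reg_summable tau z ht Hz2) as [K1 S1].
destruct (zeta_reg_summable tau p ht Hp) as [K2 S2].
destruct (wp_reg_summable tau p ht Hp) as [K3 S3].
(* second-order Taylor remainder of 1 / (z - w) at p *)
pose (r := fun w => (z - p) * (z - p) * / ((z - w) * (p - w) * (p - w))).
assert (Sr : lsummable tau r (Cmod (z - p) * Cmod (z - p) * / (k * k * k))).
{ intros m n nz. destruct (H m n nz) as [s1 [hw hz]].
  assert (hp := hz p (self_ball p d d0)). specialize (hz z Hz1).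
  unfold r. set (s := zsize m n) in *. rewrite !Cmod_mult.
  replace (Cmod (z - p) * Cmod (z - p) * / (k * k * k) / (s * s * s))%R
    with (Cmod (z - p) * Cmod (z - p) * (/ (k * k * k) / (s * s * s)))%R by (unfold Rdiv; ring).
  apply Rmult_le_compat_l; [apply Rmult_le_pos; apply Cmod_ge_0|].
  now apply Cmod_inv3. }
replace (zeta_reg tau z - zeta_reg tau p - (z - p) * - wp_reg tau p)
  with (zeta_reg tau z + (- (1)) * zeta_reg tau p + (z - p) * wp_reg tau p) by ring.
unfold zeta_reg, wp_reg.
rewrite (lattice_sum_combination tau _ _ _ _ _ r _ _ _ _ S1 S2 S3 Sr).
- eapply Rle_trans; [apply (lattice_sum_bound _ _ _ Sr)|]. right; ring.
- intros m n nz w. destruct (H m n nz) as [s1 [hw hz]].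
  assert (hp := hz p (self_ball p d d0)). specialize (hz z Hz1). fold w in hw, hz, hp.
  assert (w0 := pos_neq0 _ _ _ k0 s1 hw). assert (z0 := pos_neq0 _ _ _ k0 s1 hz).
  assert (p0 := pos_neq0 _ _ _ k0 s1 hp). unfold r. field. auto.
Qed.

Lemma wp_reg_deriv (tau p : C) : (0 < Im tau)%R -> off_lattice0 tau p ->
  cderiv (wp_reg tau) p (- (2) * eis3 tau p).
Proof.
intros ht Hp. destruct (local_setup tau p ht Hp) as [d [k [d0 [k0 H]]]].
destruct (off_lattice0_open tau p ht Hp) as [d' [d0' Ho]].
apply (cderiv_quadratic _ _ _ (Rmin d d') (48 * (3 * / (k * k * k * k)))); [now apply Rmin_pos|].
intros z Hz.
assert (Hz1 := Rlt_le_trans _ _ _ Hz (Rmin_l _ _)).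
assert (Hz2 := Ho z (Rlt_le_trans _ _ _ Hz (Rmin_r _ _))).
destruct (wp_reg_summable tau z ht Hz2) as [K1 S1].
destruct (wp_reg_summable tau p ht Hp) as [K2 S2].
destruct (eis3_summable tau p ht Hp) as [K3 S3].
pose (r := fun w => (z - p) * (z - p) *
   (/ ((z - w) * (z - w) * (p - w) * (p - w)) + (/ ((z - w) * (p - w) * (p - w) * (p - w))
     + / ((z - w) * (p - w) * (p - w) * (p - w))))).
assert (Sr : lsummable tau r (Cmod (z - p) * Cmod (z - p) * (3 * / (k * k * k * k)))).
{ intros m n nz. destruct (H m n nz) as [s1 [hw hz]].
  assert (hp := hz p (self_ball p d d0)). specialize (hz z Hz1).
  unfold r. rewrite (Cmod_mult ((z - p) * (z - p))), (Cmod_mult (z - p)).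
  set (s := zsize m n) in *.
  replace (Cmod (z - p) * Cmod (z - p) * (3 * / (k * k * k * k)) / (s * s * s))%R
    with (Cmod (z - p) * Cmod (z - p) * (3 * (/ (k * k * k * k) / (s * s * s))))%R by (unfold Rdiv; ring).
  apply Rmult_le_compat_l; [apply Rmult_le_pos; apply Cmod_ge_0|].
  set (w := lattice_point tau m n) in *.
  assert (B1 := Cmod_inv4 (z - w) (z - w) (p - w) (p - w) k _ k0 s1 hz hz hp hp).
  assert (B2 := Cmod_inv4 (z - w) (p - w) (p - w) (p - w) k _ k0 s1 hz hp hp hp).
  eapply Rle_trans; [apply Cmod_triangle|].
  eapply Rle_trans; [apply Rplus_le_compat_l; apply Cmod_triangle|]. lra. }
replace (wp_reg tau z - wp_reg tau p - (z - p) * (- (2) * eis3 tau p))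
  with (wp_reg tau z + (- (1)) * wp_reg tau p + (2 * (z - p)) * eis3 tau p) by ring.
unfold eis3, wp_reg.
rewrite (lattice_sum_combination tau _ _ _ _ _ r _ _ _ _ S1 S2 S3 Sr).
- eapply Rle_trans; [apply (lattice_sum_bound _ _ _ Sr)|]. right; ring.
- intros m n nz w. destruct (H m n nz) as [s1 [hw hz]].
  assert (hp := hz p (self_ball p d d0)). specialize (hz z Hz1). fold w in hw, hz, hp.
  assert (w0 := pos_neq0 _ _ _ k0 s1 hw). assert (z0 := pos_neq0 _ _ _ k0 s1 hz).
  assert (p0 := pos_neq0 _ _ _ k0 s1 hp). unfold r. field. auto.
Qed.

Lemma eis3_cont (tau p : C) : (0 < Im tau)%R -> off_lattice0 tau p -> ccont (eis3 tau) p.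
Proof.
intros ht Hp. destruct (local_setup tau p ht Hp) as [d [k [d0 [k0 H]]]].
destruct (off_lattice0_open tau p ht Hp) as [d' [d0' Ho]].
pose (M := (48 * (3 * / (k * k * k * k)))%R).
assert (M0 : (0 < M)%R).
{ unfold M. repeat apply Rmult_lt_0_compat; try lra. apply Rinv_0_lt_compat. repeat apply Rmult_lt_0_compat; lra. }
intros e e0.
exists (Rmin (e / M) (Rmin d d')).
split; [repeat apply Rmin_pos; trivial; now apply Rdiv_lt_0_compat|].
intros z Hz. assert (Hz0 := Rlt_le_trans _ _ _ Hz (Rmin_l _ _)).
assert (Hz' := Rlt_le_trans _ _ _ Hz (Rmin_r _ _)).
assert (Hz1 := Rlt_le_trans _ _ _ Hz' (Rmin_l _ _)).
assert (Hz2 := Ho z (Rlt_le_trans _ _ _ Hz' (Rmin_r _ _))).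
destruct (eis3_summable tau z ht Hz2) as [K1 S1].
destruct (eis3_summable tau p ht Hp) as [K2 S2].
pose (r := fun w => - (z - p) *
   (/ ((z - w) * (z - w) * (z - w) * (p - w)) + (/ ((z - w) * (z - w) * (p - w) * (p - w))
     + / ((z - w) * (p - w) * (p - w) * (p - w))))).
assert (Sr : lsummable tau r (Cmod (z - p) * (3 * / (k * k * k * k)))).
{ intros m n nz. destruct (H m n nz) as [s1 [hw hz]].
  assert (hp := hz p (self_ball p d d0)). specialize (hz z Hz1).
  unfold r. rewrite (Cmod_mult (- (z - p))), Cmod_opp.
  set (s := zsize m n) in *.
  replace (Cmod (z - p) * (3 * / (k * k * k * k)) / (s * s * s))%R
    with (Cmod (z - p) * (3 * (/ (k * k * k * k) / (s * s * s))))%R by (unfold Rdiv; ring).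
  apply Rmult_le_compat_l; [apply Cmod_ge_0|].
  set (w := lattice_point tau m n) in *.
  assert (B1 := Cmod_inv4 (z - w) (z - w) (z - w) (p - w) k _ k0 s1 hz hz hz hp).
  assert (B2 := Cmod_inv4 (z - w) (z - w) (p - w) (p - w) k _ k0 s1 hz hz hp hp).
  assert (B3 := Cmod_inv4 (z - w) (p - w) (p - w) (p - w) k _ k0 s1 hz hp hp hp).
  eapply Rle_trans; [apply Cmod_triangle|].
  eapply Rle_trans; [apply Rplus_le_compat_l; apply Cmod_triangle|]. lra. }
replace (eis3 tau z - eis3 tau p) with (eis3 tau z + (- (1)) * eis3 tau p + 0 * eis3 tau p) by ring.
unfold eis3.
rewrite (lattice_sum_combination tau _ _ _ _ _ r _ _ _ _ S1 S2 S2 Sr).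
- eapply Rle_lt_trans; [apply (lattice_sum_bound _ _ _ Sr)|].
  replace (48 * (Cmod (z - p) * (3 * / (k * k * k * k))))%R with (M * Cmod (z - p))%R by (unfold M; ring).
  replace e with (M * (e / M))%R by (field; lra). now apply Rmult_lt_compat_l.
- intros m n nz w. destruct (H m n nz) as [s1 [hw hz]].
  assert (hp := hz p (self_ball p d d0)). specialize (hz z Hz1). fold w in hw, hz, hp.
  assert (w0 := pos_neq0 _ _ _ k0 s1 hw). assert (z0 := pos_neq0 _ _ _ k0 s1 hz).
  assert (p0 := pos_neq0 _ _ _ k0 s1 hp). unfold r. field. auto.
Qed.

(** * Oddness and quasi-periods of zeta *)

Lemma lattice_point_add (tau : C) (m n m' n' : Z) :
  lattice_point tau (m + m') (n + n') = lattice_point tau m n + lattice_point tau m' n'.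
Proof. unfold lattice_point. rewrite !plus_IZR, !RtoC_plus. ring. Qed.

Lemma lattice_point_opp (tau : C) (m n : Z) :
  lattice_point tau (- m) (- n) = - lattice_point tau m n.
Proof. unfold lattice_point. rewrite !opp_IZR, !RtoC_opp. ring. Qed.

Lemma lattice_point_0 (tau : C) : lattice_point tau 0 0 = 0.
Proof. unfold lattice_point. ring. Qed.

Lemma not_lattice_off (tau z : C) : ~ in_lattice tau z -> off_lattice0 tau z.
Proof. intros H m n _ E. apply H. now exists m, n. Qed.

Lemma not_lattice_0 (tau z : C) : ~ in_lattice tau z -> z <> 0.
Proof. intros H E. apply H. exists 0%Z, 0%Z. now rewrite lattice_point_0. Qed.

Lemma not_lattice_add (tau z : C) (m n : Z) :
  ~ in_lattice tau z -> ~ in_lattice tau (z + lattice_point tau m n).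
Proof.
intros H [m' [n' E]]. apply H. exists (m' + - m)%Z, (n' + - n)%Z.
rewrite lattice_point_add, lattice_point_opp, <- E. ring.
Qed.

Lemma off_lattice0_opp (tau z : C) : off_lattice0 tau z -> off_lattice0 tau (- z).
Proof.
intros H m n nz E. apply (H (- m)%Z (- n)%Z).
- unfold nonzero_index in *. destruct (Z.eqb_spec m 0); destruct (Z.eqb_spec n 0);
  destruct (Z.eqb_spec (-m) 0); destruct (Z.eqb_spec (-n) 0); simpl in *; trivial; lia.
- rewrite lattice_point_opp, <- E. ring.
Qed.

Lemma wzeta_split (tau z : C) : wzeta tau z = 1 / z + zeta_reg tau z.
Proof. reflexivity. Qed.

Lemma wp_split (tau z : C) : wp tau z = 1 / (z * z) + wp_reg tau z.
Proof. reflexivity. Qed.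

(** Its continuity is what the mean value property below needs of wp. *)
Definition wp' (tau z : C) : C := - (2) * (1 / (z * z * z) + eis3 tau z).

Lemma wzeta_deriv (tau z : C) : (0 < Im tau)%R -> ~ in_lattice tau z ->
  cderiv (wzeta tau) z (- wp tau z).
Proof.
intros ht Hz. assert (z0 := not_lattice_0 _ _ Hz).
apply (cderiv_ext (fun w => / w + zeta_reg tau w)).
{ intros w. rewrite wzeta_split. unfold Cdiv. ring. }
apply (cderiv_eq _ _ (- / (z * z) + - wp_reg tau z)).
{ rewrite wp_split. unfold Cdiv. ring. }
apply cderiv_plus; [now apply cderiv_inv|].
apply zeta_reg_deriv; trivial. now apply not_lattice_off.
Qed.

Lemma wp_deriv (tau z : C) : (0 < Im tau)%R -> ~ in_lattice tau z ->
  cderiv (wp tau) z (wp' tau z).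
Proof.
intros ht Hz. assert (z0 := not_lattice_0 _ _ Hz).
apply (cderiv_ext (fun w => / w * / w + wp_reg tau w)).
{ intros w. rewrite wp_split. unfold Cdiv. f_equal.
  destruct (Ceq_dec w 0) as [->|w0]; [|field; trivial].
  replace (0 * 0) with (RtoC 0) by ring.
  replace (/ 0) with (RtoC 0); [ring|].
  unfold Cinv, RtoC; simpl. f_equal; unfold Rdiv; ring. }
apply (cderiv_eq _ _ ((- / (z * z) * / z + / z * - / (z * z)) + - (2) * eis3 tau z)).
{ unfold wp'. field. trivial. }
apply cderiv_plus.
- apply (cderiv_mult Cinv Cinv); now apply cderiv_inv.
- apply wp_reg_deriv; trivial. now apply not_lattice_off.
Qed.

Lemma wp'_cont (tau z : C) : (0 < Im tau)%R -> ~ in_lattice tau z -> ccont (wp' tau) z.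
Proof.
intros ht Hz. assert (z0 := not_lattice_0 _ _ Hz). unfold wp'.
apply ccont_mult; [apply ccont_const|]. apply ccont_plus.
- assert (N : z * z * z <> 0) by (repeat apply Cmult_neq_0; trivial).
  apply (cderiv_ccont _ _ (((1 * z + z * 1) * z + z * z * 1) * - / (z * z * z * (z * z * z)))).
  apply (cderiv_ext (fun w => / (w * w * w))); [intros; unfold Cdiv; ring|].
  apply (cderiv_comp Cinv (fun w => w * w * w)); [|now apply cderiv_inv].
  apply (cderiv_mult (fun w => w * w) (fun w => w)); [|apply cderiv_id].
  apply (cderiv_mult (fun w => w) (fun w => w)); apply cderiv_id.
- apply eis3_cont; trivial. now apply not_lattice_off.
Qed.

Lemma zeta_reg_lim (tau z : C) : (0 < Im tau)%R -> off_lattice0 tau z ->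
  clim (lattice_partial_sum tau (fun w => 1 / (z - w) + 1 / w + z / (w * w))) (zeta_reg tau z).
Proof.
intros ht Hz. destruct (zeta_reg_summable tau z ht Hz) as [K HK].
apply lattice_sum_correct with (1 := HK).
Qed.

Lemma lattice_nz (tau : C) (m n : Z) : (0 < Im tau)%R -> nonzero_index m n -> lattice_point tau m n <> 0.
Proof. intros ht nz E. apply (off_lattice0_0 tau ht m n nz). now symmetry. Qed.

Lemma zeta_reg_odd (tau z : C) : (0 < Im tau)%R -> off_lattice0 tau z ->
  zeta_reg tau (- z) = - zeta_reg tau z.
Proof.
intros ht Hz.
apply clim_unique with (1 := zeta_reg_lim tau (- z) ht (off_lattice0_opp _ _ Hz)).
replace (- zeta_reg tau z) with ((- (1)) * zeta_reg tau z) by ring.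
refine (clim_ext _ _ _ _ (clim_scal (- (1)) _ _ (zeta_reg_lim tau z ht Hz))).
intros N. rewrite <- lattice_partial_sum_scal, !lattice_partial_sum_box. unfold box_sum.
rewrite <- zsum_rev. apply zsum_ext. intros m _. rewrite <- zsum_rev. apply zsum_ext. intros n _.
assert (E : ((- m =? 0) && (- n =? 0))%Z%bool = ((m =? 0) && (n =? 0))%Z%bool).
{ f_equal; apply Bool.eq_iff_eq_true; rewrite !Z.eqb_eq; lia. }
rewrite E. destruct ((m =? 0) && (n =? 0))%Z%bool eqn:E'; trivial.
rewrite lattice_point_opp. assert (w0 := lattice_nz tau m n ht E').
assert (Hw := Hz (-m)%Z (-n)%Z E). rewrite lattice_point_opp in Hw.
set (w := lattice_point tau m n) in *.
assert (z + w <> 0). { intros e. apply Hw. replace z with ((z + w) - w) by ring. rewrite e. ring. }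
assert (- z - w <> 0). { intros e. apply Hw. replace z with (- (- z - w) - w) by ring. rewrite e. ring. }
field. repeat split; trivial.
now replace (z - - w) with (z + w) by ring.
Qed.

Lemma wzeta_odd (tau z : C) : (0 < Im tau)%R -> ~ in_lattice tau z ->
  wzeta tau (- z) = - wzeta tau z.
Proof.
intros ht Hz. rewrite !wzeta_split, zeta_reg_odd by (trivial; now apply not_lattice_off).
assert (z0 := not_lattice_0 _ _ Hz). field. trivial.
Qed.

(** The partial sums leave out the origin, whose term is the principal part; telescoping
    needs it. *)
Lemma box_sum_origin (N : nat) (g : Z -> Z -> C) :
  box_sum N g = g 0%Z 0%Z +
    box_sum N (fun m n => if ((m =? 0) && (n =? 0))%Z%bool then 0 else g m n).
Proof.
assert (E : box_sum N (fun m n => if (m =? 0)%Z then (if (n =? 0)%Z then g 0%Z 0%Z else 0) else 0) = g 0%Z 0%Z).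
{ unfold box_sum.
  rewrite (zsum_ext N _ (fun m => if (m =? 0)%Z then g 0%Z 0%Z else 0)).
  - apply zsum_delta.
  - intros m _. destruct (m =? 0)%Z; [apply zsum_delta|].
    rewrite (zsum_ext N _ (fun n => 0 * 0)) by (intros; ring). rewrite zsum_scal. ring. }
rewrite <- E at 1. unfold box_sum. rewrite <- zsum_plus. apply zsum_ext. intros m _.
rewrite <- zsum_plus. apply zsum_ext. intros n _.
destruct (Z.eqb_spec m 0); destruct (Z.eqb_spec n 0); simpl; subst; ring.
Qed.

Lemma kernel_bound (tau z z' : C) : (0 < Im tau)%R -> ~ in_lattice tau z -> ~ in_lattice tau z' ->
  exists K : R, (0 <= K)%R /\ forall m n (x : R), (1 <= x)%R -> (x <= zsize m n)%R ->
    (Cmod (1 / (z - lattice_point tau m n) - 1 / (z' - lattice_point tau m n)) <= K / (x * x))%R.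
Proof.
intros ht Hz Hz'.
destruct (local_setup tau z ht (not_lattice_off _ _ Hz)) as [d [k [d0 [k0 H]]]].
destruct (local_setup tau z' ht (not_lattice_off _ _ Hz')) as [d' [k' [d0' [k0' H']]]].
exists (Cmod (z' - z) * / (k * k'))%R. split.
{ apply Rmult_le_pos; [apply Cmod_ge_0|]. apply Rlt_le, Rinv_0_lt_compat. now apply Rmult_lt_0_compat. }
intros m n x x1 Hx.
assert (nz : nonzero_index m n).
{ unfold nonzero_index. destruct (Z.eqb_spec m 0); destruct (Z.eqb_spec n 0); trivial.
  subst. unfold zsize in Hx. simpl in Hx. lra. }
destruct (H m n nz) as [s1 [_ hz]]. specialize (hz z (self_ball z d d0)).
destruct (H' m n nz) as [_ [_ hz']]. specialize (hz' z' (self_ball z' d' d0')).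
set (w := lattice_point tau m n) in *.
assert (a0 := pos_neq0 _ _ _ k0 s1 hz). assert (b0 := pos_neq0 _ _ _ k0' s1 hz').
replace (1 / (z - w) - 1 / (z' - w)) with ((z' - z) * / ((z - w) * (z' - w))) by (field; auto).
rewrite Cmod_mult, Cmod_inv, Cmod_mult by (apply Cmult_neq_0; trivial).
unfold Rdiv. rewrite Rmult_assoc. apply Rmult_le_compat_l; [apply Cmod_ge_0|].
rewrite <- Rinv_mult.
assert (kx : (k * x <= k * zsize m n)%R) by (apply Rmult_le_compat_l; lra).
assert (kx' : (k' * x <= k' * zsize m n)%R) by (apply Rmult_le_compat_l; lra).
assert (p1 : (0 < k * x)%R) by (apply Rmult_lt_0_compat; lra).
assert (p2 : (0 < k' * x)%R) by (apply Rmult_lt_0_compat; lra).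
replace (k * k' * (x * x))%R with (k * x * (k' * x))%R by ring.
apply Rinv_le_contravar; [now apply Rmult_lt_0_compat|].
apply Rmult_le_compat; lra.
Qed.

(** In the difference of the two increments the convergence-producing terms cancel and
    the partial sums telescope; what is left is a sum of O(N) boundary terms of size O(N^-2). *)
Lemma wzeta_increment (tau w z z' : C) : (0 < Im tau)%R ->
  (w = 1 \/ w = tau) -> ~ in_lattice tau z -> ~ in_lattice tau z' ->
  wzeta tau (z + w) - wzeta tau z = wzeta tau (z' + w) - wzeta tau z'.
Proof.
intros ht Hw Hz Hz'.
assert (Ew : exists a b, w = lattice_point tau a b).
{ destruct Hw as [->| ->]; [exists 1%Z, 0%Z|exists 0%Z, 1%Z]; unfold lattice_point; ring. }
destruct Ew as [a [b Ew]].
assert (Hzw : ~ in_lattice tau (z + w)) by (rewrite Ew; now apply not_lattice_add).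
assert (Hzw' : ~ in_lattice tau (z' + w)) by (rewrite Ew; now apply not_lattice_add).
pose (k := fun m n => 1 / (z - lattice_point tau m n) - 1 / (z' - lattice_point tau m n)).
pose (kw := fun m n => 1 / (z + w - lattice_point tau m n) - 1 / (z' + w - lattice_point tau m n)).
destruct (kernel_bound tau z z' ht Hz Hz') as [K [K0 HK]].
assert (L : clim (fun N => box_sum N (fun m n => kw m n - k m n))
  ((wzeta tau (z + w) - wzeta tau z) - (wzeta tau (z' + w) - wzeta tau z'))).
{ assert (L0 := fun u Hu => zeta_reg_lim tau u ht (not_lattice_off _ u Hu)).
  assert (L1 := clim_minus _ _ _ _ (clim_minus _ _ _ _ (L0 _ Hzw) (L0 _ Hz))
     (clim_minus _ _ _ _ (L0 _ Hzw') (L0 _ Hz'))).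
  assert (L2 := clim_plus _ _ _ _ (clim_const (kw 0%Z 0%Z - k 0%Z 0%Z)) L1).
  replace (wzeta tau (z + w) - wzeta tau z - (wzeta tau (z' + w) - wzeta tau z')) with
   (kw 0%Z 0%Z - k 0%Z 0%Z + (zeta_reg tau (z + w) - zeta_reg tau z - (zeta_reg tau (z' + w) - zeta_reg tau z'))).
  2:{ rewrite !wzeta_split. unfold kw, k. rewrite lattice_point_0.
      replace (z + w - 0) with (z + w) by ring. replace (z' + w - 0) with (z' + w) by ring.
      replace (z - 0) with z by ring. replace (z' - 0) with z' by ring. unfold Cdiv. ring. }
  apply clim_ext with (2 := L2). intros N. rewrite (box_sum_origin N (fun m n => kw m n - k m n)). f_equal.
  replace (lattice_partial_sum tau (fun w0 => 1 / (z + w - w0) + 1 / w0 + (z + w) / (w0 * w0)) N -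
    lattice_partial_sum tau (fun w0 => 1 / (z - w0) + 1 / w0 + z / (w0 * w0)) N -
    (lattice_partial_sum tau (fun w0 => 1 / (z' + w - w0) + 1 / w0 + (z' + w) / (w0 * w0)) N -
     lattice_partial_sum tau (fun w0 => 1 / (z' - w0) + 1 / w0 + z' / (w0 * w0)) N))
  with (lattice_partial_sum tau (fun w0 => 1 / (z + w - w0) + 1 / w0 + (z + w) / (w0 * w0)) N +
    (- (1)) * lattice_partial_sum tau (fun w0 => 1 / (z - w0) + 1 / w0 + z / (w0 * w0)) N +
    ((- (1)) * lattice_partial_sum tau (fun w0 => 1 / (z' + w - w0) + 1 / w0 + (z' + w) / (w0 * w0)) N +
     lattice_partial_sum tau (fun w0 => 1 / (z' - w0) + 1 / w0 + z' / (w0 * w0)) N)) by ring.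
  rewrite <- !lattice_partial_sum_scal, <- !lattice_partial_sum_plus, lattice_partial_sum_box.
  unfold box_sum. apply zsum_ext. intros m _. apply zsum_ext. intros n _.
  destruct ((m =? 0) && (n =? 0))%Z%bool eqn:nz; trivial.
  unfold kw, k. unfold Cdiv. ring. }
enough (Z0 : clim (fun N => box_sum N (fun m n => kw m n - k m n)) 0).
{ assert (E := clim_unique _ _ _ L Z0).
  replace (wzeta tau (z + w) - wzeta tau z) with
   ((wzeta tau (z + w) - wzeta tau z - (wzeta tau (z' + w) - wzeta tau z')) + (wzeta tau (z' + w) - wzeta tau z')) by ring.
  rewrite E. ring. }
assert (lim0 : is_lim_seq (fun N => 8 * K * / (INR N + 1))%R 0%R).
{ replace (Finite 0%R) with (Rbar_mult (8 * K)%R 0%R) by (simpl; f_equal; ring).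
  apply is_lim_seq_scal_l.
  apply (is_lim_seq_ext (fun N => / INR (S N))%R); [intros; now rewrite S_INR|].
  apply (is_lim_seq_incr_1 (fun N => / INR N)%R).
  replace (Finite 0%R) with (Rbar_inv p_infty) by reflexivity.
  apply is_lim_seq_inv; [apply is_lim_seq_INR|discriminate]. }
(* the bound O(1/N) holds from N = 1 on, so the sequence is shifted by one *)
assert (Bd : forall N, (Cmod (box_sum (S N) (fun m n => kw m n - k m n)%C) <= 8 * K * / (INR N + 1))%R).
{ intros N. set (x := (INR N + 1)%R).
  assert (x1 : (1 <= x)%R) by (unfold x; pose proof (pos_INR N); lra).
  assert (Hx : x = IZR (Z.of_nat (S N))) by (unfold x; now rewrite <- S_INR, INR_IZR_INZ).
  assert (Kx0 : (0 <= K / (x * x))%R).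
  { apply Rmult_le_pos; trivial. apply Rlt_le, Rinv_0_lt_compat. apply Rmult_lt_0_compat; lra. }
  apply Rle_trans with ((2 * INR (S N) + 1) * (2 * (K / (x * x))))%R.
  2:{ rewrite S_INR. fold x. replace (8 * K * / x)%R with (8 * x * (K / (x * x)))%R by (field; lra).
      assert (0 <= (x - 1) * (K / (x * x)))%R by (apply Rmult_le_pos; lra). lra. }
  destruct Hw as [Hw|Hw].
  - assert (E : box_sum (S N) (fun m n => kw m n - k m n) =
      zsum (S N) (fun n => k (- Z.of_nat (S N) - 1)%Z n) - zsum (S N) (fun n => k (Z.of_nat (S N)) n)).
    { unfold box_sum. rewrite <- (zsum_telescope (S N) (fun m => zsum (S N) (fun n => k m n))).
      apply zsum_ext. intros m _.
      replace (zsum (S N) (fun n => k (m - 1)%Z n) - zsum (S N) (fun n => k m n)) with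
       (zsum (S N) (fun n => k (m - 1)%Z n) + (- (1)) * zsum (S N) (fun n => k m n)) by ring.
      rewrite <- zsum_scal, <- zsum_plus. apply zsum_ext. intros n _.
      replace (kw m n) with (k (m - 1)%Z n); [ring|].
      unfold kw, k. rewrite Hw.
      replace (lattice_point tau (m - 1) n) with (lattice_point tau m n - 1); [f_equal; f_equal; ring|].
      unfold lattice_point. rewrite minus_IZR, RtoC_minus. ring. }
    rewrite E. unfold Cminus. eapply Rle_trans; [apply Cmod_triangle|]. rewrite Cmod_opp.
    assert (B1 : (Cmod (zsum (S N) (fun n => k (- Z.of_nat (S N) - 1)%Z n)) <= (2 * INR (S N) + 1) * (K / (x * x)))%R).
    { apply zsum_bound. intros n _. apply HK; trivial. rewrite Hx. unfold zsize. apply IZR_le. lia. }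
    assert (B2 : (Cmod (zsum (S N) (fun n => k (Z.of_nat (S N)) n)) <= (2 * INR (S N) + 1) * (K / (x * x)))%R).
    { apply zsum_bound. intros n _. apply HK; trivial. rewrite Hx. unfold zsize. apply IZR_le. lia. }
    lra.
  - apply zsum_bound. intros m _.
    replace (zsum (S N) (fun n => kw m n - k m n)) with (k m (- Z.of_nat (S N) - 1)%Z - k m (Z.of_nat (S N))).
    2:{ rewrite <- (zsum_telescope (S N) (k m)). apply zsum_ext. intros n _. f_equal.
      unfold kw, k. rewrite Hw.
      replace (lattice_point tau m (n - 1)) with (lattice_point tau m n - tau); [f_equal; f_equal; ring|].
      unfold lattice_point. rewrite minus_IZR, RtoC_minus. ring. }
    unfold Cminus. eapply Rle_trans; [apply Cmod_triangle|]. rewrite Cmod_opp.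
    assert (B1 : (Cmod (k m (- Z.of_nat (S N) - 1)%Z) <= K / (x * x))%R).
    { apply HK; trivial. rewrite Hx. unfold zsize. apply IZR_le. lia. }
    assert (B2 : (Cmod (k m (Z.of_nat (S N))) <= K / (x * x))%R).
    { apply HK; trivial. rewrite Hx. unfold zsize. apply IZR_le. lia. }
    lra. }
destruct (clim_zero _ _ Bd lim0) as [Z1 Z2].
split; apply is_lim_seq_incr_1; assumption.
Qed.

(** Comparing coordinates, a lattice point would force both i and j to be even. *)
Lemma half_not_lattice (tau : C) (i j : Z) : (0 < Im tau)%R ->
  (Z.odd i || Z.odd j)%bool = true ->
  ~ in_lattice tau (RtoC (IZR i) / 2 + RtoC (IZR j) / 2 * tau).
Proof.
intros ht Ho [m [n E]].
destruct (lattice_norm tau ht) as [k [k0 H]].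
specialize (H (IZR i / 2 - IZR m)%R (IZR j / 2 - IZR n)%R).
replace (RtoC (IZR i / 2 - IZR m) + RtoC (IZR j / 2 - IZR n) * tau) with (RtoC 0) in H.
2:{ rewrite !RtoC_minus, !RtoC_div by lra.
    replace (IZR i / 2 - IZR m + (IZR j / 2 - IZR n) * tau) with
     ((IZR i / 2 + IZR j / 2 * tau) - lattice_point tau m n) by (unfold lattice_point; ring).
    rewrite E. ring. }
rewrite Cmod_0 in H.
assert (a := Rabs_pos (IZR i / 2 - IZR m)). assert (b := Rabs_pos (IZR j / 2 - IZR n)).
assert (S0 : (Rabs (IZR i / 2 - IZR m) + Rabs (IZR j / 2 - IZR n) = 0)%R).
{ destruct (Rle_lt_or_eq_dec 0 (Rabs (IZR i / 2 - IZR m) + Rabs (IZR j / 2 - IZR n)) ltac:(lra)) as [L|L]; [|lra].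
  assert (0 < k * (Rabs (IZR i / 2 - IZR m) + Rabs (IZR j / 2 - IZR n)))%R by now apply Rmult_lt_0_compat.
  lra. }
assert (a0 : (IZR i / 2 - IZR m = 0)%R).
{ destruct (Req_dec (IZR i / 2 - IZR m) 0) as [e|e]; trivial. apply Rabs_pos_lt in e. lra. }
assert (b0 : (IZR j / 2 - IZR n = 0)%R).
{ destruct (Req_dec (IZR j / 2 - IZR n) 0) as [e|e]; trivial. apply Rabs_pos_lt in e. lra. }
assert (Ei : i = (2 * m)%Z) by (apply eq_IZR; rewrite mult_IZR; lra).
assert (Ej : j = (2 * n)%Z) by (apply eq_IZR; rewrite mult_IZR; lra).
subst i j. rewrite !Z.odd_mul in Ho. discriminate Ho.
Qed.

Lemma wzeta_period1 (tau z : C) : (0 < Im tau)%R -> ~ in_lattice tau z ->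
  wzeta tau (z + 1) = wzeta tau z + eta tau 1.
Proof.
intros ht Hz. unfold eta, omega.
rewrite <- (wzeta_increment tau 1 z (- (1 / 2)) ht (or_introl eq_refl) Hz); [ring|].
replace (- (1 / 2)) with (RtoC (IZR (-1)) / 2 + RtoC (IZR 0) / 2 * tau).
- now apply half_not_lattice.
- change (RtoC (IZR (-1))) with (RtoC (Ropp 1)). rewrite RtoC_opp. field.
Qed.

Lemma wzeta_period2 (tau z : C) : (0 < Im tau)%R -> ~ in_lattice tau z ->
  wzeta tau (z + tau) = wzeta tau z + eta tau 2.
Proof.
intros ht Hz. unfold eta, omega.
rewrite <- (wzeta_increment tau tau z (- (tau / 2)) ht (or_intror eq_refl) Hz); [ring|].
replace (- (tau / 2)) with (RtoC (IZR 0) / 2 + RtoC (IZR (-1)) / 2 * tau).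
- now apply half_not_lattice.
- change (RtoC (IZR (-1))) with (RtoC (Ropp 1)). rewrite RtoC_opp. field.
Qed.

Lemma eta3 (tau : C) : (0 < Im tau)%R -> eta tau 3 = eta tau 1 + eta tau 2.
Proof.
intros ht.
assert (Hz : ~ in_lattice tau (- ((1 + tau) / 2))).
{ replace (- ((1 + tau) / 2)) with (RtoC (IZR (-1)) / 2 + RtoC (IZR (-1)) / 2 * tau).
  - now apply half_not_lattice.
  - change (RtoC (IZR (-1))) with (RtoC (Ropp 1)). rewrite RtoC_opp. field. }
unfold eta at 1. unfold omega.
replace (- ((1 + tau) / 2) + (1 + tau)) with ((- ((1 + tau) / 2) + 1) + tau) by ring.
rewrite wzeta_period2, wzeta_period1; trivial; [ring|].
replace (RtoC 1) with (lattice_point tau 1 0) at 2 by (unfold lattice_point; ring).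
now apply not_lattice_add.
Qed.

(** * The half lattice and compactness *)

(** The singular set of q, in a form stable under translations. *)
Definition in_half (tau z : C) : Prop := exists m n, z = lattice_point tau m n / 2.

Lemma half_add (tau z : C) (m n : Z) :
  in_half tau z -> in_half tau (z + lattice_point tau m n / 2).
Proof. intros [a [b ->]]. exists (a + m)%Z, (b + n)%Z. rewrite lattice_point_add. field. Qed.

Lemma not_half_add (tau z : C) (m n : Z) :
  ~ in_half tau z -> ~ in_half tau (z + lattice_point tau m n / 2).
Proof.
intros H K. apply H. apply (half_add _ _ (- m) (- n)) in K.
rewrite lattice_point_opp in K.
now replace (z + lattice_point tau m n / 2 + - lattice_point tau m n / 2) with z in K by field.
Qed.

Lemma not_half_add1 (tau z : C) : ~ in_half tau z -> ~ in_half tau (z + 1 / 2).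
Proof.
intros H. replace (RtoC 1) with (lattice_point tau 1 0) by (unfold lattice_point; ring).
now apply not_half_add.
Qed.

Lemma not_half_add2 (tau z : C) : ~ in_half tau z -> ~ in_half tau (z + tau / 2).
Proof.
intros H. replace tau with (lattice_point tau 0 1) at 2 by (unfold lattice_point; ring).
now apply not_half_add.
Qed.

Lemma lattice_half (tau z : C) : in_lattice tau z -> in_half tau z.
Proof.
intros [m [n ->]]. exists (m + m)%Z, (n + n)%Z. rewrite lattice_point_add. field.
Qed.

Lemma half_isolated (tau p : C) : (0 < Im tau)%R ->
  exists r : R, (0 < r)%R /\ forall w, (0 < Cmod (w - p) < r)%R -> ~ in_half tau w.
Proof.
intros ht. destruct (classic (in_half tau p)) as [[a [b E]]|H].
- destruct (lattice_point_norm tau ht) as [k [k0 Hk]].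
  exists (k / 2)%R. split; [lra|]. intros w [h1 h2] [c [d Ew]].
  assert (E2 : w - p = lattice_point tau (c + - a) (d + - b) / 2).
  { rewrite lattice_point_add, lattice_point_opp, E, Ew. field. }
  assert (nz : nonzero_index (c + - a) (d + - b)).
  { unfold nonzero_index. destruct (Z.eqb_spec (c + - a) 0); destruct (Z.eqb_spec (d + - b) 0); trivial.
    rewrite e, e0, lattice_point_0 in E2. rewrite E2 in h1.
    unfold Cdiv in h1. rewrite Cmult_0_l, Cmod_0 in h1. lra. }
  specialize (Hk (c + - a)%Z (d + - b)%Z). assert (s := nonzero_index_zsize _ _ nz).
  rewrite E2 in h2. unfold Cdiv in h2. rewrite Cmod_mult, Cmod_inv, Cmod_R, Rabs_right in h2 by (try lra; intros e; injection e; lra).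
  assert (k * 1 <= k * zsize (c + - a) (d + - b))%R by (apply Rmult_le_compat_l; lra). lra.
- assert (H2 : ~ in_lattice tau (2 * p)).
  { intros [m [n E]]. apply H. exists m, n. rewrite <- E. field. }
  destruct (off_lattice0_dist tau (2 * p) ht (not_lattice_off _ _ H2)) as [d [d0 Hd]].
  assert (m0 : (0 < Cmod (2 * p))%R) by (apply Cmod_gt_0; now apply not_lattice_0 with tau).
  exists (Rmin d (Cmod (2 * p)) / 2)%R. assert (M0 : (0 < Rmin d (Cmod (2 * p)))%R) by now apply Rmin_pos.
  split; [lra|]. intros w [_ h] [m [n E]].
  assert (B : (Rmin d (Cmod (2 * p)) <= Cmod (2 * p - lattice_point tau m n))%R).
  { destruct ((m =? 0) && (n =? 0))%Z%bool eqn:e.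
    - destruct (Z.eqb_spec m 0); destruct (Z.eqb_spec n 0); try discriminate. subst m n.
      rewrite lattice_point_0. replace (2 * p - 0) with (2 * p) by ring. apply Rmin_r.
    - eapply Rle_trans; [apply Rmin_l|]. now apply Hd. }
  replace (2 * p - lattice_point tau m n) with ((- (2)) * (w - p)) in B by (rewrite E; field).
  rewrite (Cmod_mult (- (2))), Cmod_opp, (Cmod_R 2), (Rabs_right 2) in B by lra. lra.
Qed.

(** Limits at points of the half lattice are therefore unique. *)
Lemma half_dense (tau p : C) (e : R) : (0 < Im tau)%R -> (0 < e)%R ->
  exists w, (Cmod (w - p) < e)%R /\ ~ in_half tau w.
Proof.
intros ht e0. destruct (half_isolated tau p ht) as [r [r0 H]].
pose (t := (Rmin e r / 2)%R). assert (m0 : (0 < Rmin e r)%R) by now apply Rmin_pos.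
assert (E : Cmod (p + RtoC t - p) = t).
{ replace (p + RtoC t - p) with (RtoC t) by ring. rewrite Cmod_R, Rabs_right; unfold t; lra. }
exists (p + RtoC t). assert (a := Rmin_l e r). assert (b := Rmin_r e r). split.
- rewrite E. unfold t. lra.
- apply H. rewrite E. unfold t. lra.
Qed.

Lemma not_half_open (tau p : C) : (0 < Im tau)%R -> ~ in_half tau p ->
  exists r : R, (0 < r)%R /\ forall w, (Cmod (w - p) < r)%R -> ~ in_half tau w.
Proof.
intros ht Hp. destruct (half_isolated tau p ht) as [r [r0 H]].
exists r. split; trivial. intros w Hw.
destruct (Ceq_dec w p) as [->|n]; trivial. apply H. split; trivial. now apply Cmod_minus_pos.
Qed.

(** Connectedness of [0, 1], for spreading the maximum along a segment. *)
Lemma interval_connected (P : R -> Prop) : P 0%R ->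
  (forall t, (0 <= t <= 1)%R -> P t -> exists d : R, (0 < d)%R /\ forall s, (Rabs (s - t) < d)%R -> P s) ->
  (forall t, (0 <= t <= 1)%R -> ~ P t -> exists d : R, (0 < d)%R /\ forall s, (Rabs (s - t) < d)%R -> ~ P s) ->
  P 1%R.
Proof.
intros P0 Hop Hcl.
pose (E := fun t => (0 <= t <= 1)%R /\ forall s, (0 <= s <= t)%R -> P s).
destruct (completeness E) as [T [ub lub]].
{ exists 1%R. intros t [Ht _]. lra. }
{ exists 0%R. split; [lra|]. intros s Hs. now replace s with 0%R by lra. }
assert (T01 : (0 <= T <= 1)%R).
{ split.
  - apply ub. split; [lra|]. intros s Hs. now replace s with 0%R by lra.
  - apply lub. intros t [Ht _]. lra. }
assert (app : forall x, (x < T)%R -> exists t, E t /\ (x < t)%R).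
{ intros x Hx. apply NNPP. intros N. apply (Rlt_not_le _ _ Hx). apply lub.
  intros t Ht. apply Rnot_lt_le. intros L. apply N. now exists t. }
assert (PT : P T).
{ apply NNPP. intros N. destruct (Hcl T T01 N) as [d [d0 Hd]].
  destruct (app (T - d)%R ltac:(lra)) as [t [[Ht Et] L]].
  assert (t <= T)%R by (apply ub; split; trivial).
  apply (Hd t); [rewrite Rabs_left1; lra|]. apply Et. lra. }
destruct (Hop T T01 PT) as [d [d0 Hd]].
assert (E1 : E (Rmin 1 (T + d / 2))).
{ split; [split; [apply Rmin_glb; lra|apply Rmin_l]|]. intros s Hs.
  assert (m := Rmin_r 1 (T + d / 2)).
  destruct (Rlt_le_dec s T) as [L|L].
  - destruct (app s L) as [t [[_ Et] L']]. apply Et. lra.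
  - apply Hd. rewrite Rabs_right; lra. }
apply ub in E1. unfold Rmin in E1. destruct (Rle_dec 1 (T + d / 2)); [|lra].
now replace 1%R with T by lra.
Qed.

(** Compactness gives a uniform radius d > 0 but keeps no track of the centres;
    encoding the bound in the radius (U <= 1/d, then U <= M - d) recovers the maximum. *)
Lemma square_max (U : R -> R -> R) :
  (forall x y, forall e : R, (0 < e)%R -> exists d : R, (0 < d)%R /\
     forall x' y', (Rabs (x' - x) < d)%R -> (Rabs (y' - y) < d)%R -> (Rabs (U x' y' - U x y) < e)%R) ->
  exists x0 y0, forall x y, (0 <= x <= 1)%R -> (0 <= y <= 1)%R -> (U x y <= U x0 y0)%R.
Proof.
intros HU.
assert (compact : forall Q : R -> R -> R -> Prop,
  (forall d d' x y, (0 < d' <= d)%R -> Q d x y -> Q d' x y) ->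
  (forall x y, (0 <= x <= 1)%R -> (0 <= y <= 1)%R -> exists d : R, (0 < d)%R /\
     forall x' y', (Rabs (x' - x) < d)%R -> (Rabs (y' - y) < d)%R -> Q d x' y') ->
  exists d : R, (0 < d)%R /\ forall x y, (0 <= x <= 1)%R -> (0 <= y <= 1)%R -> Q d x y).
{ intros Q mono HQ.
  assert (H : forall p : R * R, exists d : posreal,
    (0 <= fst p <= 1)%R -> (0 <= snd p <= 1)%R ->
     forall x' y', (Rabs (x' - fst p) < d)%R -> (Rabs (y' - snd p) < d)%R -> Q d x' y').
  { intros [x y]. destruct (classic ((0 <= x <= 1)%R /\ (0 <= y <= 1)%R)) as [[Hx Hy]|N].
    - destruct (HQ x y Hx Hy) as [d [d0 Hd]]. exists (mkposreal d d0). intros _ _. exact Hd.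
    - exists (mkposreal 1 Rlt_0_1). intros a b. now destruct N. }
  pose (delta := fun x y => proj1_sig (constructive_indefinite_description _ (H (x, y)))).
  destruct (compactness_value_2d 0 1 0 1 delta) as [d Hd].
  exists d. split; [apply cond_pos|]. intros x y Hx Hy. apply NNPP. intros N.
  apply (Hd x y Hx Hy). intros [u [v [Hu [Hv [h1 [h2 h3]]]]]]. apply N.
  unfold delta in *. destruct (constructive_indefinite_description _ (H (u, v))) as [e He]; simpl in *.
  apply mono with (pos e); [split; [apply cond_pos|trivial]|]. now apply He. }
destruct (compact (fun d x y => (U x y <= / d)%R)) as [B [B0 HB]].
{ intros d d' x y [h1 h2] h3. eapply Rle_trans; [exact h3|]. now apply Rinv_le_contravar. }
{ intros x y _ _. destruct (HU x y 1%R Rlt_0_1) as [d [d0 Hd]].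
  pose (M := (Rabs (U x y) + 1)%R). assert (M0 : (0 < M)%R) by (unfold M; pose proof (Rabs_pos (U x y)); lra).
  exists (Rmin d (/ M)). split; [apply Rmin_pos; trivial; now apply Rinv_0_lt_compat|].
  intros x' y' hx hy.
  specialize (Hd x' y' (Rlt_le_trans _ _ _ hx (Rmin_l _ _)) (Rlt_le_trans _ _ _ hy (Rmin_l _ _))).
  apply Rle_trans with M.
  - apply Rabs_lt_between in Hd. pose proof (Rle_abs (U x y)). unfold M. lra.
  - rewrite <- (Rinv_inv M) at 1. apply Rinv_le_contravar.
    + apply Rmin_pos; trivial; now apply Rinv_0_lt_compat.
    + apply Rmin_r. }
pose (S := fun v => exists x y, (0 <= x <= 1)%R /\ (0 <= y <= 1)%R /\ v = U x y).
destruct (completeness S) as [M [ub lub]].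
{ exists (/ B)%R. intros v [x [y [Hx [Hy ->]]]]. now apply HB. }
{ exists (U 0 0), 0%R, 0%R. repeat split; lra. }
apply NNPP. intros N.
assert (lt : forall x y, (0 <= x <= 1)%R -> (0 <= y <= 1)%R -> (U x y < M)%R).
{ intros x y Hx Hy. apply Rnot_le_lt. intros L. apply N. exists x, y. intros x' y' Hx' Hy'.
  apply Rle_trans with M; trivial. apply ub. now exists x', y'. }
destruct (compact (fun d x y => (U x y <= M - d)%R)) as [d [d0 Hd]].
{ intros. lra. }
{ intros x y Hx Hy. specialize (lt x y Hx Hy).
  destruct (HU x y ((M - U x y) / 2)%R ltac:(lra)) as [d [d0 Hd]].
  exists (Rmin d ((M - U x y) / 2)). split; [apply Rmin_pos; lra|].
  intros x' y' hx hy.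
  specialize (Hd x' y' (Rlt_le_trans _ _ _ hx (Rmin_l _ _)) (Rlt_le_trans _ _ _ hy (Rmin_l _ _))).
  apply Rabs_lt_between in Hd. assert (m := Rmin_r d ((M - U x y) / 2)). lra. }
assert (M <= M - d)%R; [|lra].
apply lub. intros v [x [y [Hx [Hy ->]]]]. now apply Hd.
Qed.

Lemma polar (w : C) : exists th : R, w = (Cmod w * cos th, Cmod w * sin th)%R.
Proof.
destruct (Ceq_dec w 0) as [->|n].
{ exists 0%R. rewrite Cmod_0. unfold RtoC. f_equal; ring. }
apply Cmod_gt_0 in n. destruct w as [x y]. set (r := Cmod (x, y)) in *.
assert (rr : (r * r = x * x + y * y)%R).
{ replace (r * r)%R with (Cmod (x, y) ^ 2)%R by (unfold r; ring).
  rewrite Cmod2_alt. unfold Re, Im; simpl. ring. }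
assert (hx : (-1 <= x / r <= 1)%R).
{ assert (Rabs x <= r)%R by (apply (re_le_Cmod (x, y))). apply Rabs_le_between in H.
  split; apply Rmult_le_reg_r with r; trivial; unfold Rdiv; rewrite Rmult_assoc, Rinv_l; lra. }
assert (ss : (r * sqrt (1 - (x / r)²) = Rabs y)%R).
{ replace (1 - (x / r)²)%R with (y² / r²)%R.
  - rewrite sqrt_div_alt by (apply Rlt_0_sqr; lra). rewrite !sqrt_Rsqr_abs, (Rabs_right r) by lra. field. lra.
  - unfold Rsqr. field_simplify_eq; [|lra]. lra. }
destruct (Rle_lt_dec 0 y) as [L|L].
- exists (acos (x / r)). rewrite cos_acos, sin_acos, ss, Rabs_right by lra. f_equal. field. lra.
- exists (- acos (x / r))%R. rewrite cos_neg, sin_neg, cos_acos, sin_acos by lra.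
  replace (r * - sqrt (1 - (x / r)²))%R with (- (r * sqrt (1 - (x / r)²)))%R by ring.
  rewrite ss, Rabs_left by lra. f_equal; [field; lra|ring].
Qed.

(** * Mean values on circles and the maximum principle *)

Definition circle (p : C) (r th : R) : C := (Re p + r * cos th, Im p + r * sin th)%R.

Lemma circle_dist (p : C) (r th : R) : (0 <= r)%R -> Cmod (circle p r th - p) = r.
Proof.
intros r0. unfold Cmod, circle, Cminus, Cplus, Copp, Re, Im; simpl.
assert (T := sin2_cos2 th). unfold Rsqr in T.
match goal with |- sqrt ?x = _ => replace x with (r * r * (sin th * sin th + cos th * cos th))%R by ring end.
rewrite T, Rmult_1_r. now apply sqrt_square.
Qed.

Lemma circle_polar (p w : C) : exists th, w = circle p (Cmod (w - p)) th.
Proof.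
destruct (polar (w - p)) as [th E]. exists th. unfold circle.
replace w with ((w - p) + p) at 1 by ring. rewrite E at 1.
destruct p; unfold Cplus, Re, Im; simpl. f_equal; ring.
Qed.

Lemma ccont_continuity_2d (g : C -> C) (X Y : R -> R -> R) (x y : R) :
  continuity_2d_pt X x y -> continuity_2d_pt Y x y -> ccont g (X x y, Y x y) ->
  continuity_2d_pt (fun u v => Re (g (X u v, Y u v))) x y.
Proof.
intros HX HY Hg e. destruct (Hg e (cond_pos e)) as [d [d0 Hd]].
assert (d2 : (0 < d / 2)%R) by lra.
destruct (HX (mkposreal _ d2)) as [d3 H3]. destruct (HY (mkposreal _ d2)) as [d4 H4].
assert (m0 : (0 < Rmin d3 d4)%R) by (apply Rmin_pos; apply cond_pos).
exists (mkposreal _ m0). intros u v hu hv. simpl in hu, hv.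
specialize (H3 u v (Rlt_le_trans _ _ _ hu (Rmin_l _ _)) (Rlt_le_trans _ _ _ hv (Rmin_l _ _))).
specialize (H4 u v (Rlt_le_trans _ _ _ hu (Rmin_r _ _)) (Rlt_le_trans _ _ _ hv (Rmin_r _ _))).
simpl in H3, H4.
assert (Hw : (Cmod ((X u v, Y u v) - (X x y, Y x y))%C < d)%R).
{ eapply Rle_lt_trans; [apply (Cmod_le_sum (X u v - X x y) (Y u v - Y x y))|]. lra. }
eapply Rle_lt_trans; [|exact (Hd _ Hw)]. apply (re_le_Cmod (g (X u v, Y u v) - g (X x y, Y x y))).
Qed.

Lemma ccont_circle_2d (g : C -> C) (p : C) (r th : R) :
  ccont g (circle p r th) ->
  continuity_2d_pt (fun u v => Re (g (circle p u v))) r th.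
Proof.
intros H. apply (ccont_continuity_2d g (fun u v => Re p + u * cos v)%R (fun u v => Im p + u * sin v)%R).
- apply continuity_2d_pt_plus; [apply continuity_2d_pt_const|].
  apply continuity_2d_pt_mult; [apply continuity_2d_pt_id1|].
  apply (continuity_1d_2d_pt_comp cos (fun _ v => v)); [apply continuity_cos|apply continuity_2d_pt_id2].
- apply continuity_2d_pt_plus; [apply continuity_2d_pt_const|].
  apply continuity_2d_pt_mult; [apply continuity_2d_pt_id1|].
  apply (continuity_1d_2d_pt_comp sin (fun _ v => v)); [apply continuity_sin|apply continuity_2d_pt_id2].
- exact H.
Qed.

Lemma continuity_2d_continuous_r (f : R -> R -> R) (x y : R) :
  continuity_2d_pt f x y -> continuous (f x) y.
Proof.
intros H. apply filterlim_locally. intros e. destruct (H e) as [d Hd].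
exists d. intros v Hv. apply (Hd x v).
- replace (x - x)%R with 0%R by ring. rewrite Rabs_R0. apply cond_pos.
- exact Hv.
Qed.

Lemma cderiv_circle_r (h : C -> C) (l p : C) (r th : R) :
  cderiv h (circle p r th) l ->
  is_derive (fun s => Re (h (circle p s th))) r (cos th * Re l - sin th * Im l)%R.
Proof.
intros H.
assert (D := cderiv_curve h l (fun s => Re p + s * cos th)%R (fun s => Im p + s * sin th)%R r (cos th) (sin th)).
apply D; trivial; auto_derive; trivial; ring.
Qed.

Lemma cderiv_circle_th (h : C -> C) (l p : C) (r th : R) :
  cderiv h (circle p r th) l ->
  is_derive (fun s => Re (- Ci * h (circle p r s))) th (r * (cos th * Re l - sin th * Im l))%R.
Proof.
intros H.
assert (H' : cderiv (fun w => - Ci * h w) (circle p r th) (- Ci * l)).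
{ now apply cderiv_scal. }
assert (D := cderiv_curve _ _ (fun s => Re p + r * cos s)%R (fun s => Im p + r * sin s)%R th (- (r * sin th)) (r * cos th)
  ltac:(auto_derive; trivial; ring) ltac:(auto_derive; trivial; ring) H').
replace (r * (cos th * Re l - sin th * Im l))%R with (Re (((- (r * sin th))%R, (r * cos th)%R) * (- Ci * l))).
- exact D.
- unfold Re, Im, Ci, Copp, Cmult; simpl. ring.
Qed.

Lemma circle_radial_cont (dh : C -> C) (p : C) (r th : R) :
  ccont dh (circle p r th) ->
  continuity_2d_pt (fun u v => cos v * Re (dh (circle p u v)) - sin v * Im (dh (circle p u v)))%R r th.
Proof.
intros H. apply continuity_2d_pt_minus; apply continuity_2d_pt_mult.
- apply (continuity_1d_2d_pt_comp cos (fun _ v => v)); [apply continuity_cos|apply continuity_2d_pt_id2].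
- now apply ccont_circle_2d.
- apply (continuity_1d_2d_pt_comp sin (fun _ v => v)); [apply continuity_sin|apply continuity_2d_pt_id2].
- apply (continuity_2d_pt_ext (fun u v => Re (- Ci * dh (circle p u v)))).
  { intros. now rewrite <- Im_Re. }
  apply (ccont_circle_2d (fun w => - Ci * dh w)).
  apply (ccont_mult (fun _ => - Ci) dh); [apply ccont_const|trivial].
Qed.

(** The r-derivative of the mean of Re h over the circle of radius r is the mean of
    Re (e^(i th) h'), which is 1/r times the th-derivative of Im h, a periodic function.
    The centre may be singular. *)
Lemma circle_mean_const (h dh : C -> C) (p : C) (rad a r1 r2 : R) :
  (forall w, (0 < Cmod (w - p) < rad)%R -> cderiv h w (dh w) /\ ccont dh w) ->
  (0 < r1 <= r2)%R -> (r2 < rad)%R ->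
  RInt (fun th => Re (h (circle p r1 th))) a (a + 2 * PI) =
  RInt (fun th => Re (h (circle p r2 th))) a (a + 2 * PI).
Proof.
intros H r10 r2R.
pose (I := fun r => RInt (fun th => Re (h (circle p r th))) a (a + 2 * PI)).
change (I r1 = I r2).
assert (on : forall r th, (0 < r < rad)%R -> (0 < Cmod (circle p r th - p) < rad)%R).
{ intros r th Hr. rewrite circle_dist; lra. }
assert (D : forall r, (0 < r < rad)%R -> is_derive I r 0%R).
{ intros r Hr.
  assert (near : forall u, (Rabs (u - r) < Rmin r (rad - r))%R -> (0 < u < rad)%R).
  { intros u Hu. assert (m1 := Rmin_l r (rad - r)). assert (m2 := Rmin_r r (rad - r)).
    apply Rabs_lt_between in Hu. lra. }
  assert (m0 : (0 < Rmin r (rad - r))%R) by (apply Rmin_pos; lra).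
  assert (E0 : RInt (fun t => Derive (fun u => Re (h (circle p u t))) r) a (a + 2 * PI) = 0%R).
  { rewrite (RInt_ext _ (fun t => cos t * Re (dh (circle p r t)) - sin t * Im (dh (circle p r t)))%R).
    2:{ intros t _. apply is_derive_unique. apply cderiv_circle_r. now apply H, on. }
    apply is_RInt_unique.
    assert (J := is_RInt_derive (V := R_CompleteNormedModule)
      (fun t => / r * Re (- Ci * h (circle p r t)))%R
      (fun t => cos t * Re (dh (circle p r t)) - sin t * Im (dh (circle p r t)))%R a (a + 2 * PI)).
    replace 0%R with (minus (/ r * Re (- Ci * h (circle p r (a + 2 * PI))))%R (/ r * Re (- Ci * h (circle p r a)))%R).
    - apply J.
      + intros t _.
        replace (cos t * Re (dh (circle p r t)) - sin t * Im (dh (circle p r t)))%R with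
          (/ r * (r * (cos t * Re (dh (circle p r t)) - sin t * Im (dh (circle p r t)))))%R by (field; lra).
        apply is_derive_scal. apply cderiv_circle_th. now apply H, on.
      + intros t _. apply (continuity_2d_continuous_r (fun u v => cos v * Re (dh (circle p u v)) - sin v * Im (dh (circle p u v)))%R).
        apply circle_radial_cont. now apply H, on.
    - replace (circle p r (a + 2 * PI)) with (circle p r a).
      + unfold minus, plus, opp; simpl. ring.
      + unfold circle. replace (a + 2 * PI)%R with (a + 2 * INR 1 * PI)%R by (simpl; ring).
        now rewrite cos_period, sin_period. }
  rewrite <- E0. apply is_derive_RInt_param.
  - exists (mkposreal _ m0). intros u Hu t _. eexists. apply cderiv_circle_r. apply H, on. now apply near.
  - intros t _.
    apply (continuity_2d_pt_ext_loc (fun u v => cos v * Re (dh (circle p u v)) - sin v * Im (dh (circle p u v)))%R).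
    + exists (mkposreal _ m0). intros u v Hu _. symmetry. apply is_derive_unique.
      apply cderiv_circle_r. apply H, on. now apply near.
    + apply circle_radial_cont. now apply H, on.
  - exists (mkposreal _ m0). intros u Hu. apply (ex_RInt_continuous (V := R_CompleteNormedModule)).
    intros t _. apply (continuity_2d_continuous_r (fun u v => Re (h (circle p u v)))).
    apply ccont_circle_2d. apply (cderiv_ccont _ _ (dh (circle p u t))). apply H, on. now apply near. }
destruct (Rle_lt_or_eq_dec r1 r2 (proj2 r10)) as [L|E]; [|now rewrite E].
apply (eq_is_derive (V := R_NormedModule) I r1 r2); trivial.
intros t Ht. apply D. lra.
Qed.

Lemma RInt_pos_point (f : R -> R) (a b c : R) :
  (a < c < b)%R -> (forall x, (a <= x <= b)%R -> continuous f x) ->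
  (forall x, (a <= x <= b)%R -> (0 <= f x)%R) -> (0 < f c)%R -> (0 < RInt f a b)%R.
Proof.
intros Hc Hf H0 Hp.
assert (e0 : (0 < f c / 2)%R) by lra.
assert (Hc' : (a <= c <= b)%R) by lra.
destruct (proj1 (filterlim_locally f (f c)) (Hf c Hc') (mkposreal _ e0)) as [d Hd].
pose (m := Rmin (d / 2) (Rmin ((c - a) / 2) ((b - c) / 2))).
assert (m0 : (0 < m)%R) by (repeat apply Rmin_pos; pose proof (cond_pos d); lra).
assert (m1 : (m <= d / 2)%R) by apply Rmin_l.
assert (m2 : (m <= (c - a) / 2)%R) by (eapply Rle_trans; [apply Rmin_r|apply Rmin_l]).
assert (m3 : (m <= (b - c) / 2)%R) by (eapply Rle_trans; [apply Rmin_r|apply Rmin_r]).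
assert (ex : forall u v, (a <= u <= v)%R -> (v <= b)%R -> ex_RInt f u v).
{ intros u v h1 h2. apply (ex_RInt_continuous (V := R_CompleteNormedModule)).
  intros z Hz. rewrite Rmin_left, Rmax_right in Hz by lra. apply Hf. lra. }
rewrite <- (RInt_Chasles f a (c - m) b) by (apply ex; lra).
rewrite <- (RInt_Chasles f (c - m) (c + m) b) by (apply ex; lra).
assert (i1 : (0 <= RInt f a (c - m))%R).
{ apply RInt_ge_0; [lra|apply ex; lra|]. intros; apply H0; lra. }
assert (i3 : (0 <= RInt f (c + m) b)%R).
{ apply RInt_ge_0; [lra|apply ex; lra|]. intros; apply H0; lra. }
assert (i2 : (0 < RInt f (c - m) (c + m))%R).
{ apply RInt_gt_0; [lra| |intros; apply Hf; lra]. intros x Hx.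
  assert (Bx : ball c d x).
  { change (Rabs (x - c) < d)%R. pose proof (cond_pos d). apply Rabs_lt_between. lra. }
  specialize (Hd x Bx). change (Rabs (f x - f c) < f c / 2)%R in Hd.
  apply Rabs_lt_between in Hd. lra. }
unfold plus; simpl. lra.
Qed.

(** Strong maximum principle at p, which may be a removable singularity: the means over small
    circles tend to M, hence so does every mean, and Re h <= M forces equality. *)
Lemma local_max_const (h dh : C -> C) (p : C) (rad M : R) :
  (forall w, (0 < Cmod (w - p) < rad)%R -> cderiv h w (dh w) /\ ccont dh w) ->
  (forall w, (0 < Cmod (w - p) < rad)%R -> (Re (h w) <= M)%R) ->
  (forall e : R, (0 < e)%R -> exists d : R, (0 < d)%R /\ forall w, (0 < Cmod (w - p) < d)%R -> (M - e <= Re (h w))%R) ->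
  forall w, (0 < Cmod (w - p) < rad)%R -> Re (h w) = M.
Proof.
intros H HM Hl w Hw.
apply Rle_antisym; [now apply HM|]. apply Rnot_lt_le. intros L.
destruct (circle_polar p w) as [th0 Ew]. set (r := Cmod (w - p)) in *.
(* start the circle opposite to w, so that w is an interior parameter *)
pose (a := (th0 - PI)%R). assert (pi0 := PI_RGT_0).
pose (phi := fun th => (M - Re (h (circle p r th)))%R).
assert (on : forall r th, (0 < r < rad)%R -> (0 < Cmod (circle p r th - p) < rad)%R).
{ intros u th Hr. rewrite circle_dist; lra. }
assert (cont : forall u th, (0 < u < rad)%R -> continuous (fun th => Re (h (circle p u th))) th).
{ intros u th Hu. apply (continuity_2d_continuous_r (fun u v => Re (h (circle p u v)))).
  apply ccont_circle_2d. apply (cderiv_ccont _ _ (dh (circle p u th))). now apply H, on. }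
assert (exI : forall u, (0 < u < rad)%R -> ex_RInt (fun th => Re (h (circle p u th))) a (a + 2 * PI)).
{ intros u Hu. apply (ex_RInt_continuous (V := R_CompleteNormedModule)). intros; now apply cont. }
assert (P1 : (0 < RInt phi a (a + 2 * PI))%R).
{ apply RInt_pos_point with th0; [unfold a; lra| | |].
  - intros x _. apply (continuous_minus (V := R_NormedModule) (fun _ => M)); [apply continuous_const|now apply cont].
  - intros x _. unfold phi. assert (Re (h (circle p r x)) <= M)%R by now apply HM, on. lra.
  - unfold phi. rewrite <- Ew. lra. }
assert (P2 : (RInt phi a (a + 2 * PI) = 2 * PI * M - RInt (fun th => Re (h (circle p r th))) a (a + 2 * PI))%R).
{ unfold phi. rewrite (RInt_minus (V := R_CompleteNormedModule) (fun _ => M)); [|apply ex_RInt_const|now apply exI].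
  rewrite RInt_const. unfold minus, plus, opp, scal; simpl. unfold mult; simpl. ring. }
set (J := RInt (fun th => Re (h (circle p r th))) a (a + 2 * PI)) in *.
set (k := RInt phi a (a + 2 * PI)) in *.
destruct (Hl (k / (4 * PI))%R) as [d [d0 Hd]]; [apply Rdiv_lt_0_compat; lra|].
pose (r1 := Rmin (d / 2) (r / 2)). assert (r10 : (0 < r1)%R) by (apply Rmin_pos; lra).
assert (a1 : (r1 <= d / 2)%R) by apply Rmin_l. assert (a2 : (r1 <= r / 2)%R) by apply Rmin_r.
assert (EJ : RInt (fun th => Re (h (circle p r1 th))) a (a + 2 * PI) = J).
{ apply (circle_mean_const h dh p rad); trivial; lra. }
assert (LJ : ((a + 2 * PI - a) * (M - k / (4 * PI)) <= J)%R).
{ rewrite <- EJ.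
  assert (E : RInt (fun _ => (M - k / (4 * PI))%R) a (a + 2 * PI) = ((a + 2 * PI - a) * (M - k / (4 * PI)))%R).
  { rewrite RInt_const. reflexivity. }
  rewrite <- E. apply RInt_le; [lra|apply ex_RInt_const|apply exI; lra|].
  intros x _. apply Hd. rewrite circle_dist; lra. }
replace ((a + 2 * PI - a) * (M - k / (4 * PI)))%R with (2 * PI * M - k / 2)%R in LJ by (field; lra).
lra.
Qed.

(** * A Liouville theorem with removable singularities *)

(** At a point of the half lattice this is the limit over a punctured neighbourhood, at
    the other points it is the value of a continuous h; so one definition serves both. *)
Definition half_lim (tau : C) (h : C -> C) (p l : C) : Prop :=
  forall e : R, (0 < e)%R -> exists d : R, (0 < d)%R /\
    forall w, (Cmod (w - p) < d)%R -> ~ in_half tau w -> (Cmod (h w - l) < e)%R.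

Lemma half_lim_unique (tau : C) (h : C -> C) (p l l' : C) : (0 < Im tau)%R ->
  half_lim tau h p l -> half_lim tau h p l' -> l = l'.
Proof.
intros ht H H'. destruct (Ceq_dec l l') as [|n]; trivial. exfalso.
assert (c0 := Cmod_minus_pos _ _ n).
destruct (H (Cmod (l - l') / 2)%R ltac:(lra)) as [d [d0 Hd]].
destruct (H' (Cmod (l - l') / 2)%R ltac:(lra)) as [d' [d0' Hd']].
destruct (half_dense tau p (Rmin d d') ht) as [w [Hw Nw]]; [now apply Rmin_pos|].
specialize (Hd w (Rlt_le_trans _ _ _ Hw (Rmin_l _ _)) Nw).
specialize (Hd' w (Rlt_le_trans _ _ _ Hw (Rmin_r _ _)) Nw).
assert (T := Cmod_triangle (- (h w - l)) (h w - l')). rewrite Cmod_opp in T.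
replace (- (h w - l) + (h w - l')) with (l - l') in T by ring. lra.
Qed.

Lemma half_lim_scal (tau c : C) (h : C -> C) (p l : C) :
  half_lim tau h p l -> half_lim tau (fun w => c * h w) p (c * l).
Proof.
intros H e e0. assert (cc := Cmod_ge_0 c).
destruct (H (e / (1 + Cmod c))%R) as [d [d0 Hd]]; [apply Rdiv_lt_0_compat; lra|].
exists d. split; trivial. intros w Hw Nw. specialize (Hd w Hw Nw).
replace (c * h w - c * l) with (c * (h w - l)) by ring. rewrite Cmod_mult.
apply Rle_lt_trans with (Cmod c * (e / (1 + Cmod c)))%R; [apply Rmult_le_compat_l; lra|].
replace e with ((1 + Cmod c) * (e / (1 + Cmod c)))%R at 2 by (field; lra).
apply Rmult_lt_compat_r; [apply Rdiv_lt_0_compat; lra|lra].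
Qed.

Lemma half_lim_shift (tau : C) (h g : C -> C) (p l : C) (m n : Z) :
  (forall z, ~ in_half tau z -> h z = g (z + lattice_point tau m n / 2)) ->
  half_lim tau g (p + lattice_point tau m n / 2) l -> half_lim tau h p l.
Proof.
intros E H e e0. destruct (H e e0) as [d [d0 Hd]]. exists d. split; trivial.
intros w Hw Nw. rewrite E by trivial. apply Hd; [|now apply not_half_add].
now replace (w + lattice_point tau m n / 2 - (p + lattice_point tau m n / 2)) with (w - p) by ring.
Qed.

Lemma half_lim_regular (tau : C) (h : C -> C) (p : C) :
  ccont h p -> half_lim tau h p (h p).
Proof.
intros H e e0. destruct (H e e0) as [d [d0 Hd]]. exists d. split; trivial. intros w Hw _. now apply Hd.
Qed.

(** Induction over the integers in both directions; s^2 = 1 makes s its own inverse. *)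
Lemma multiplier_one (tau : C) (h : C -> C) (s : C) (a b : Z) : s * s = 1 ->
  (forall z, ~ in_half tau z -> h (z + lattice_point tau a b / 2) = s * h z) ->
  forall m : Z, exists c, c * c = 1 /\
    forall z, ~ in_half tau z -> h (z + lattice_point tau (m * a) (m * b) / 2) = c * h z.
Proof.
intros ss H.
apply (Z.bi_induction (fun m => exists c, c * c = 1 /\
    forall z, ~ in_half tau z -> h (z + lattice_point tau (m * a) (m * b) / 2) = c * h z)).
- intros x y ->. reflexivity.
- exists 1. split; [ring|]. intros z Hz. rewrite !Z.mul_0_l, lattice_point_0.
  replace (z + 0 / 2) with z by field. ring.
- intros m. split.
  + intros [c [cc Hc]]. exists (s * c). split; [replace (s * c * (s * c)) with ((s * s) * (c * c)) by ring; rewrite ss, cc; ring|].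
    intros z Hz. rewrite !Z.mul_succ_l, lattice_point_add.
    replace (z + (lattice_point tau (m * a) (m * b) + lattice_point tau a b) / 2) with
      ((z + lattice_point tau (m * a) (m * b) / 2) + lattice_point tau a b / 2) by field.
    rewrite H by (now apply not_half_add). rewrite Hc by trivial. ring.
  + intros [c [cc Hc]]. exists (s * c). split; [replace (s * c * (s * c)) with ((s * s) * (c * c)) by ring; rewrite ss, cc; ring|].
    intros z Hz. rewrite <- Cmult_assoc, <- Hc by trivial. rewrite !Z.mul_succ_l, lattice_point_add.
    replace (z + (lattice_point tau (m * a) (m * b) + lattice_point tau a b) / 2) with
      ((z + lattice_point tau (m * a) (m * b) / 2) + lattice_point tau a b / 2) by field.
    rewrite H by (now apply not_half_add). rewrite Cmult_assoc, ss. ring.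
Qed.

Lemma multiplier (tau : C) (h : C -> C) (s1 s2 : C) : s1 * s1 = 1 -> s2 * s2 = 1 ->
  (forall z, ~ in_half tau z -> h (z + 1 / 2) = s1 * h z) ->
  (forall z, ~ in_half tau z -> h (z + tau / 2) = s2 * h z) ->
  forall m n : Z, exists c, c * c = 1 /\
    forall z, ~ in_half tau z -> h (z + lattice_point tau m n / 2) = c * h z.
Proof.
intros e1 e2 H1 H2 m n.
destruct (multiplier_one tau h s1 1 0 e1) with (m := m) as [c [cc Hc]].
{ intros z Hz. replace (lattice_point tau 1 0) with (RtoC 1) by (unfold lattice_point; ring). now apply H1. }
destruct (multiplier_one tau h s2 0 1 e2) with (m := n) as [c' [cc' Hc']].
{ intros z Hz. replace (lattice_point tau 0 1) with tau by (unfold lattice_point; ring). now apply H2. }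
rewrite Z.mul_1_r, Z.mul_0_r in Hc, Hc'.
exists (c * c'). split; [replace (c * c' * (c * c')) with ((c * c) * (c' * c')) by ring; rewrite cc, cc'; ring|].
intros z Hz. replace m with (m + 0)%Z by ring. replace n with (0 + n)%Z at 1 by ring.
rewrite lattice_point_add.
replace (z + (lattice_point tau m 0 + lattice_point tau 0 n) / 2) with
 ((z + lattice_point tau 0 n / 2) + lattice_point tau m 0 / 2) by field.
rewrite Hc by (now apply not_half_add). rewrite Hc' by trivial. ring.
Qed.

(** The limits extend h to a continuous function on the torus, whose real part attains its
    maximum; by the local principle the set where it does is open, and it is closed. *)
Lemma liouville_Re (tau : C) (h dh : C -> C) : (0 < Im tau)%R ->
  (forall z, ~ in_half tau z -> cderiv h z (dh z)) ->
  (forall z, ~ in_half tau z -> ccont dh z) ->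
  (forall m n z, ~ in_half tau z -> h (z + lattice_point tau m n) = h z) ->
  (forall p, exists l, half_lim tau h p l) ->
  exists M, forall z, ~ in_half tau z -> Re (h z) = M.
Proof.
intros ht Hh Hdh Hper Hlim.
pose (H := fun p => proj1_sig (constructive_indefinite_description _ (Hlim p))).
assert (HH : forall p, half_lim tau h p (H p)).
{ intros p. unfold H. now destruct (constructive_indefinite_description _ (Hlim p)). }
clearbody H.
assert (Heq : forall z, ~ in_half tau z -> H z = h z).
{ intros z Hz. apply (half_lim_unique tau h z); trivial.
  apply half_lim_regular. now apply (cderiv_ccont _ _ (dh z)), Hh. }
assert (Hc : forall p, ccont H p).
{ intros p e e0. destruct (HH p (e / 2)%R ltac:(lra)) as [d [d0 Hd]].
  exists d. split; trivial. intros w Hw.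
  destruct (HH w (e / 2)%R ltac:(lra)) as [d' [d0' Hd']].
  destruct (half_dense tau w (Rmin d' (d - Cmod (w - p))) ht) as [u [Hu Nu]]; [apply Rmin_pos; lra|].
  specialize (Hd' u (Rlt_le_trans _ _ _ Hu (Rmin_l _ _)) Nu).
  assert (hu := Rlt_le_trans _ _ _ Hu (Rmin_r _ _)).
  assert (up : (Cmod (u - p) < d)%R).
  { replace (u - p) with ((u - w) + (w - p)) by ring. eapply Rle_lt_trans; [apply Cmod_triangle|]. lra. }
  specialize (Hd u up Nu).
  replace (H w - H p) with (- (h u - H w) + (h u - H p)) by ring.
  eapply Rle_lt_trans; [apply Cmod_triangle|]. rewrite Cmod_opp. lra. }
assert (HP : forall m n p, H (p + lattice_point tau m n) = H p).
{ intros m n p. apply (half_lim_unique tau h p); trivial.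
  apply (half_lim_shift tau h h p _ (m + m) (n + n)).
  - intros z Hz. rewrite lattice_point_add.
    replace (z + (lattice_point tau m n + lattice_point tau m n) / 2) with (z + lattice_point tau m n) by field.
    symmetry. now apply Hper.
  - rewrite lattice_point_add.
    replace (p + (lattice_point tau m n + lattice_point tau m n) / 2) with (p + lattice_point tau m n) by field.
    apply HH. }
destruct (square_max (fun x y => Re (H (RtoC x + RtoC y * tau)))) as [x0 [y0 Hmax]].
{ intros x y e e0. destruct (Hc (RtoC x + RtoC y * tau) e e0) as [d [d0 Hd]].
  assert (ct := Cmod_ge_0 tau).
  exists (d / (1 + Cmod tau))%R. split; [apply Rdiv_lt_0_compat; lra|].
  intros x' y' hx hy.
  assert (B : (Cmod (RtoC x' + RtoC y' * tau - (RtoC x + RtoC y * tau)) < d)%R).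
  { replace (RtoC x' + RtoC y' * tau - (RtoC x + RtoC y * tau)) with (RtoC (x' - x) + RtoC (y' - y) * tau)
      by (rewrite !RtoC_minus; ring).
    eapply Rle_lt_trans; [apply Cmod_triangle|]. rewrite Cmod_mult, !Cmod_R.
    assert (Rabs (y' - y) * Cmod tau <= d / (1 + Cmod tau) * Cmod tau)%R by (apply Rmult_le_compat_r; lra).
    replace d with (d / (1 + Cmod tau) + d / (1 + Cmod tau) * Cmod tau)%R by (field; lra). lra. }
  eapply Rle_lt_trans; [|exact (Hd _ B)].
  apply (re_le_Cmod (H (RtoC x' + RtoC y' * tau) - H (RtoC x + RtoC y * tau))). }
set (p0 := RtoC x0 + RtoC y0 * tau) in *. set (M := Re (H p0)) in *.
(* reduce z modulo the lattice to the fundamental parallelogram *)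
assert (HM : forall z, (Re (H z) <= M)%R).
{ intros z. destruct (C_coordinates tau z ht) as [x [y E]].
  destruct (archimed x) as [a1 a2]. destruct (archimed y) as [b1 b2].
  rewrite <- (HP (- (up x - 1))%Z (- (up y - 1))%Z z).
  replace (z + lattice_point tau (- (up x - 1)) (- (up y - 1))) with
    (RtoC (x - (IZR (up x) - 1)) + RtoC (y - (IZR (up y) - 1)) * tau).
  - apply Hmax; lra.
  - rewrite E. unfold lattice_point. rewrite !opp_IZR, !minus_IZR, !RtoC_opp, !RtoC_minus. ring. }
assert (loc : forall p, Re (H p) = M -> exists r : R, (0 < r)%R /\ forall w, (Cmod (w - p) < r)%R -> Re (H w) = M).
{ intros p Ep. destruct (half_isolated tau p ht) as [r [r0 Hr]].
  exists r. split; trivial. intros w Hw.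
  destruct (Ceq_dec w p) as [->|n]; trivial.
  assert (w0 := Cmod_minus_pos _ _ n).
  rewrite Heq by now apply Hr.
  apply (local_max_const h dh p r M); [| | |lra].
  - intros u Hu. split; [apply Hh|apply Hdh]; now apply Hr.
  - intros u Hu. rewrite <- Heq by now apply Hr. apply HM.
  - intros e e0. destruct (HH p e e0) as [d [d0 Hd]]. exists (Rmin d r).
    split; [now apply Rmin_pos|]. intros u [hu1 hu2].
    assert (hu3 := Rlt_le_trans _ _ _ hu2 (Rmin_l _ _)).
    assert (hu4 := Rlt_le_trans _ _ _ hu2 (Rmin_r _ _)).
    specialize (Hd u hu3 (Hr u (conj hu1 hu4))).
    assert (K := re_le_Cmod (h u - H p)).
    assert (K2 : (Rabs (Re (h u) - M) < e)%R).
    { rewrite <- Ep. eapply Rle_lt_trans; [exact K|exact Hd]. }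
    apply Rabs_lt_between in K2. lra. }
exists M. intros z Hz. rewrite <- Heq by trivial.
pose (L := fun t : R => p0 + t * (z - p0)).
assert (EL : forall s t : R, Cmod (L s - L t) = (Rabs (s - t) * Cmod (z - p0))%R).
{ intros s t. replace (L s - L t) with (RtoC (s - t) * (z - p0)) by (unfold L; rewrite RtoC_minus; ring).
  now rewrite Cmod_mult, Cmod_R. }
assert (small : forall d t, (0 < d)%R -> exists d' : R, (0 < d')%R /\
   forall s, (Rabs (s - t) < d')%R -> (Cmod (L s - L t) < d)%R).
{ intros d t d0. assert (c0 := Cmod_ge_0 (z - p0)). exists (d / (1 + Cmod (z - p0)))%R.
  split; [apply Rdiv_lt_0_compat; lra|]. intros s Hs. rewrite EL.
  apply Rle_lt_trans with (d / (1 + Cmod (z - p0)) * Cmod (z - p0))%R; [apply Rmult_le_compat_r; lra|].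
  replace d with (d / (1 + Cmod (z - p0)) * (1 + Cmod (z - p0)))%R at 2 by (field; lra).
  apply Rmult_lt_compat_l; [apply Rdiv_lt_0_compat; lra|lra]. }
replace z with (L 1%R) by (unfold L; ring).
apply (interval_connected (fun t => Re (H (L t)) = M)).
- now replace (L 0%R) with p0 by (unfold L; ring).
- intros t _ Et. destruct (loc _ Et) as [r [r0 Hr]]. destruct (small r t r0) as [d [d0 Hd]].
  exists d. split; trivial. intros s Hs. apply Hr. now apply Hd.
- intros t _ Nt. assert (m := HM (L t)).
  destruct (Hc (L t) (M - Re (H (L t)))%R) as [r [r0 Hr]]; [lra|].
  destruct (small r t r0) as [d [d0 Hd]]. exists d. split; trivial. intros s Hs Es.
  specialize (Hr _ (Hd s Hs)). assert (K := re_le_Cmod (H (L s) - H (L t))).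
  assert (K2 : (Rabs (Re (H (L s)) - Re (H (L t))) < M - Re (H (L t)))%R).
  { eapply Rle_lt_trans; [exact K|exact Hr]. }
  rewrite Es, Rabs_right in K2 by lra. lra.
Qed.

(** Only the limit at 0 is assumed, as the half-period translations carry it to all
    singularities. *)
Lemma liouville (tau : C) (h dh : C -> C) (s1 s2 l : C) : (0 < Im tau)%R ->
  (forall z, ~ in_half tau z -> cderiv h z (dh z)) ->
  (forall z, ~ in_half tau z -> ccont dh z) ->
  s1 * s1 = 1 -> s2 * s2 = 1 ->
  (forall z, ~ in_half tau z -> h (z + 1 / 2) = s1 * h z) ->
  (forall z, ~ in_half tau z -> h (z + tau / 2) = s2 * h z) ->
  half_lim tau h 0 l ->
  forall z, ~ in_half tau z -> h z = l.
Proof.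
intros ht Hh Hdh e1 e2 H1 H2 Hl.
assert (mult := multiplier tau h s1 s2 e1 e2 H1 H2).
assert (per : forall m n z, ~ in_half tau z -> h (z + lattice_point tau m n) = h z).
{ intros m n z Hz. destruct (mult m n) as [c [cc Hc]].
  replace (z + lattice_point tau m n) with ((z + lattice_point tau m n / 2) + lattice_point tau m n / 2) by field.
  rewrite Hc by now apply not_half_add. rewrite Hc by trivial. rewrite Cmult_assoc, cc. ring. }
assert (lims : forall p, exists k, half_lim tau h p k).
{ intros p. destruct (classic (in_half tau p)) as [[m [n ->]]|Np].
  - destruct (mult m n) as [c [cc Hc]]. exists (c * l).
    apply (half_lim_shift tau h (fun w => c * h w) _ _ (- m) (- n)).
    + intros z Hz. rewrite <- Hc by now apply not_half_add.
      rewrite lattice_point_opp. f_equal. field.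
    + replace (lattice_point tau m n / 2 + lattice_point tau (- m) (- n) / 2) with (RtoC 0)
        by (rewrite lattice_point_opp; field).
      now apply half_lim_scal.
  - exists (h p). apply half_lim_regular. now apply (cderiv_ccont _ _ (dh p)), Hh. }
destruct (liouville_Re tau h dh ht Hh Hdh per lims) as [a Ha].
destruct (liouville_Re tau (fun z => - Ci * h z) (fun z => - Ci * dh z) ht) as [b Hb].
{ intros z Hz. now apply cderiv_scal, Hh. }
{ intros z Hz. apply (ccont_mult (fun _ => - Ci) dh); [apply ccont_const|now apply Hdh]. }
{ intros m n z Hz. now rewrite per. }
{ intros p. destruct (lims p) as [k Hk]. exists (- Ci * k). now apply half_lim_scal. }
assert (E : forall z, ~ in_half tau z -> h z = (a, b)).
{ intros z Hz. apply Re_Im_eq; simpl; [now apply Ha|]. rewrite Im_Re. now apply Hb. }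
assert (El : (a, b) = l).
{ apply (half_lim_unique tau h 0); trivial. intros e e0. exists 1%R. split; [lra|].
  intros w _ Nw. rewrite E by trivial. replace ((a, b) - (a, b)) with (RtoC 0) by ring. now rewrite Cmod_0. }
intros z Hz. rewrite E; trivial.
Qed.

(** * Combinations of zeta and wp at the half-periods *)

Lemma sum4_eq (f : nat -> C) : sum4 f = f 0%nat + f 1%nat + f 2%nat + f 3%nat.
Proof. unfold sum4. rewrite !sum_Sn, sum_O. reflexivity. Qed.

Lemma omega_point (tau : C) (k : nat) : exists a b, omega tau k = lattice_point tau a b.
Proof.
destruct k as [|[|[|k]]]; [exists 0%Z, 0%Z|exists 1%Z, 0%Z|exists 0%Z, 1%Z|exists 1%Z, 1%Z];
unfold omega, lattice_point; ring.
Qed.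

Lemma half_shift (tau z : C) (k : nat) : ~ in_half tau z -> ~ in_lattice tau (z - omega tau k / 2).
Proof.
intros H K. apply H. apply lattice_half in K. destruct (omega_point tau k) as [a [b E]].
apply (half_add _ _ a b) in K. rewrite <- E in K.
now replace (z - omega tau k / 2 + omega tau k / 2) with z in K by ring.
Qed.

Lemma half_period_off (tau : C) (k : nat) : (0 < Im tau)%R -> (1 <= k <= 3)%nat ->
  ~ in_lattice tau (- (omega tau k / 2)).
Proof.
intros ht Hk.
assert (E : exists i j, (Z.odd i || Z.odd j)%bool = true /\
  - (omega tau k / 2) = RtoC (IZR i) / 2 + RtoC (IZR j) / 2 * tau).
{ assert (m1 : RtoC (IZR (-1)) = - RtoC 1) by (change (IZR (-1)) with (Ropp 1); apply RtoC_opp).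
  destruct k as [|[|[|[|k]]]]; try lia;
  [exists (-1)%Z, 0%Z|exists 0%Z, (-1)%Z|exists (-1)%Z, (-1)%Z]; (split; [reflexivity|]); rewrite ?m1; unfold omega; field. }
destruct E as [i [j [Ho E]]]. rewrite E. now apply half_not_lattice.
Qed.

Lemma not_lattice_open (tau z : C) : (0 < Im tau)%R -> ~ in_lattice tau z ->
  exists d : R, (0 < d)%R /\ forall w, (Cmod (w - z) < d)%R -> ~ in_lattice tau w.
Proof.
intros ht Hz. destruct (off_lattice0_open tau z ht (not_lattice_off _ _ Hz)) as [d [d0 H]].
assert (c0 : (0 < Cmod z)%R) by (apply Cmod_gt_0; now apply not_lattice_0 with tau).
exists (Rmin d (Cmod z)). split; [now apply Rmin_pos|]. intros w Hw [m [n E]].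
specialize (H w (Rlt_le_trans _ _ _ Hw (Rmin_l _ _))).
assert (Hw' := Rlt_le_trans _ _ _ Hw (Rmin_r _ _)).
destruct ((m =? 0) && (n =? 0))%Z%bool eqn:e.
- destruct (Z.eqb_spec m 0); destruct (Z.eqb_spec n 0); try discriminate. subst.
  rewrite lattice_point_0 in Hw'. replace (0 - z) with (- z) in Hw' by ring. rewrite Cmod_opp in Hw'. lra.
- now apply (H m n e).
Qed.

(** Differentiating the quasi-periodicity of zeta. *)
Lemma wp_period (tau z p e : C) : (0 < Im tau)%R ->
  (forall w, ~ in_lattice tau w -> ~ in_lattice tau (w + p)) ->
  (forall w, ~ in_lattice tau w -> wzeta tau (w + p) = wzeta tau w + e) ->
  ~ in_lattice tau z -> wp tau (z + p) = wp tau z.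
Proof.
intros ht Hp He Hz.
assert (D1 : cderiv (fun w => wzeta tau (w + p)) z (- wp tau (z + p))).
{ apply cderiv_shift. apply wzeta_deriv; auto. }
assert (D2 : cderiv (fun w => wzeta tau (w + p)) z (- wp tau z + 0)).
{ apply (cderiv_ext_loc (fun w => wzeta tau w + e)).
  - apply locally_Cmod. destruct (not_lattice_open tau z ht Hz) as [d [d0 H]].
    exists d. split; trivial. intros w Hw. symmetry. apply He. now apply H.
  - apply cderiv_plus; [now apply wzeta_deriv|apply cderiv_const]. }
assert (E := cderiv_unique _ _ _ _ D1 D2).
replace (wp tau (z + p)) with (- - wp tau (z + p)) by ring. rewrite E. ring.
Qed.

Lemma not_lattice_add1 (tau z : C) : ~ in_lattice tau z -> ~ in_lattice tau (z + 1).
Proof.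
intros H. replace (RtoC 1) with (lattice_point tau 1 0) by (unfold lattice_point; ring). now apply not_lattice_add.
Qed.

Lemma not_lattice_addtau (tau z : C) : ~ in_lattice tau z -> ~ in_lattice tau (z + tau).
Proof.
intros H. replace tau with (lattice_point tau 0 1) at 2 by (unfold lattice_point; ring). now apply not_lattice_add.
Qed.

Lemma wp_period1 (tau z : C) : (0 < Im tau)%R -> ~ in_lattice tau z -> wp tau (z + 1) = wp tau z.
Proof.
intros ht Hz. apply wp_period with (eta tau 1); trivial.
- apply not_lattice_add1.
- intros; now apply wzeta_period1.
Qed.

Lemma wp_period2 (tau z : C) : (0 < Im tau)%R -> ~ in_lattice tau z -> wp tau (z + tau) = wp tau z.
Proof.
intros ht Hz. apply wp_period with (eta tau 2); trivial.
- apply not_lattice_addtau.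
- intros; now apply wzeta_period2.
Qed.

(** With a = eps l these are the sums in q and F, with a constantly 1 the sum of the four
    translates of zeta; half-period translations permute the
    four terms up to quasi-periods. *)
Definition zeta_comb (tau : C) (a : nat -> C) (z : C) : C :=
  sum4 (fun k => a k * wzeta tau (z - omega tau k / 2)).
Definition wp_comb (tau : C) (a : nat -> C) (z : C) : C :=
  sum4 (fun k => a k * wp tau (z - omega tau k / 2)).
Definition wp_comb' (tau : C) (a : nat -> C) (z : C) : C :=
  sum4 (fun k => a k * wp' tau (z - omega tau k / 2)).

Lemma cderiv_sum4 (a : nat -> C) (f : nat -> C -> C) (l : nat -> C) (z : C) :
  (forall k, (k <= 3)%nat -> cderiv (f k) z (l k)) ->
  cderiv (fun w => sum4 (fun k => a k * f k w)) z (sum4 (fun k => a k * l k)).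
Proof.
intros H. apply (cderiv_ext (fun w => a 0%nat * f 0%nat w + a 1%nat * f 1%nat w + a 2%nat * f 2%nat w + a 3%nat * f 3%nat w)).
{ intros w. now rewrite sum4_eq. }
rewrite sum4_eq.
assert (K : forall k, (k <= 3)%nat -> cderiv (fun w => a k * f k w) z (a k * l k)).
{ intros k Hk. apply (cderiv_scal (a k) (f k)). auto. }
apply cderiv_plus; [apply cderiv_plus; [apply cderiv_plus|]|]; apply K; lia.
Qed.

Lemma zeta_comb_deriv (tau : C) (a : nat -> C) (z : C) : (0 < Im tau)%R -> ~ in_half tau z ->
  cderiv (zeta_comb tau a) z (- wp_comb tau a z).
Proof.
intros ht Hz.
apply (cderiv_eq _ _ (sum4 (fun k => a k * - wp tau (z - omega tau k / 2)))).
{ unfold wp_comb. rewrite !sum4_eq. ring. }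
apply (cderiv_sum4 a (fun k w => wzeta tau (w - omega tau k / 2))). intros k _.
apply (cderiv_shift (wzeta tau) z (- (omega tau k / 2))).
apply wzeta_deriv; trivial. now apply half_shift.
Qed.

Lemma wp_comb_deriv (tau : C) (a : nat -> C) (z : C) : (0 < Im tau)%R -> ~ in_half tau z ->
  cderiv (wp_comb tau a) z (wp_comb' tau a z).
Proof.
intros ht Hz.
apply (cderiv_sum4 a (fun k w => wp tau (w - omega tau k / 2))). intros k _.
apply (cderiv_shift (wp tau) z (- (omega tau k / 2))).
apply wp_deriv; trivial. now apply half_shift.
Qed.

Lemma wp_comb'_cont (tau : C) (a : nat -> C) (z : C) : (0 < Im tau)%R -> ~ in_half tau z ->
  ccont (wp_comb' tau a) z.
Proof.
intros ht Hz.
assert (K : forall k, ccont (fun w => a k * wp' tau (w - omega tau k / 2)) z).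
{ intros k. apply (ccont_mult (fun _ => a k)); [apply ccont_const|].
  apply (ccont_shift (wp' tau) z (- (omega tau k / 2))). apply wp'_cont; trivial. now apply half_shift. }
assert (S := ccont_plus _ _ _ (ccont_plus _ _ _ (ccont_plus _ _ _ (K 0%nat) (K 1%nat)) (K 2%nat)) (K 3%nat)).
intros e e0. destruct (S e e0) as [d [d0 Hd]]. exists d. split; trivial.
intros w Hw. unfold wp_comb'. rewrite !sum4_eq. now apply Hd.
Qed.

Lemma zeta_comb_half1 (tau : C) (a : nat -> C) (z : C) : (0 < Im tau)%R -> ~ in_half tau z ->
  zeta_comb tau a (z + 1 / 2) =
  a 1%nat * wzeta tau (z - omega tau 0 / 2) + a 0%nat * (wzeta tau (z - omega tau 1 / 2) + eta tau 1)
  + a 3%nat * wzeta tau (z - omega tau 2 / 2) + a 2%nat * (wzeta tau (z - omega tau 3 / 2) + eta tau 1).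
Proof.
intros ht Hz. unfold zeta_comb. rewrite sum4_eq.
rewrite <- !wzeta_period1 by (trivial; now apply half_shift).
unfold omega.
replace (z + 1 / 2 - 0 / 2) with (z - 1 / 2 + 1) by field.
replace (z + 1 / 2 - 1 / 2) with (z - 0 / 2) by field.
replace (z + 1 / 2 - tau / 2) with (z - (1 + tau) / 2 + 1) by field.
replace (z + 1 / 2 - (1 + tau) / 2) with (z - tau / 2) by field. ring.
Qed.

Lemma zeta_comb_half2 (tau : C) (a : nat -> C) (z : C) : (0 < Im tau)%R -> ~ in_half tau z ->
  zeta_comb tau a (z + tau / 2) =
  a 2%nat * wzeta tau (z - omega tau 0 / 2) + a 3%nat * wzeta tau (z - omega tau 1 / 2)
  + a 0%nat * (wzeta tau (z - omega tau 2 / 2) + eta tau 2)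
  + a 1%nat * (wzeta tau (z - omega tau 3 / 2) + eta tau 2).
Proof.
intros ht Hz. unfold zeta_comb. rewrite sum4_eq.
rewrite <- !wzeta_period2 by (trivial; now apply half_shift).
unfold omega.
replace (z + tau / 2 - 0 / 2) with (z - tau / 2 + tau) by field.
replace (z + tau / 2 - 1 / 2) with (z - (1 + tau) / 2 + tau) by field.
replace (z + tau / 2 - tau / 2) with (z - 0 / 2) by field.
replace (z + tau / 2 - (1 + tau) / 2) with (z - 1 / 2) by field. ring.
Qed.

Lemma wp_comb_half1 (tau : C) (a : nat -> C) (z : C) : (0 < Im tau)%R -> ~ in_half tau z ->
  wp_comb tau a (z + 1 / 2) =
  a 1%nat * wp tau (z - omega tau 0 / 2) + a 0%nat * wp tau (z - omega tau 1 / 2)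
  + a 3%nat * wp tau (z - omega tau 2 / 2) + a 2%nat * wp tau (z - omega tau 3 / 2).
Proof.
intros ht Hz. unfold wp_comb. rewrite sum4_eq.
rewrite <- (wp_period1 tau (z - omega tau 1 / 2)), <- (wp_period1 tau (z - omega tau 3 / 2))
 by (trivial; now apply half_shift).
unfold omega.
replace (z + 1 / 2 - 0 / 2) with (z - 1 / 2 + 1) by field.
replace (z + 1 / 2 - 1 / 2) with (z - 0 / 2) by field.
replace (z + 1 / 2 - tau / 2) with (z - (1 + tau) / 2 + 1) by field.
replace (z + 1 / 2 - (1 + tau) / 2) with (z - tau / 2) by field. ring.
Qed.

Lemma wp_comb_half2 (tau : C) (a : nat -> C) (z : C) : (0 < Im tau)%R -> ~ in_half tau z ->
  wp_comb tau a (z + tau / 2) =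
  a 2%nat * wp tau (z - omega tau 0 / 2) + a 3%nat * wp tau (z - omega tau 1 / 2)
  + a 0%nat * wp tau (z - omega tau 2 / 2) + a 1%nat * wp tau (z - omega tau 3 / 2).
Proof.
intros ht Hz. unfold wp_comb. rewrite sum4_eq.
rewrite <- (wp_period2 tau (z - omega tau 2 / 2)), <- (wp_period2 tau (z - omega tau 3 / 2))
 by (trivial; now apply half_shift).
unfold omega.
replace (z + tau / 2 - 0 / 2) with (z - tau / 2 + tau) by field.
replace (z + tau / 2 - 1 / 2) with (z - (1 + tau) / 2 + tau) by field.
replace (z + tau / 2 - tau / 2) with (z - 0 / 2) by field.
replace (z + tau / 2 - (1 + tau) / 2) with (z - 1 / 2) by field. ring.
Qed.

Definition zeta_comb_reg (tau : C) (a : nat -> C) (z : C) : C :=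
  a 0%nat * zeta_reg tau z + a 1%nat * wzeta tau (z - omega tau 1 / 2)
  + a 2%nat * wzeta tau (z - omega tau 2 / 2) + a 3%nat * wzeta tau (z - omega tau 3 / 2).
Definition wp_comb_reg (tau : C) (a : nat -> C) (z : C) : C :=
  a 0%nat * wp_reg tau z + a 1%nat * wp tau (z - omega tau 1 / 2)
  + a 2%nat * wp tau (z - omega tau 2 / 2) + a 3%nat * wp tau (z - omega tau 3 / 2).

Lemma zeta_comb_split (tau : C) (a : nat -> C) (z : C) :
  zeta_comb tau a z = a 0%nat / z + zeta_comb_reg tau a z.
Proof.
unfold zeta_comb, zeta_comb_reg. rewrite sum4_eq.
replace (z - omega tau 0 / 2) with z by (unfold omega; field).
rewrite (wzeta_split tau z). unfold Cdiv. ring.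
Qed.

Lemma wp_comb_split (tau : C) (a : nat -> C) (z : C) :
  wp_comb tau a z = a 0%nat / (z * z) + wp_comb_reg tau a z.
Proof.
unfold wp_comb, wp_comb_reg. rewrite sum4_eq.
replace (z - omega tau 0 / 2) with z by (unfold omega; field).
rewrite (wp_split tau z). unfold Cdiv. ring.
Qed.

Lemma half_period_off' (tau : C) (k : nat) : (0 < Im tau)%R -> (1 <= k <= 3)%nat ->
  ~ in_lattice tau (0 + - (omega tau k / 2)).
Proof. intros ht Hk. rewrite Cplus_0_l. now apply half_period_off. Qed.

Lemma zeta_comb_reg_deriv (tau : C) (a : nat -> C) : (0 < Im tau)%R ->
  cderiv (zeta_comb_reg tau a) 0 (- wp_comb_reg tau a 0).
Proof.
intros ht.
assert (K : forall k, (1 <= k <= 3)%nat ->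
  cderiv (fun w => a k * wzeta tau (w - omega tau k / 2)) 0 (- (a k * wp tau (0 - omega tau k / 2)))).
{ intros k Hk. apply (cderiv_eq _ _ (a k * - wp tau (0 + - (omega tau k / 2)))); [unfold Cminus; ring|].
  apply (cderiv_scal (a k) (fun w => wzeta tau (w - omega tau k / 2))).
  apply (cderiv_shift (wzeta tau)). apply wzeta_deriv; trivial. now apply half_period_off'. }
unfold wp_comb_reg.
apply (cderiv_eq _ _ (a 0%nat * - wp_reg tau 0 + - (a 1%nat * wp tau (0 - omega tau 1 / 2))
  + - (a 2%nat * wp tau (0 - omega tau 2 / 2)) + - (a 3%nat * wp tau (0 - omega tau 3 / 2)))); [ring|].
apply cderiv_plus; [|apply K; lia].
apply cderiv_plus; [|apply K; lia].
apply cderiv_plus; [|apply K; lia].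
apply cderiv_scal.
apply zeta_reg_deriv; trivial. now apply off_lattice0_0.
Qed.

Lemma wp_comb_reg_cont (tau : C) (a : nat -> C) : (0 < Im tau)%R -> ccont (wp_comb_reg tau a) 0.
Proof.
intros ht.
assert (K : forall k, (1 <= k <= 3)%nat -> ccont (fun w => a k * wp tau (w - omega tau k / 2)) 0).
{ intros k Hk. apply (ccont_mult (fun _ => a k)); [apply ccont_const|].
  apply (ccont_shift (wp tau)). eapply cderiv_ccont. apply wp_deriv; trivial. now apply half_period_off'. }
unfold wp_comb_reg.
apply (ccont_plus (fun z => a 0%nat * wp_reg tau z + a 1%nat * wp tau (z - omega tau 1 / 2) + a 2%nat * wp tau (z - omega tau 2 / 2))
  (fun z => a 3%nat * wp tau (z - omega tau 3 / 2))); [|apply K; lia].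
apply (ccont_plus (fun z => a 0%nat * wp_reg tau z + a 1%nat * wp tau (z - omega tau 1 / 2))
  (fun z => a 2%nat * wp tau (z - omega tau 2 / 2))); [|apply K; lia].
apply (ccont_plus (fun z => a 0%nat * wp_reg tau z) (fun z => a 1%nat * wp tau (z - omega tau 1 / 2))); [|apply K; lia].
apply (ccont_mult (fun _ => a 0%nat)); [apply ccont_const|].
eapply cderiv_ccont. apply wp_reg_deriv; trivial. now apply off_lattice0_0.
Qed.

(** All terms of the sum vanish; this normalization of wp is what makes
    c_1 + c_2 + c_3 equal to 0. *)
Lemma wp_reg_0 (tau : C) : (0 < Im tau)%R -> wp_reg tau 0 = 0.
Proof.
intros ht. apply Cmod_eq_0. apply Rle_antisym; [|apply Cmod_ge_0].
eapply Rle_trans; [apply (lattice_sum_bound tau _ 0)|lra]. intros m n nz. cbv beta.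
assert (w0 := lattice_nz tau m n ht nz). set (w := lattice_point tau m n) in *.
replace (1 / ((0 - w) * (0 - w)) - 1 / (w * w)) with (RtoC 0).
- rewrite Cmod_0. unfold Rdiv. rewrite Rmult_0_l. apply Rle_refl.
- field. intros e. apply w0. replace w with (- (0 - w)) by ring. rewrite e. ring.
Qed.

(** The regular part r is required to vanish at 0: then r z / z tends to r1, and the
    product of two such functions has no residue at 0. *)
Definition simple_pole (tau : C) (u : C -> C) (al s1 s2 r1 : C) : Prop :=
  (exists du, forall z, ~ in_half tau z -> cderiv u z (du z) /\ ccont du z) /\
  (s1 * s1 = 1 /\ s2 * s2 = 1 /\ forall z, ~ in_half tau z ->
     u (z + 1 / 2) = s1 * u z /\ u (z + tau / 2) = s2 * u z) /\
  exists r, (forall z, u z = al / z + r z) /\ r 0 = 0 /\ cderiv r 0 r1.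

Definition double_pole (tau : C) (w : C -> C) (al s1 s2 p0 : C) : Prop :=
  (exists dw, forall z, ~ in_half tau z -> cderiv w z (dw z) /\ ccont dw z) /\
  (forall z, ~ in_half tau z -> w (z + 1 / 2) = s1 * w z /\ w (z + tau / 2) = s2 * w z) /\
  exists p, (forall z, w z = al / (z * z) + p z) /\ p 0 = p0 /\ ccont p 0.

(** The simple poles of the product cancel since both regular parts vanish at 0, so
    w - u v tends to p0 - al * q1 - be * r1 at 0. *)
Lemma product_principle (tau : C) (u v w : C -> C) (al be s1 s2 t1 t2 r1 q1 p0 : C) :
  (0 < Im tau)%R ->
  simple_pole tau u al s1 s2 r1 -> simple_pole tau v be t1 t2 q1 ->
  double_pole tau w (al * be) (s1 * t1) (s2 * t2) p0 ->
  forall z, ~ in_half tau z -> w z - u z * v z = p0 - al * q1 - be * r1.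
Proof.
intros ht [[du Hdu] [[es1 [es2 Hu]] [r [Ru [r0 Dr]]]]] [[dv Hdv] [[et1 [et2 Hv]] [s [Rv [s0 Ds]]]]]
  [[dw Hdw] [Hw [p [Rw [<- Cp]]]]].
apply (liouville tau (fun z => w z - u z * v z) (fun z => dw z - (du z * v z + u z * dv z)) (s1 * t1) (s2 * t2)); trivial.
- intros z Hz. apply cderiv_minus; [now apply Hdw|]. apply cderiv_mult; [now apply Hdu|now apply Hdv].
- intros z Hz. destruct (Hdu z Hz) as [A1 B1]. destruct (Hdv z Hz) as [A2 B2].
  apply cderiv_ccont in A1, A2.
  apply (ccont_plus dw (fun z => - (du z * v z + u z * dv z))); [now apply Hdw|].
  apply ccont_opp. apply ccont_plus; now apply ccont_mult.
- replace (s1 * t1 * (s1 * t1)) with (s1 * s1 * (t1 * t1)) by ring. rewrite es1, et1. ring.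
- replace (s2 * t2 * (s2 * t2)) with (s2 * s2 * (t2 * t2)) by ring. rewrite es2, et2. ring.
- intros z Hz. destruct (Hu z Hz) as [-> _], (Hv z Hz) as [-> _], (Hw z Hz) as [-> _]. ring.
- intros z Hz. destruct (Hu z Hz) as [_ ->], (Hv z Hz) as [_ ->], (Hw z Hz) as [_ ->]. ring.
- intros e e0.
  assert (Crs : ccont (fun z => p z + - (r z * s z)) 0).
  { apply ccont_plus; trivial. apply ccont_opp. apply ccont_mult; eapply cderiv_ccont; eassumption. }
  pose (k := (1 + Cmod al + Cmod be)%R).
  assert (ca := Cmod_ge_0 al). assert (cb := Cmod_ge_0 be).
  assert (k1 : (1 <= k)%R) by (unfold k; lra).
  assert (ek : (0 < e / 2 / k)%R) by (apply Rdiv_lt_0_compat; lra).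
  destruct (Crs (e / 2)%R ltac:(lra)) as [d1 [d10 H1]].
  rewrite cderiv_eps in Dr, Ds.
  destruct (Dr _ ek) as [d2 [d20 H2]]. destruct (Ds _ ek) as [d3 [d30 H3]].
  exists (Rmin d1 (Rmin d2 d3)). split; [repeat apply Rmin_pos; trivial|].
  intros z Hz Nz. rewrite Ru, Rv, Rw.
  assert (z0 : z <> 0).
  { intros E. apply Nz. exists 0%Z, 0%Z. rewrite E, lattice_point_0. field. }
  specialize (H1 z (Rlt_le_trans _ _ _ Hz (Rmin_l _ _))).
  assert (Hz' := Rlt_le_trans _ _ _ Hz (Rmin_r _ _)).
  specialize (H2 z (Rlt_le_trans _ _ _ Hz' (Rmin_l _ _))).
  specialize (H3 z (Rlt_le_trans _ _ _ Hz' (Rmin_r _ _))).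
  rewrite r0 in H2. rewrite s0 in H3. rewrite r0, s0 in H1.
  replace (z - 0) with z in H2, H3 by ring.
  assert (cz : (0 < Cmod z)%R) by now apply Cmod_gt_0.
  assert (Q : forall x, (Cmod x <= e / 2 / k * Cmod z)%R -> (Cmod (x / z) <= e / 2 / k)%R).
  { intros x Hx. rewrite Cmod_div by trivial. apply Rmult_le_reg_r with (Cmod z); trivial.
    unfold Rdiv at 1. rewrite Rmult_assoc, Rinv_l; lra. }
  apply Q in H2, H3.
  set (X := (r z - 0 - z * r1) / z) in *. set (Y := (s z - 0 - z * q1) / z) in *.
  replace (al * be / (z * z) + p z - (al / z + r z) * (be / z + s z) - (p 0 - al * q1 - be * r1))
    with ((p z + - (r z * s z) - (p 0 + - (0 * 0))) + (- (al * Y) + - (be * X)))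
    by (unfold X, Y; field; trivial).
  eapply Rle_lt_trans; [apply Cmod_triangle|].
  assert (T := Cmod_triangle (- (al * Y)) (- (be * X))). rewrite !Cmod_opp, !Cmod_mult in T.
  assert (Cmod al * Cmod Y <= Cmod al * (e / 2 / k))%R by (apply Rmult_le_compat_l; lra).
  assert (Cmod be * Cmod X <= Cmod be * (e / 2 / k))%R by (apply Rmult_le_compat_l; lra).
  assert (E : (e / 2 = (1 + Cmod al + Cmod be) * (e / 2 / k))%R) by (unfold k; field; unfold k in k1; lra).
  lra.
Qed.

(** * The functions A_l and their algebraic relations *)

Definition ones (k : nat) : C := 1.

(** The function A_l; F = A_l + 2 T. *)
Definition Afun (tau : C) (l : nat) (z : C) : C := eta tau (3 - l) - zeta_comb tau (eps l) z.
Definition Areg (tau : C) (l : nat) (z : C) : C := eta tau (3 - l) - zeta_comb_reg tau (eps l) z.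

Ltac case_l l Hl := destruct l as [|[|[|[|l]]]]; [lia| | | |lia].

Lemma m1_opp : RtoC (-1) = - (1).
Proof. change (-1)%R with (Ropp 1). apply RtoC_opp. Qed.

Ltac eps_simpl := unfold eps; simpl Nat.eqb; simpl orb; cbv iota; rewrite ?m1_opp.

Lemma eps_sq (l k : nat) : eps l k * eps l k = 1.
Proof. eps_simpl. destruct ((k =? 0) || (k =? l))%nat%bool; rewrite ?m1_opp; ring. Qed.

Lemma eps_0 (l : nat) : eps l 0 = 1.
Proof. reflexivity. Qed.

Lemma eta_0 (tau : C) : eta tau 0 = 0.
Proof. reflexivity. Qed.

Lemma eta_half (tau : C) (k : nat) : (0 < Im tau)%R -> (1 <= k <= 3)%nat ->
  wzeta tau (- (omega tau k / 2)) = - (eta tau k / 2).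
Proof.
intros ht Hk.
assert (E : eta tau k = wzeta tau (- (omega tau k / 2) + omega tau k) - wzeta tau (- (omega tau k / 2))).
{ destruct k; [lia|reflexivity]. }
rewrite E. replace (- (omega tau k / 2) + omega tau k) with (- - (omega tau k / 2)) by field.
rewrite (wzeta_odd tau (- (omega tau k / 2))) by (trivial; now apply half_period_off). field.
Qed.

Lemma Afun_deriv (tau z : C) (l : nat) : (0 < Im tau)%R -> ~ in_half tau z ->
  cderiv (Afun tau l) z (wp_comb tau (eps l) z).
Proof.
intros ht Hz. apply (cderiv_eq _ _ (0 - - wp_comb tau (eps l) z)); [ring|].
apply cderiv_minus; [apply cderiv_const|now apply zeta_comb_deriv].
Qed.

Lemma Afun_split (tau z : C) (l : nat) : Afun tau l z = - (1) / z + Areg tau l z.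
Proof.
unfold Afun, Areg. rewrite zeta_comb_split, eps_0. unfold Cdiv. ring.
Qed.

(** By oddness zeta (- omega_k / 2) = - eta_k / 2, and the constant eta_(3-l) in F is
    exactly what compensates the sum of these values. *)
Lemma Areg_0 (tau : C) (l : nat) : (0 < Im tau)%R -> (1 <= l <= 3)%nat -> Areg tau l 0 = 0.
Proof.
intros ht Hl. unfold Areg, zeta_comb_reg.
assert (E : forall k, 0 - omega tau k / 2 = - (omega tau k / 2)) by (intros; ring).
rewrite !E, !eta_half by (trivial; lia).
assert (Z0 : zeta_reg tau 0 = 0).
{ assert (O := zeta_reg_odd tau 0 ht (off_lattice0_0 tau ht)).
  replace (- (0)) with (RtoC 0) in O by ring.
  replace (zeta_reg tau 0) with ((zeta_reg tau 0 + zeta_reg tau 0) / 2) by field.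
  rewrite O at 1. field. }
rewrite Z0, eta3 by trivial.
case_l l Hl; eps_simpl; simpl Nat.sub; rewrite ?eta_0; field.
Qed.

Lemma Areg_deriv (tau : C) (l : nat) : (0 < Im tau)%R ->
  cderiv (Areg tau l) 0 (wp_comb_reg tau (eps l) 0).
Proof.
intros ht. apply (cderiv_eq _ _ (0 - - wp_comb_reg tau (eps l) 0)); [ring|].
apply cderiv_minus; [apply cderiv_const|now apply zeta_comb_reg_deriv].
Qed.

Lemma Afun_half (tau z : C) (l : nat) : (0 < Im tau)%R -> (1 <= l <= 3)%nat -> ~ in_half tau z ->
  Afun tau l (z + 1 / 2) = eps l 1 * Afun tau l z /\
  Afun tau l (z + tau / 2) = eps l 2 * Afun tau l z.
Proof.
intros ht Hl Hz. unfold Afun. rewrite zeta_comb_half1, zeta_comb_half2 by trivial.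
unfold zeta_comb. rewrite sum4_eq.
case_l l Hl; eps_simpl; simpl Nat.sub; rewrite ?eta_0; split; ring.
Qed.

Lemma wp_comb_eps_half (tau z : C) (l : nat) : (0 < Im tau)%R -> (1 <= l <= 3)%nat -> ~ in_half tau z ->
  wp_comb tau (eps l) (z + 1 / 2) = eps l 1 * wp_comb tau (eps l) z /\
  wp_comb tau (eps l) (z + tau / 2) = eps l 2 * wp_comb tau (eps l) z.
Proof.
intros ht Hl Hz. rewrite wp_comb_half1, wp_comb_half2 by trivial.
unfold wp_comb. rewrite sum4_eq.
case_l l Hl; eps_simpl; split; ring.
Qed.

Lemma wp_comb_ones_half (tau z : C) : (0 < Im tau)%R -> ~ in_half tau z ->
  wp_comb tau ones (z + 1 / 2) = wp_comb tau ones z /\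
  wp_comb tau ones (z + tau / 2) = wp_comb tau ones z.
Proof.
intros ht Hz. rewrite wp_comb_half1, wp_comb_half2 by trivial.
unfold wp_comb, ones. rewrite sum4_eq. split; ring.
Qed.

Lemma not_half_opp (tau z : C) : ~ in_half tau z -> ~ in_half tau (- z).
Proof.
intros H [m [n E]]. apply H. exists (- m)%Z, (- n)%Z. rewrite lattice_point_opp.
replace z with (- - z) by ring. rewrite E. field.
Qed.

Lemma Afun_odd (tau z : C) (l : nat) : (0 < Im tau)%R -> (1 <= l <= 3)%nat -> ~ in_half tau z ->
  Afun tau l (- z) = - Afun tau l z.
Proof.
intros ht Hl Hz.
assert (K0 : wzeta tau (- z - omega tau 0 / 2) = - wzeta tau (z - omega tau 0 / 2)).
{ rewrite <- wzeta_odd by (trivial; now apply half_shift). f_equal. unfold omega. field. }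
assert (K1 : wzeta tau (- z - omega tau 1 / 2) = - (wzeta tau (z - omega tau 1 / 2) + eta tau 1)).
{ assert (N := half_shift tau z 1 Hz). rewrite <- wzeta_period1 by trivial.
  rewrite <- wzeta_odd by (trivial; now apply not_lattice_add1). f_equal. unfold omega. field. }
assert (K2 : wzeta tau (- z - omega tau 2 / 2) = - (wzeta tau (z - omega tau 2 / 2) + eta tau 2)).
{ assert (N := half_shift tau z 2 Hz). rewrite <- wzeta_period2 by trivial.
  rewrite <- wzeta_odd by (trivial; now apply not_lattice_addtau). f_equal. unfold omega. field. }
assert (K3 : wzeta tau (- z - omega tau 3 / 2) = - (wzeta tau (z - omega tau 3 / 2) + eta tau 1 + eta tau 2)).
{ assert (N := half_shift tau z 3 Hz). assert (N1 := not_lattice_add1 _ _ N).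
  rewrite <- wzeta_period1, <- wzeta_period2 by trivial.
  rewrite <- wzeta_odd by (trivial; now apply not_lattice_addtau). f_equal. unfold omega. field. }
unfold Afun, zeta_comb. rewrite !sum4_eq, K0, K1, K2, K3.
case_l l Hl; eps_simpl; simpl Nat.sub; rewrite ?eta_0; ring.
Qed.

(** The limit of P - A_l^2 at 0. *)
Definition cconst (tau : C) (l : nat) : C :=
  wp_comb_reg tau ones 0 + wp_comb_reg tau (eps l) 0 + wp_comb_reg tau (eps l) 0.

Lemma wp_comb_cont (tau : C) (a : nat -> C) (z : C) : (0 < Im tau)%R -> ~ in_half tau z ->
  ccont (wp_comb tau a) z.
Proof. intros ht Hz. eapply cderiv_ccont. now apply wp_comb_deriv. Qed.

Lemma Afun_pole (tau : C) (l : nat) : (0 < Im tau)%R -> (1 <= l <= 3)%nat ->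
  simple_pole tau (Afun tau l) (- (1)) (eps l 1) (eps l 2) (wp_comb_reg tau (eps l) 0).
Proof.
intros ht Hl. split; [|split].
- exists (wp_comb tau (eps l)). intros z Hz. split; [now apply Afun_deriv|now apply wp_comb_cont].
- split; [apply eps_sq|split; [apply eps_sq|]]. intros z Hz. now apply Afun_half.
- exists (Areg tau l). split; [intros z; apply Afun_split|].
  split; [now apply Areg_0|now apply Areg_deriv].
Qed.

Lemma wp_comb_pole (tau s1 s2 : C) (a : nat -> C) : (0 < Im tau)%R ->
  (forall z, ~ in_half tau z -> wp_comb tau a (z + 1 / 2) = s1 * wp_comb tau a z /\
     wp_comb tau a (z + tau / 2) = s2 * wp_comb tau a z) ->
  double_pole tau (wp_comb tau a) (a 0%nat) s1 s2 (wp_comb_reg tau a 0).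
Proof.
intros ht Ha. split; [|split; trivial].
- exists (wp_comb' tau a). intros z Hz. split; [now apply wp_comb_deriv|now apply wp_comb'_cont].
- exists (wp_comb_reg tau a). split; [intros z; apply wp_comb_split|].
  split; [reflexivity|now apply wp_comb_reg_cont].
Qed.

Lemma wp_sum_square (tau z : C) (l : nat) : (0 < Im tau)%R -> (1 <= l <= 3)%nat -> ~ in_half tau z ->
  wp_comb tau ones z = Afun tau l z * Afun tau l z + cconst tau l.
Proof.
intros ht Hl Hz. assert (PA := Afun_pole tau l ht Hl).
assert (K : wp_comb tau ones z - Afun tau l z * Afun tau l z =
  wp_comb_reg tau ones 0 - - (1) * wp_comb_reg tau (eps l) 0 - - (1) * wp_comb_reg tau (eps l) 0).
{ apply (product_principle tau _ _ _ _ _ _ _ _ _ _ _ _ ht PA PA); trivial. rewrite !eps_sq.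
  replace (- (1) * - (1)) with (ones 0%nat) by (unfold ones; ring).
  apply wp_comb_pole; trivial. intros u Hu. rewrite !Cmult_1_l. now apply wp_comb_ones_half. }
apply Cminus_0. transitivity (wp_comb tau ones z - Afun tau l z * Afun tau l z - cconst tau l); [ring|].
rewrite K. unfold cconst. ring.
Qed.

(** Under the half-period where eps_l is -1 the constant w - u v changes sign, hence is 0.
    Its expression at 0 then becomes a relation between values of wp at the half-periods. *)
Lemma wp_comb_eps_product (tau : C) (l m n : nat) : (0 < Im tau)%R ->
  (1 <= l <= 3)%nat -> (1 <= m <= 3)%nat -> (1 <= n <= 3)%nat ->
  eps m 1 * eps n 1 = eps l 1 -> eps m 2 * eps n 2 = eps l 2 ->
  (eps l 1 <> 1 \/ eps l 2 <> 1) ->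
  wp_comb_reg tau (eps l) 0 + wp_comb_reg tau (eps n) 0 + wp_comb_reg tau (eps m) 0 = 0 /\
  forall z, ~ in_half tau z -> wp_comb tau (eps l) z = Afun tau m z * Afun tau n z.
Proof.
intros ht Hl Hm Hn E1 E2 Hs.
assert (K : forall z, ~ in_half tau z -> wp_comb tau (eps l) z - Afun tau m z * Afun tau n z =
  wp_comb_reg tau (eps l) 0 - - (1) * wp_comb_reg tau (eps n) 0 - - (1) * wp_comb_reg tau (eps m) 0).
{ apply (product_principle tau _ _ _ _ _ _ _ _ _ _ _ _ ht (Afun_pole tau m ht Hm) (Afun_pole tau n ht Hn)).
  rewrite E1, E2. replace (- (1) * - (1)) with (eps l 0) by (rewrite eps_0; ring).
  apply wp_comb_pole; trivial. intros u Hu. now apply wp_comb_eps_half. }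
set (k := wp_comb_reg tau (eps l) 0 - - (1) * wp_comb_reg tau (eps n) 0 - - (1) * wp_comb_reg tau (eps m) 0) in K.
assert (k0 : k = 0).
{ destruct (half_dense tau 0 1 ht Rlt_0_1) as [z [_ Hz]].
  assert (s : exists s : C, s <> 1 /\ k = s * k).
  { destruct Hs as [Hs|Hs]; [exists (eps l 1)|exists (eps l 2)]; (split; [trivial|]).
    - rewrite <- (K (z + 1 / 2)) at 1 by now apply not_half_add1.
      destruct (wp_comb_eps_half tau z l ht Hl Hz) as [-> _].
      destruct (Afun_half tau z m ht Hm Hz) as [-> _]. destruct (Afun_half tau z n ht Hn Hz) as [-> _].
      rewrite <- (K z Hz), <- E1. ring.
    - rewrite <- (K (z + tau / 2)) at 1 by now apply not_half_add2.
      destruct (wp_comb_eps_half tau z l ht Hl Hz) as [_ ->].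
      destruct (Afun_half tau z m ht Hm Hz) as [_ ->]. destruct (Afun_half tau z n ht Hn Hz) as [_ ->].
      rewrite <- (K z Hz), <- E2. ring. }
  destruct s as [s [s1 Es]].
  assert (N : 1 - s <> 0). { intros e. apply s1. replace s with (1 - (1 - s)) by ring. rewrite e. ring. }
  replace k with ((k - s * k) / (1 - s)) by (field; trivial). rewrite <- Es. field. trivial. }
split.
- transitivity k; [unfold k; ring|exact k0].
- intros z Hz. specialize (K z Hz). rewrite k0 in K.
  now apply Cminus_0.
Qed.

Definition next_index (l : nat) : nat := match l with 1 => 2 | 2 => 3 | _ => 1 end%nat.

Lemma opp1_neq1 : - (1) <> RtoC 1.
Proof. intros E. injection E. lra. Qed.

Lemma next_index_range (l : nat) : (1 <= next_index l <= 3)%nat.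
Proof. destruct l as [|[|[|l]]]; simpl; lia. Qed.

Lemma Afun_deriv_product (tau z : C) (l : nat) : (0 < Im tau)%R -> (1 <= l <= 3)%nat -> ~ in_half tau z ->
  wp_comb tau (eps l) z = Afun tau (next_index l) z * Afun tau (next_index (next_index l)) z.
Proof.
intros ht Hl Hz. apply wp_comb_eps_product; trivial; try apply next_index_range;
case_l l Hl; simpl; eps_simpl; try ring;
try (now left; apply opp1_neq1); now right; apply opp1_neq1.
Qed.

(** The relation obtained at 0 from A_1' = A_2 A_3 says that the values of wp at the three
    half-periods add up to 0. *)
Lemma cconst_sum (tau : C) : (0 < Im tau)%R -> cconst tau 1 + cconst tau 2 + cconst tau 3 = 0.
Proof.
intros ht.
destruct (wp_comb_eps_product tau 1 2 3 ht) as [K _]; try lia; try (eps_simpl; ring).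
{ right. eps_simpl. apply opp1_neq1. }
assert (E : wp_comb_reg tau ones 0 =
  - (wp_comb_reg tau (eps 1) 0 + wp_comb_reg tau (eps 3) 0 + wp_comb_reg tau (eps 2) 0)).
{ unfold wp_comb_reg, ones. rewrite wp_reg_0 by trivial. eps_simpl. ring. }
unfold cconst. rewrite E.
replace (wp_comb_reg tau (eps 1) 0) with
  ((wp_comb_reg tau (eps 1) 0 + wp_comb_reg tau (eps 3) 0 + wp_comb_reg tau (eps 2) 0)
   - wp_comb_reg tau (eps 3) 0 - wp_comb_reg tau (eps 2) 0) by ring.
rewrite K. ring.
Qed.

Lemma cconst_sum_next (tau : C) (l : nat) : (0 < Im tau)%R -> (1 <= l <= 3)%nat ->
  cconst tau l + cconst tau (next_index l) + cconst tau (next_index (next_index l)) = 0.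
Proof.
intros ht Hl. rewrite <- (cconst_sum tau ht). case_l l Hl; simpl; ring.
Qed.

(** * Quasi-periods are not proportional to periods *)

Lemma gronwall (e e' : R -> R) (K : R) :
  (forall t, (0 <= t <= 1)%R -> is_derive e t (e' t)) ->
  (forall t, (0 <= t <= 1)%R -> (e' t <= K * e t)%R) ->
  e 0%R = 0%R -> (e 1%R <= 0)%R.
Proof.
intros He HK e0.
assert (D : forall t, (0 <= t <= 1)%R ->
  is_derive (fun s => e s * exp (- K * s))%R t ((e' t - K * e t) * exp (- K * t))%R).
{ intros t Ht. assert (H := He t Ht).
  evar_last.
  - apply (is_derive_mult e (fun s => exp (- K * s))%R t (e' t) (- K * exp (- K * t))%R).
    + exact H.
    + auto_derive; trivial. ring.
    + exact Rmult_comm.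
  - unfold plus, mult; simpl. ring. }
destruct (MVT_gen (fun s => e s * exp (- K * s))%R 0 1 (fun t => (e' t - K * e t) * exp (- K * t))%R) as [c [Hc E]].
- intros x Hx. rewrite Rmin_left, Rmax_right in Hx by lra. apply D. lra.
- intros x Hx. rewrite Rmin_left, Rmax_right in Hx by lra. apply continuity_pt_filterlim.
  apply (ex_derive_continuous (V := R_NormedModule) (fun s => e s * exp (- K * s))%R). eexists. now apply D.
- rewrite Rmin_left, Rmax_right in Hc by lra. rewrite e0 in E.
  assert (p1 := exp_pos (- K * 1)). assert (p2 := exp_pos (- K * c)). specialize (HK c Hc).
  assert (N : ((e' c - K * e c) * exp (- K * c) <= 0)%R).
  { rewrite <- (Rmult_0_l (exp (- K * c))). apply Rmult_le_compat_r; lra. }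
  apply Rnot_lt_le. intros L.
  assert (0 < e 1 * exp (- K * 1))%R by now apply Rmult_lt_0_compat. lra.
Qed.

Lemma cderiv_line_Im (f : C -> C) (l z w : C) (t : R) :
  cderiv f (z + t * w) l -> is_derive (fun s : R => Im (f (z + s * w))) t (Im (w * l)).
Proof.
intros H. apply (is_derive_ext (fun s : R => Re (- Ci * f (z + s * w)))).
{ intros s. now rewrite <- Im_Re. }
replace (Im (w * l)) with (Re (w * (- Ci * l))) by (rewrite (Im_Re (w * l)); f_equal; ring).
apply (cderiv_line (fun u => - Ci * f u)).
now apply cderiv_scal.
Qed.

(** Uniqueness for linear systems along a segment, for the function |f1|^2 + |f2|^2. *)
Lemma segment_gronwall (f1 f2 : C -> C) (d1 d2 : R -> C) (z w : C) (B : R) :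
  (forall t : R, (0 <= t <= 1)%R -> cderiv f1 (z + t * w)%C (d1 t)) ->
  (forall t : R, (0 <= t <= 1)%R -> cderiv f2 (z + t * w)%C (d2 t)) ->
  (forall t : R, (0 <= t <= 1)%R -> (Cmod (d1 t) <= B * (Cmod (f1 (z + t * w)%C) + Cmod (f2 (z + t * w)%C)))%R) ->
  (forall t : R, (0 <= t <= 1)%R -> (Cmod (d2 t) <= B * (Cmod (f1 (z + t * w)%C) + Cmod (f2 (z + t * w)%C)))%R) ->
  f1 z = 0 -> f2 z = 0 -> f1 (z + w)%C = 0 /\ f2 (z + w)%C = 0.
Proof.
intros D1 D2 B1 B2 z1 z2.
pose (sq := fun x : C => (Re x * Re x + Im x * Im x)%R).
assert (Hsq : forall x, (sq x = Cmod x * Cmod x)%R).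
{ intros x. replace (Cmod x * Cmod x)%R with (Cmod x ^ 2)%R by ring. rewrite Cmod2_alt. unfold sq. ring. }
pose (e := fun t : R => (sq (f1 (z + t * w)%C) + sq (f2 (z + t * w)%C))%R).
pose (dsq := fun x d => (Re d * Re x + Re x * Re d + (Im d * Im x + Im x * Im d))%R).
assert (Dsq : forall f l t, cderiv f (z + RtoC t * w)%C l ->
   is_derive (fun s : R => sq (f (z + s * w)%C)) t (dsq (f (z + t * w)%C) (w * l)%C)).
{ intros f l t H.
  apply (is_derive_plus (V := R_NormedModule)).
  - apply (is_derive_mult (fun s : R => Re (f (z + s * w)%C)) (fun s : R => Re (f (z + s * w)%C))); try (now apply cderiv_line). exact Rmult_comm.
  - apply (is_derive_mult (fun s : R => Im (f (z + s * w)%C)) (fun s : R => Im (f (z + s * w)%C))); try (now apply cderiv_line_Im). exact Rmult_comm. }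
assert (dsqB : forall x d, (dsq x d <= 2 * (Cmod x * Cmod d))%R).
{ intros x d. assert (K := re_le_Cmod (Cconj x * d)). rewrite Cmod_mult, Cmod_conj in K.
  assert (K2 := Rle_trans _ _ _ (Rle_abs _) K).
  replace (dsq x d) with (2 * Re (Cconj x * d)%C)%R; [lra|].
  unfold dsq, Re, Im, Cconj, Cmult; simpl. ring. }
assert (L : (e 1%R <= 0)%R).
{ apply (gronwall e (fun t => (dsq (f1 (z + t * w)%C) (w * d1 t)%C + dsq (f2 (z + t * w)%C) (w * d2 t)%C))%R (4 * (Cmod w * B))).
  - intros t Ht. apply (is_derive_plus (V := R_NormedModule)); apply Dsq; auto.
  - intros t Ht. unfold e. rewrite !Hsq. specialize (B1 t Ht). specialize (B2 t Ht).
    assert (K1 := dsqB (f1 (z + t * w)%C) (w * d1 t)%C). assert (K2 := dsqB (f2 (z + t * w)%C) (w * d2 t)%C).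
    rewrite Cmod_mult in K1, K2.
    assert (p1 := Cmod_ge_0 (f1 (z + t * w)%C)). assert (p2 := Cmod_ge_0 (f2 (z + t * w)%C)).
    set (a := Cmod (f1 (z + t * w)%C)) in *. set (b := Cmod (f2 (z + t * w)%C)) in *.
    assert (cw := Cmod_ge_0 w). set (m := Cmod w) in *.
    assert (M1 : (a * (m * Cmod (d1 t)) <= a * (m * (B * (a + b))))%R).
    { repeat apply Rmult_le_compat_l; trivial. }
    assert (M2 : (b * (m * Cmod (d2 t)) <= b * (m * (B * (a + b))))%R).
    { repeat apply Rmult_le_compat_l; trivial. }
    assert (mB : (0 <= m * B * ((a - b) * (a - b)))%R).
    { destruct (Rle_lt_or_eq_dec 0 (a + b)) as [s|s]; [lra| |].
      - assert (0 <= B)%R.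
        { assert (0 <= B * (a + b))%R by (eapply Rle_trans; [apply Cmod_ge_0|exact B1]).
          apply Rnot_lt_le. intros n. assert (B * (a + b) < 0 * (a + b))%R by (apply Rmult_lt_compat_r; lra). lra. }
        apply Rmult_le_pos; [now apply Rmult_le_pos|apply Rle_0_sqr].
      - replace a with 0%R by lra. replace b with 0%R by lra. lra. }
    lra.
  - unfold e. replace (z + 0%R * w) with z by ring. rewrite z1, z2. unfold sq, Re, Im; simpl. ring. }
unfold e in L. replace (z + 1%R * w) with (z + w) in L by ring. rewrite !Hsq in L.
assert (p1 := Cmod_ge_0 (f1 (z + w)%C)). assert (p2 := Cmod_ge_0 (f2 (z + w)%C)).
split; apply Cmod_eq_0; nra.
Qed.

Lemma real_not_half (tau : C) (x : R) : (0 < Im tau)%R -> (0 < Rabs x < 1/2)%R -> ~ in_half tau (RtoC x).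
Proof.
intros ht Hx [m [n E]].
assert (E2 : RtoC 2 * RtoC x = lattice_point tau m n) by (rewrite E; field).
assert (I : Im (RtoC 2 * RtoC x) = Im (lattice_point tau m n)) by now rewrite E2.
assert (R0 : Re (RtoC 2 * RtoC x) = Re (lattice_point tau m n)) by now rewrite E2.
unfold lattice_point, Re, Im, RtoC, Cplus, Cmult in I, R0; simpl in I, R0. unfold Im in ht.
assert (n0 : IZR n = 0%R).
{ apply Rmult_eq_reg_r with (snd tau); lra. }
rewrite n0 in R0.
assert (M : (0 < Rabs (IZR m) < 1)%R).
{ replace (IZR m) with (2 * x)%R by lra. rewrite Rabs_mult, (Rabs_right 2) by lra. lra. }
rewrite <- abs_IZR in M. destruct M as [M1 M2]. apply lt_IZR in M1, M2. lia.
Qed.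

(** Otherwise v = c0 - Z - kap z, with Z the sum of the translates of zeta, is elliptic for the half lattice with a single simple pole,
    and [product_principle] gives A_1' = A_1 v.  As A_1 is odd with period 1/2, it vanishes at
    1/4; being a solution of a linear equation, it vanishes on the whole interval from 0 to
    1/4, against its pole at 0. *)
Lemma quasi_periods_independent (tau kap : C) : (0 < Im tau)%R ->
  4 * eta tau 1 + kap = 0 -> 4 * eta tau 2 + kap * tau = 0 -> False.
Proof.
intros ht H1 H2.
pose (c0 := zeta_comb_reg tau ones 0).
pose (v := fun z => c0 - zeta_comb tau ones z - kap * z).
assert (Dk : forall z, cderiv (fun z => kap * z) z kap).
{ intros z. apply (cderiv_eq _ _ (kap * 1)); [ring|]. apply (cderiv_scal kap (fun z => z)), cderiv_id. }
assert (Dv : forall z, ~ in_half tau z -> cderiv v z (wp_comb tau ones z - kap)).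
{ intros z Hz. apply (cderiv_eq _ _ (0 - - wp_comb tau ones z - kap)); [ring|].
  apply cderiv_minus; [|apply Dk]. apply cderiv_minus; [apply cderiv_const|now apply zeta_comb_deriv]. }
assert (per : forall u, ~ in_half tau u -> v (u + 1 / 2) = 1 * v u /\ v (u + tau / 2) = 1 * v u).
{ intros u Hu. unfold v. rewrite zeta_comb_half1, zeta_comb_half2 by trivial.
  unfold zeta_comb. rewrite sum4_eq. unfold ones. split.
  - replace kap with (- (4) * eta tau 1 + (4 * eta tau 1 + kap)) by ring. rewrite H1. field.
  - replace (kap * (u + tau / 2)) with (kap * u + (- (4) * eta tau 2 + (4 * eta tau 2 + kap * tau)) / 2) by field.
    rewrite H2. field. }
assert (PA := Afun_pole tau 1 ht ltac:(lia)).
assert (Pv : simple_pole tau v (- (1)) 1 1 (0 - - wp_comb_reg tau ones 0 - kap)).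
{ split; [|split].
  - exists (fun z => wp_comb tau ones z - kap). intros z Hz. split; [now apply Dv|].
    apply (ccont_plus _ (fun _ => - kap)); [now apply wp_comb_cont|apply ccont_const].
  - split; [ring|split; [ring|exact per]].
  - exists (fun z => c0 - zeta_comb_reg tau ones z - kap * z). split; [|split].
    + intros z. unfold v. rewrite zeta_comb_split. unfold ones at 1. unfold Cdiv. ring.
    + unfold c0. ring.
    + apply cderiv_minus; [|apply Dk]. apply cderiv_minus; [apply cderiv_const|now apply zeta_comb_reg_deriv]. }
assert (Hk : exists k, forall z, ~ in_half tau z -> wp_comb tau (eps 1) z - Afun tau 1 z * v z = k).
{ eexists. apply (product_principle tau _ _ _ _ _ _ _ _ _ _ _ (wp_comb_reg tau (eps 1) 0) ht PA Pv). rewrite !Cmult_1_r.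
  replace (- (1) * - (1)) with (eps 1 0) by (rewrite eps_0; ring).
  apply wp_comb_pole; trivial. intros u Hu. apply wp_comb_eps_half; trivial; lia. }
destruct Hk as [k Hk].
assert (q4 : ~ in_half tau (RtoC (1/4))).
{ apply real_not_half; trivial. rewrite Rabs_right; lra. }
assert (k0 : k = 0).
{ assert (k = - k).
  { rewrite <- (Hk (RtoC (1/4) + tau / 2)) at 1 by now apply not_half_add2.
    destruct (wp_comb_eps_half tau _ 1 ht ltac:(lia) q4) as [_ ->].
    destruct (Afun_half tau _ 1 ht ltac:(lia) q4) as [_ ->], (per _ q4) as [_ ->].
    rewrite <- (Hk _ q4). eps_simpl. ring. }
  replace k with ((k - - k) / 2) by field. rewrite <- H. field. }
assert (ode : forall z, ~ in_half tau z -> cderiv (Afun tau 1) z (v z * Afun tau 1 z)).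
{ intros z Hz. apply (cderiv_eq _ _ (wp_comb tau (eps 1) z)); [|now apply Afun_deriv].
  replace (wp_comb tau (eps 1) z) with ((wp_comb tau (eps 1) z - Afun tau 1 z * v z) + Afun tau 1 z * v z) by ring.
  rewrite Hk by trivial. rewrite k0. ring. }
assert (A4 : Afun tau 1 (RtoC (1/4)) = 0).
{ assert (q4' := not_half_opp _ _ q4).
  assert (E : Afun tau 1 (RtoC (1/4)) = - Afun tau 1 (RtoC (1/4))).
  { rewrite <- Afun_odd by (trivial; lia).
    destruct (Afun_half tau _ 1 ht ltac:(lia) q4') as [E _].
    replace (- RtoC (1/4) + 1 / 2) with (RtoC (1/4)) in E.
    - rewrite E. eps_simpl. ring.
    - rewrite RtoC_div by lra. field. }
  replace (Afun tau 1 (RtoC (1/4))) with ((Afun tau 1 (RtoC (1/4)) - - Afun tau 1 (RtoC (1/4))) / 2) by field.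
  rewrite <- E. field. }
assert (Zero : forall t : R, (0 < t < 1/4)%R -> Afun tau 1 (RtoC t) = 0).
{ intros t Ht. pose (w := RtoC (t - 1/4)).
  assert (on : forall x : R, (0 <= x <= 1)%R -> ~ in_half tau (RtoC (1/4) + x * w)).
  { intros x Hx. unfold w. rewrite <- RtoC_mult, <- RtoC_plus. apply real_not_half; trivial.
    assert (0 < 1 / 4 + x * (t - 1 / 4) < 1/2)%R by nra. rewrite Rabs_right; lra. }
  assert (bound : exists B : R, forall x : R, (0 <= x <= 1)%R -> (Cmod (v (RtoC (1/4) + x * w)%C) <= B)%R).
  (* v is bounded on the segment, one component at a time *)
  { assert (comp : forall g : R -> R, (forall x, (0 <= x <= 1)%R -> ex_derive g x) ->
      exists m : R, forall x, (0 <= x <= 1)%R -> (Rabs (g x) <= m)%R).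
    { intros g Hg. destruct (continuity_ab_maj (fun x => Rabs (g x)) 0 1) as [m [Hm _]]; [lra| |now exists (Rabs (g m))].
      intros x Hx. apply (continuity_pt_comp g Rabs); [|apply Rcontinuity_abs].
      apply continuity_pt_filterlim. now apply (ex_derive_continuous (V := R_NormedModule) g), Hg. }
    destruct (comp (fun x : R => Re (v (RtoC (1/4) + x * w)%C))) as [m1 M1].
    { intros x Hx. eexists. now apply cderiv_line, Dv, on. }
    destruct (comp (fun x : R => Im (v (RtoC (1/4) + x * w)%C))) as [m2 M2].
    { intros x Hx. eexists. now apply cderiv_line_Im, Dv, on. }
    exists (m1 + m2)%R. intros x Hx. specialize (M1 x Hx). specialize (M2 x Hx).
    destruct (v (RtoC (1/4) + x * w)) as [a b].
    eapply Rle_trans; [apply Cmod_le_sum|]. simpl in M1, M2. lra. }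
  destruct bound as [B HB].
  destruct (segment_gronwall (Afun tau 1) (fun _ => 0) (fun x => v (RtoC (1/4) + x * w) * Afun tau 1 (RtoC (1/4) + x * w))
    (fun _ => 0) (RtoC (1/4)) w B) as [R1 _]; trivial.
  - intros x Hx. now apply ode, on.
  - intros x Hx. apply cderiv_const.
  - intros x Hx. rewrite Cmod_mult, Cmod_0, Rplus_0_r. apply Rmult_le_compat_r; [apply Cmod_ge_0|now apply HB].
  - intros x Hx. rewrite !Cmod_0. rewrite Rplus_0_r. apply Rmult_le_pos; [|apply Cmod_ge_0].
    eapply Rle_trans; [apply Cmod_ge_0|now apply (HB x)].
  - replace (RtoC t) with (RtoC (1/4) + w); trivial. unfold w. rewrite <- RtoC_plus. f_equal. ring. }
(* near 0 the pole - 1 / t dominates, so A_1 cannot vanish there *)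
assert (C0 : ccont (Areg tau 1) 0) by (eapply cderiv_ccont; now apply Areg_deriv).
destruct (C0 1%R Rlt_0_1) as [d [d0 Hd]].
pose (t := Rmin (1/8) (d/2)).
assert (t0 : (0 < t)%R) by (apply Rmin_pos; lra).
assert (t8 : (t <= 1/8)%R) by apply Rmin_l. assert (td : (t <= d/2)%R) by apply Rmin_r.
assert (Zt := Zero t ltac:(lra)). rewrite Afun_split in Zt.
assert (bt : (Cmod (RtoC t - 0) < d)%R).
{ replace (RtoC t - 0) with (RtoC t) by ring. rewrite Cmod_R, Rabs_right; lra. }
specialize (Hd _ bt). rewrite (Areg_0 tau 1 ht ltac:(lia)) in Hd.
replace (Areg tau 1 (RtoC t) - 0) with (RtoC (/ t)) in Hd.
- rewrite Cmod_R, Rabs_right in Hd by (apply Rle_ge, Rlt_le, Rinv_0_lt_compat; lra).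
  assert (1 < / t)%R; [|lra]. rewrite <- Rinv_1. apply Rinv_lt_contravar; lra.
- rewrite RtoC_inv by lra.
  replace (Areg tau 1 (RtoC t) - 0) with ((- (1) / RtoC t + Areg tau 1 (RtoC t)) + / RtoC t) by (unfold Cdiv; ring).
  rewrite Zt. ring.
Qed.

(** * Two-by-two matrices that preserve a symmetric form *)

Definition mat2 (a b c d : C) : @matrix C 2 2 := ((a, (b, tt)), ((c, (d, tt)), tt)).
Lemma mat2_eta (M : @matrix C 2 2) : exists a b c d, M = mat2 a b c d.
Proof. destruct M as [[a [b []]] [[c [d []]] []]]. now exists a, b, c, d. Qed.
Lemma Mmult_mat2 (a b c d a' b' c' d' : C) :
  Mmult (mat2 a b c d) (mat2 a' b' c' d') =
  mat2 (a * a' + b * c') (a * b' + b * d') (c * a' + d * c') (c * b' + d * d').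
Proof.
unfold Mmult, mk_matrix; simpl. rewrite !sum_Sn, !sum_O. reflexivity.
Qed.
Lemma Mmult_col2 (a b c d x y : C) :
  Mmult (mat2 a b c d) (col2 x y) = col2 (a * x + b * y) (c * x + d * y).
Proof.
unfold Mmult, col2, mk_matrix; simpl. rewrite !sum_Sn, !sum_O. reflexivity.
Qed.
Lemma Mone_mat2 : (Mone : @matrix C 2 2) = mat2 1 0 0 1.
Proof. reflexivity. Qed.
Lemma diagonal2_mat2 (a b c d : C) : diagonal2 (mat2 a b c d) <-> b = 0 /\ c = 0.
Proof. reflexivity. Qed.
Lemma col2_inj (a b a' b' : C) : col2 a b = col2 a' b' -> a = a' /\ b = b'.
Proof. intros E. now injection E. Qed.
Lemma mat2_inj (a b c d a' b' c' d' : C) : mat2 a b c d = mat2 a' b' c' d' ->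
  a = a' /\ b = b' /\ c = c' /\ d = d'.
Proof. intros E. now injection E. Qed.

Lemma C_sqrt (x : C) : exists s : C, s * s = x.
Proof.
destruct (polar x) as [th E]. set (r := Cmod x) in *.
exists (RtoC (sqrt r) * (cos (th / 2), sin (th / 2))).
assert (rr : RtoC (sqrt r) * RtoC (sqrt r) = RtoC r).
{ rewrite <- RtoC_mult, sqrt_sqrt; trivial. apply Cmod_ge_0. }
replace (RtoC (sqrt r) * (cos (th / 2), sin (th / 2)) * (RtoC (sqrt r) * (cos (th / 2), sin (th / 2))))
  with ((RtoC (sqrt r) * RtoC (sqrt r)) * ((cos (th / 2), sin (th / 2)) * (cos (th / 2), sin (th / 2)))) by ring.
rewrite rr, E. replace th with (2 * (th / 2))%R by field.
replace (2 * (th / 2) / 2)%R with (th / 2)%R by field.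
rewrite cos_2a, sin_2a. unfold Cmult, RtoC; simpl. f_equal; ring.
Qed.

(** M G M^T = G for G = (g11, g12; g12, g22), entry by entry, together with det M = 1. *)
Definition preserves (g11 g12 g22 : C) (M : @matrix C 2 2) : Prop :=
  exists a b c d, M = mat2 a b c d /\ a * d - b * c = 1 /\
  a * a * g11 + 2 * (a * b) * g12 + b * b * g22 = g11 /\
  a * c * g11 + (a * d + b * c) * g12 + b * d * g22 = g12 /\
  c * c * g11 + 2 * (c * d) * g12 + d * d * g22 = g22.

(** For determinant one, M^-T = J M J^-1 with J = (0, 1; -1, 0), so M G M^T = G says that M
    commutes with G J; these are the entries of that identity.  The coefficients in the
    proof come from multiplying M G M^T = G by M^-T. *)
Lemma preserves_commutes (g11 g12 g22 : C) (M : @matrix C 2 2) : preserves g11 g12 g22 M ->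
  exists a b c d, M = mat2 a b c d /\ a * d - b * c = 1 /\
  b * g22 + c * g11 = 0 /\ (a - d) * g11 + 2 * b * g12 = 0 /\ (a - d) * g22 - 2 * c * g12 = 0.
Proof.
intros [a [b [c [d [EM [det [E11 [E12 E22]]]]]]]]. exists a, b, c, d.
apply Cminus_eq in E11, E12, E22. apply Cminus_eq in det.
split; [trivial|]. split; [now apply Cminus_0|].
set (e11 := a * a * g11 + 2 * (a * b) * g12 + b * b * g22 - g11) in *.
set (e12 := a * c * g11 + (a * d + b * c) * g12 + b * d * g22 - g12) in *.
set (e22 := c * c * g11 + 2 * (c * d) * g12 + d * d * g22 - g22) in *.
set (dd := a * d - b * c - 1) in *.
repeat split.
- replace (b * g22 + c * g11) with (- c * e11 + a * e12 - (a * g12 + b * g22) * dd) by (unfold e11, e12, dd; ring).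
  rewrite E11, E12, det. ring.
- replace ((a - d) * g11 + 2 * b * g12) with (d * e11 - b * e12 - (a * g11 + b * g12) * dd) by (unfold e11, e12, dd; ring).
  rewrite E11, E12, det. ring.
- replace ((a - d) * g22 - 2 * c * g12) with (- (- c * e12 + a * e22 - (c * g12 + d * g22) * dd)) by (unfold e22, e12, dd; ring).
  rewrite E22, E12, det. ring.
Qed.

(** G J has trace 0 and determinant - s^2, hence the distinct eigenvalues s and - s; the rows of P
    are left eigenvectors: rows of G J + s and of G J - s, the first ones or the second ones
    according to which of g11 and g22 is nonzero. *)
Lemma nondegenerate_diagonalizable (g11 g12 g22 : C) (M1 M2 : @matrix C 2 2) :
  g12 * g12 - g11 * g22 <> 0 ->
  preserves g11 g12 g22 M1 -> preserves g11 g12 g22 M2 ->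
  simultaneously_diagonalizable M1 M2.
Proof.
intros disc H1 H2. destruct (C_sqrt (g12 * g12 - g11 * g22)) as [s Es].
assert (s0 : s <> 0). { intros e. apply disc. rewrite <- Es, e. ring. }
assert (es : s * s - (g12 * g12 - g11 * g22) = 0) by (rewrite Es; ring).
destruct (Ceq_dec g22 0) as [z22|n22]; [destruct (Ceq_dec g11 0) as [z11|n11]|].
- subst g11 g22.
  assert (n12 : g12 <> 0). { intros e. apply disc. rewrite e. ring. }
  exists Mone, Mone. rewrite Mone_mat2.
  assert (K : forall M, preserves 0 g12 0 M -> diagonal2 (Mmult (Mmult (mat2 1 0 0 1) M) (mat2 1 0 0 1))).
  { intros M H. destruct (preserves_commutes _ _ _ _ H) as [a [b [c [d [-> [_ [_ [e2 e3]]]]]]]].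
    assert (b0 : b = 0).
    { replace b with (((a - d) * 0 + 2 * b * g12) / (2 * g12)) by (field; trivial). rewrite e2. field. trivial. }
    assert (c0 : c = 0).
    { replace c with (- ((a - d) * 0 - 2 * c * g12) / (2 * g12)) by (field; trivial). rewrite e3. field. trivial. }
    rewrite !Mmult_mat2, diagonal2_mat2, b0, c0. split; ring. }
  rewrite !Mmult_mat2. split; [f_equal; ring|]. split; [f_equal; ring|]. split; now apply K.
- pose (P := mat2 (s - g12) g11 (- s - g12) g11).
  pose (P' := mat2 (g11 / (2 * s * g11)) (- g11 / (2 * s * g11)) ((s + g12) / (2 * s * g11)) ((s - g12) / (2 * s * g11))).
  exists P, P'. rewrite Mone_mat2. unfold P, P'.
  assert (K : forall M, preserves g11 g12 g22 M -> diagonal2 (Mmult (Mmult P M) P')).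
  { intros M H. destruct (preserves_commutes _ _ _ _ H) as [a [b [c [d [-> [_ [e1 [e2 e3]]]]]]]].
    unfold P, P'. rewrite !Mmult_mat2, diagonal2_mat2. split.
    - match goal with |- ?x = _ => replace x with ((- (s - g12) * ((a - d) * g11 + 2 * b * g12) - g11 * (b * g22 + c * g11)
        + b * (s * s - (g12 * g12 - g11 * g22))) / (2 * s * g11)) by (field; auto) end.
      rewrite e1, e2, es. field. auto.
    - match goal with |- ?x = _ => replace x with ((- (s + g12) * ((a - d) * g11 + 2 * b * g12) + g11 * (b * g22 + c * g11)
        - b * (s * s - (g12 * g12 - g11 * g22))) / (2 * s * g11)) by (field; auto) end.
      rewrite e1, e2, es. field. auto. }
  split; [rewrite Mmult_mat2; f_equal; field; auto|]. split; [rewrite Mmult_mat2; f_equal; field; auto|]. split; now apply K.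
- pose (P := mat2 (- g22) (s + g12) (- g22) (- s + g12)).
  pose (P' := mat2 ((- s + g12) / (2 * s * g22)) (- (s + g12) / (2 * s * g22)) (g22 / (2 * s * g22)) (- g22 / (2 * s * g22))).
  exists P, P'. rewrite Mone_mat2. unfold P, P'.
  assert (K : forall M, preserves g11 g12 g22 M -> diagonal2 (Mmult (Mmult P M) P')).
  { intros M H. destruct (preserves_commutes _ _ _ _ H) as [a [b [c [d [-> [_ [e1 [e2 e3]]]]]]]].
    unfold P, P'. rewrite !Mmult_mat2, diagonal2_mat2. split.
    - match goal with |- ?x = _ => replace x with (((s + g12) * ((a - d) * g22 - 2 * c * g12) + g22 * (b * g22 + c * g11)
        - c * (s * s - (g12 * g12 - g11 * g22))) / (2 * s * g22)) by (field; auto) end.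
      rewrite e1, e3, es. field. auto.
    - match goal with |- ?x = _ => replace x with ((- (- s + g12) * ((a - d) * g22 - 2 * c * g12) - g22 * (b * g22 + c * g11)
        + c * (s * s - (g12 * g12 - g11 * g22))) / (2 * s * g22)) by (field; auto) end.
      rewrite e1, e3, es. field. auto. }
  split; [rewrite Mmult_mat2; f_equal; field; auto|]. split; [rewrite Mmult_mat2; f_equal; field; auto|]. split; now apply K.
Qed.

(** Now G J is nilpotent and nonzero, and M = a + b G J has a double eigenvalue; being
    diagonalizable, it is scalar. *)
Lemma degenerate_scalar (g11 g12 g22 : C) (P P' M : @matrix C 2 2) :
  g12 * g12 - g11 * g22 = 0 -> (g11 <> 0 \/ g22 <> 0) ->
  preserves g11 g12 g22 M ->
  Mmult P P' = Mone -> Mmult P' P = Mone -> diagonal2 (Mmult (Mmult P M) P') ->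
  exists sg, sg * sg = 1 /\ M = mat2 sg 0 0 sg.
Proof.
intros disc nz H HP HP' HD.
destruct (preserves_commutes _ _ _ _ H) as [a [b [c [d [EM [det [e1 [e2 e3]]]]]]]].
assert (discM : (a - d) * (a - d) + 4 * (b * c) = 0).
{ destruct nz as [n|n].
  - replace ((a - d) * (a - d) + 4 * (b * c)) with
      ((((a - d) * g11 - 2 * b * g12) * ((a - d) * g11 + 2 * b * g12) + 4 * b * g11 * (b * g22 + c * g11)
        + 4 * (b * b) * (g12 * g12 - g11 * g22)) / (g11 * g11)) by (field; trivial).
    rewrite e1, e2, disc. field. trivial.
  - replace ((a - d) * (a - d) + 4 * (b * c)) with
      ((((a - d) * g22 + 2 * c * g12) * ((a - d) * g22 - 2 * c * g12) + 4 * c * g22 * (b * g22 + c * g11)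
        + 4 * (c * c) * (g12 * g12 - g11 * g22)) / (g22 * g22)) by (field; trivial).
    rewrite e1, e3, disc. field. trivial. }
destruct (mat2_eta P) as [p [u [r [t ->]]]]. destruct (mat2_eta P') as [p' [u' [r' [t' ->]]]].
destruct (mat2_eta (Mmult (Mmult (mat2 p u r t) M) (mat2 p' u' r' t'))) as [d1 [x1 [x2 [d2 ED]]]].
rewrite ED, diagonal2_mat2 in HD. destruct HD as [-> ->].
assert (EM2 : M = Mmult (Mmult (mat2 p' u' r' t') (mat2 d1 0 0 d2)) (mat2 p u r t)).
{ rewrite <- ED, <- !Mmult_assoc, HP', Mmult_one_r, !Mmult_assoc, HP', Mmult_one_l. reflexivity. }
rewrite EM, !Mmult_mat2 in EM2. apply mat2_inj in EM2. destruct EM2 as [Ea [Eb [Ec Ed]]].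
rewrite Mmult_mat2, Mone_mat2 in HP, HP'.
apply mat2_inj in HP. apply mat2_inj in HP'.
destruct HP as [h1 [h2 [h3 h4]]]. destruct HP' as [k1 [k2 [k3 k4]]].
assert (tr : a + d = d1 + d2).
{ rewrite Ea, Ed. transitivity (d1 * (p * p' + u * r') + d2 * (r * u' + t * t')); [ring|]. rewrite h1, h4. ring. }
assert (dt : d1 * d2 = 1).
{ rewrite <- det, Ea, Eb, Ec, Ed.
  transitivity (d1 * d2 * ((p * p' + u * r') * (r * u' + t * t') - (p * u' + u * t') * (r * p' + t * r'))).
  - rewrite h1, h2, h3, h4. ring.
  - ring. }
assert (dd : d1 = d2).
{ assert (sq : (d1 - d2) * (d1 - d2) = 0).
  { transitivity ((d1 + d2) * (d1 + d2) - 4 * (d1 * d2)); [ring|]. rewrite <- tr, dt, <- det.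
    transitivity ((a - d) * (a - d) + 4 * (b * c)); [ring|exact discM]. }
  apply Cminus_0. destruct (C_integral _ _ sq); trivial. }
subst d2. exists d1. split; [exact dt|]. rewrite EM. f_equal.
- rewrite Ea. transitivity (d1 * (p' * p + u' * r)); [ring|]. rewrite k1. ring.
- rewrite Eb. transitivity (d1 * (p' * u + u' * t)); [ring|]. rewrite k2. ring.
- rewrite Ec. transitivity (d1 * (r' * p + t' * r)); [ring|]. rewrite k3. ring.
- rewrite Ed. transitivity (d1 * (r' * u + t' * t)); [ring|]. rewrite k4. ring.
Qed.

(** * The differential equation and its conserved form *)

Lemma singular_half (tau z : C) : singular tau z <-> in_half tau z.
Proof.
split.
- intros [k [m [n [_ E]]]]. destruct (omega_point tau k) as [a [b Eo]].
  exists (a + (m + m))%Z, (b + (n + n))%Z. rewrite !lattice_point_add, E, Eo. field.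
- intros [m [n E]].
  assert (Em := Z.div_mod m 2 ltac:(lia)). assert (En := Z.div_mod n 2 ltac:(lia)).
  assert (Bm := Z.mod_pos_bound m 2 ltac:(lia)). assert (Bn := Z.mod_pos_bound n 2 ltac:(lia)).
  set (m' := (m / 2)%Z) in *. set (n' := (n / 2)%Z) in *.
  set (i := (m mod 2)%Z) in *. set (j := (n mod 2)%Z) in *.
  assert (K : exists k, (k <= 3)%nat /\ omega tau k = lattice_point tau i j).
  { assert (ci : i = 0%Z \/ i = 1%Z) by lia. assert (cj : j = 0%Z \/ j = 1%Z) by lia.
    destruct ci as [-> | ->], cj as [-> | ->];
    [exists 0%nat|exists 2%nat|exists 1%nat|exists 3%nat]; (split; [lia|]); unfold omega, lattice_point; ring. }
  destruct K as [k [k3 Ek]]. exists k, m', n'. split; trivial.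
  rewrite Ek, E, Em, En, lattice_point_add.
  replace (lattice_point tau (2 * m') (2 * n')) with (2 * lattice_point tau m' n')
    by (unfold lattice_point; rewrite !mult_IZR, !RtoC_mult; ring).
  field.
Qed.

Ltac cder := lazymatch goal with
| |- cderiv (fun w => @?f w + @?g w) _ _ => apply (cderiv_plus f g); cder
| |- cderiv (fun w => @?f w - @?g w) _ _ => apply (cderiv_minus f g); cder
| |- cderiv (fun w => @?f w * @?g w) _ _ => apply (cderiv_mult f g); cder
| |- cderiv (fun w => - @?f w) _ _ => apply (cderiv_opp f); cder
| |- cderiv (fun _ => ?c) _ _ => apply (cderiv_const c)
| |- cderiv (fun w => w) _ _ => apply cderiv_id
| |- _ => eassumption
end.
Ltac cderive := eapply cderiv_eq; [|cder]; cbv beta.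

(** Here f = A + 2 T, f' = B D and f'' = A (B^2 + D^2), since A' = B D, B' = D A, D' = A B. *)
Definition Phi (A B D q : C -> C) (T : C) (y y1 w w1 : C -> C) (z : C) : C :=
  (A z + 2 * T) * (y1 z * w1 z) - (1 / 2) * (B z * D z) * (y z * w1 z + y1 z * w z)
  + ((1 / 2) * (A z * (B z * B z + D z * D z)) - q z * (A z + 2 * T)) * (y z * w z).

(** The hypothesis relating q to A, B, D is f''' = 4 q f' + 2 q' f divided by f'. *)
Lemma Phi_deriv (A B D q : C -> C) (T : C) (y y1 w w1 : C -> C) (z : C) :
  cderiv A z (B z * D z) -> cderiv B z (D z * A z) -> cderiv D z (A z * B z) ->
  cderiv q z ((3 / 2 * A z - T) * (B z * D z)) ->
  4 * q z + 2 * (3 / 2 * A z - T) * (A z + 2 * T) = B z * B z + D z * D z + 4 * (A z * A z) ->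
  cderiv y z (y1 z) -> cderiv y1 z (q z * y z) ->
  cderiv w z (w1 z) -> cderiv w1 z (q z * w z) ->
  cderiv (Phi A B D q T y y1 w w1) z 0.
Proof.
intros HA HB HD Hq E Hy Hy1 Hw Hw1. unfold Phi. cderive.
apply Cminus_eq in E.
transitivity (- (1/2) * (B z * D z) * (y z * w z) *
  (4 * q z + 2 * (3 / 2 * A z - T) * (A z + 2 * T) - (B z * B z + D z * D z + 4 * (A z * A z)))).
- field.
- rewrite E. ring.
Qed.

Lemma wronskian_deriv (q y y1 w w1 : C -> C) (z : C) :
  cderiv y z (y1 z) -> cderiv y1 z (q z * y z) ->
  cderiv w z (w1 z) -> cderiv w1 z (q z * w z) ->
  cderiv (fun z => y z * w1 z - y1 z * w z) z 0.
Proof. intros Hy Hy1 Hw Hw1. cderive. ring. Qed.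

(** The coefficient X is a primitive of (2 T + A) (2 T - A); then V'' = q V as soon as
    f' Y = 2 f Y'.  [Vsol'] is the derivative of V, with Y'' = q Y substituted. *)
Definition Vsol (X Y Y1 : C -> C) (z : C) : C := 2 * Y1 z + X z * Y z.
Definition Vsol' (A q : C -> C) (T : C) (X Y Y1 : C -> C) (z : C) : C :=
  2 * (q z * Y z) + (4 * (T * T) - A z * A z) * Y z + X z * Y1 z.

(** As V is a solution, its Wronskian with any solution w is constant; this is the only
    property of V in use. *)
Lemma Vsol_wronskian (A B D q : C -> C) (T : C) (X Y Y1 w w1 : C -> C) (z : C) :
  cderiv A z (B z * D z) -> cderiv q z ((3 / 2 * A z - T) * (B z * D z)) ->
  cderiv X z (4 * (T * T) - A z * A z) ->
  cderiv Y z (Y1 z) -> cderiv Y1 z (q z * Y z) ->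
  cderiv w z (w1 z) -> cderiv w1 z (q z * w z) ->
  B z * D z * Y z = 2 * (A z + 2 * T) * Y1 z ->
  cderiv (fun z => Vsol X Y Y1 z * w1 z - Vsol' A q T X Y Y1 z * w z) z 0.
Proof.
intros HA Hq HX HY HY1 Hw Hw1 E. unfold Vsol, Vsol'. cderive.
apply Cminus_eq in E.
transitivity (- (A z - 2 * T) * (B z * D z * Y z - 2 * (A z + 2 * T) * Y1 z) * w z).
- field.
- rewrite E. ring.
Qed.

Lemma next_index_cycle (l : nat) : (1 <= l <= 3)%nat -> next_index (next_index (next_index l)) = l.
Proof. intros Hl. case_l l Hl; reflexivity. Qed.

Lemma half_open_locally (tau z : C) (P : C -> Prop) : (0 < Im tau)%R -> ~ in_half tau z ->
  (forall w, ~ in_half tau w -> P w) -> locally z P.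
Proof.
intros ht Hz HP. apply locally_Cmod. destruct (not_half_open tau z ht Hz) as [d [d0 Hd]].
exists d. split; trivial. intros w Hw. apply HP. now apply Hd.
Qed.

Lemma q_formula (tau T z : C) (l : nat) : (0 < Im tau)%R -> (1 <= l <= 3)%nat -> ~ in_half tau z ->
  q tau l T z = 3 / 4 * (Afun tau l z * Afun tau l z + cconst tau l) - T * Afun tau l z + T * T.
Proof.
intros ht Hl Hz. rewrite <- wp_sum_square by trivial. unfold q, Afun, wp_comb, zeta_comb, ones.
rewrite !sum4_eq. ring.
Qed.

Lemma F_formula (tau T z : C) (l : nat) : F tau l T z = Afun tau l z + 2 * T.
Proof. unfold F, Afun, zeta_comb. ring. Qed.

(** Cyclic permutation of the indices turns one identity A_l' = A_m A_n into three. *)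
Lemma A_relations (tau z : C) (l : nat) : (0 < Im tau)%R -> (1 <= l <= 3)%nat -> ~ in_half tau z ->
  let A := Afun tau l in let B := Afun tau (next_index l) in let D := Afun tau (next_index (next_index l)) in
  cderiv A z (B z * D z) /\ cderiv B z (D z * A z) /\ cderiv D z (A z * B z) /\
  B z * B z = A z * A z + (cconst tau l - cconst tau (next_index l)) /\
  D z * D z = A z * A z + (cconst tau l - cconst tau (next_index (next_index l))).
Proof.
intros ht Hl Hz A B D.
assert (r1 := next_index_range l). assert (r2 := next_index_range (next_index l)). assert (n3 := next_index_cycle l Hl).
assert (S0 := wp_sum_square tau z l ht Hl Hz). assert (S1 := wp_sum_square tau z _ ht r1 Hz).
assert (S2 := wp_sum_square tau z _ ht r2 Hz).
split; [|split; [|split; [|split]]].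
- unfold A, B, D. rewrite <- Afun_deriv_product by trivial. now apply Afun_deriv.
- unfold A, B, D. rewrite <- n3 at 3. rewrite <- Afun_deriv_product by trivial. now apply Afun_deriv.
- unfold A, B, D. rewrite <- n3 at 2. rewrite <- n3 at 3. rewrite <- Afun_deriv_product by trivial. now apply Afun_deriv.
- unfold A, B. transitivity (wp_comb tau ones z - cconst tau (next_index l)); [rewrite S1|rewrite S0]; ring.
- unfold A, D. transitivity (wp_comb tau ones z - cconst tau (next_index (next_index l))); [rewrite S2|rewrite S0]; ring.
Qed.

Lemma q_deriv (tau T z : C) (l : nat) : (0 < Im tau)%R -> (1 <= l <= 3)%nat -> ~ in_half tau z ->
  let A := Afun tau l in let B := Afun tau (next_index l) in let D := Afun tau (next_index (next_index l)) in
  cderiv (q tau l T) z ((3 / 2 * A z - T) * (B z * D z)).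
Proof.
intros ht Hl Hz A B D. destruct (A_relations tau z l ht Hl Hz) as [HA _]. fold A B D in HA.
apply (cderiv_ext_loc (fun w => 3 / 4 * (A w * A w + cconst tau l) - T * A w + T * T)).
- apply (half_open_locally tau); trivial. intros w Hw. symmetry. now apply q_formula.
- cderive. field.
Qed.

(** The constants left after substitution are c_l + c_m + c_n. *)
Lemma q_relation (tau T z : C) (l : nat) : (0 < Im tau)%R -> (1 <= l <= 3)%nat -> ~ in_half tau z ->
  let A := Afun tau l in let B := Afun tau (next_index l) in let D := Afun tau (next_index (next_index l)) in
  4 * q tau l T z + 2 * (3 / 2 * A z - T) * (A z + 2 * T) = B z * B z + D z * D z + 4 * (A z * A z).
Proof.
intros ht Hl Hz A B D. destruct (A_relations tau z l ht Hl Hz) as [_ [_ [_ [EB ED]]]].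
fold A B D in EB, ED. rewrite EB, ED, q_formula by trivial. fold A.
apply Cminus_0.
transitivity (cconst tau l + cconst tau (next_index l) + cconst tau (next_index (next_index l))); [field|now apply cconst_sum_next].
Qed.

Lemma Q_formula (tau T z : C) (l : nat) : (0 < Im tau)%R -> (1 <= l <= 3)%nat -> ~ in_half tau z ->
  let A := Afun tau l in let B := Afun tau (next_index l) in let D := Afun tau (next_index (next_index l)) in
  Q tau l T z = B z * D z * (B z * D z) - 2 * (A z * (B z * B z + D z * D z) * (A z + 2 * T))
    + 4 * (q tau l T z * ((A z + 2 * T) * (A z + 2 * T))).
Proof.
intros ht Hl Hz A B D.
assert (D1 : forall w, ~ in_half tau w -> C_derive (F tau l T) w = B w * D w).
{ intros w Hw. apply is_C_derive_unique. destruct (A_relations tau w l ht Hl Hw) as [HA _].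
  fold A B D in HA. apply (cderiv_ext (fun u => A u + 2 * T)).
  - intros u. now rewrite F_formula.
  - cderive. ring. }
assert (D2 : C_derive (C_derive (F tau l T)) z = A z * (B z * B z + D z * D z)).
{ apply is_C_derive_unique. destruct (A_relations tau z l ht Hl Hz) as [HA [HB [HD _]]].
  fold A B D in HA, HB, HD. apply (cderiv_ext_loc (fun u => B u * D u)).
  - apply (half_open_locally tau); trivial. intros w Hw. symmetry. now apply D1.
  - cderive. ring. }
unfold Q. rewrite D2, D1, F_formula by trivial. fold A. ring.
Qed.

(** The powers of A cancel, as they must since Q does not depend on z; equivalently, Q is
    the value of the quartic (A')^2 at A = - 2 T. *)
Lemma Q_polynomial (tau T z : C) (l : nat) : (0 < Im tau)%R -> (1 <= l <= 3)%nat -> ~ in_half tau z ->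
  Q tau l T z = (4 * (T * T) + (cconst tau l - cconst tau (next_index l))) *
                (4 * (T * T) + (cconst tau l - cconst tau (next_index (next_index l)))).
Proof.
intros ht Hl Hz. rewrite Q_formula by trivial.
destruct (A_relations tau z l ht Hl Hz) as [_ [_ [_ [EB ED]]]].
assert (S := cconst_sum_next tau l ht Hl).
set (A := Afun tau l z) in *. set (B := Afun tau (next_index l) z) in *. set (D := Afun tau (next_index (next_index l)) z) in *.
replace (B * D * (B * D)) with ((B * B) * (D * D)) by ring. rewrite EB, ED, q_formula by trivial. fold A.
assert (E : cconst tau l = - cconst tau (next_index l) - cconst tau (next_index (next_index l))).
{ apply Cminus_0. rewrite <- S. ring. }
rewrite E. field.
Qed.

Lemma Afun_period (tau z : C) (l : nat) : (0 < Im tau)%R -> (1 <= l <= 3)%nat -> ~ in_half tau z ->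
  Afun tau l (z + 1) = Afun tau l z /\ Afun tau l (z + tau) = Afun tau l z.
Proof.
intros ht Hl Hz.
assert (N1 := not_half_add1 _ _ Hz). assert (N2 := not_half_add2 _ _ Hz).
split.
- replace (z + 1) with (z + 1 / 2 + 1 / 2) by field.
  destruct (Afun_half tau _ l ht Hl N1) as [-> _]. destruct (Afun_half tau _ l ht Hl Hz) as [-> _].
  rewrite Cmult_assoc, eps_sq. ring.
- replace (z + tau) with (z + tau / 2 + tau / 2) by field.
  destruct (Afun_half tau _ l ht Hl N2) as [_ ->]. destruct (Afun_half tau _ l ht Hl Hz) as [_ ->].
  rewrite Cmult_assoc, eps_sq. ring.
Qed.

Lemma zeta_sum_period (tau z : C) : (0 < Im tau)%R -> ~ in_half tau z ->
  zeta_comb tau ones (z + 1) = zeta_comb tau ones z + 4 * eta tau 1 /\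
  zeta_comb tau ones (z + tau) = zeta_comb tau ones z + 4 * eta tau 2.
Proof.
intros ht Hz. unfold zeta_comb, ones. rewrite !sum4_eq.
assert (K1 : forall k, wzeta tau (z + 1 - omega tau k / 2) = wzeta tau (z - omega tau k / 2) + eta tau 1).
{ intros k. rewrite <- wzeta_period1 by (trivial; now apply half_shift). f_equal. ring. }
assert (K2 : forall k, wzeta tau (z + tau - omega tau k / 2) = wzeta tau (z - omega tau k / 2) + eta tau 2).
{ intros k. rewrite <- wzeta_period2 by (trivial; now apply half_shift). f_equal. ring. }
rewrite !K1, !K2. split; ring.
Qed.

Definition is_sol (qf y y1 : C -> C) (z : C) : Prop :=
  cderiv y z (y1 z) /\ cderiv y1 z (qf z * y z).

Lemma solution_near_derive (tau T p : C) (l : nat) (y : C -> C) :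
  solution_near tau l T y p -> is_sol (q tau l T) y (C_derive y) p.
Proof.
intros [y' H]. assert (Hp := locally_singleton _ _ H).
assert (E : locally p (fun w => y' w = C_derive y w)).
{ generalize H. apply filter_imp. intros w [Hw _]. symmetry. now apply is_C_derive_unique. }
destruct Hp as [H1 H2]. split.
- rewrite <- (locally_singleton _ _ E). exact H1.
- apply (cderiv_ext_loc y' (C_derive y)); trivial.
Qed.

Lemma is_sol_comb (qf y1 y1' y2 y2' : C -> C) (a b z : C) :
  is_sol qf y1 y1' z -> is_sol qf y2 y2' z ->
  is_sol qf (fun w => a * y1 w + b * y2 w) (fun w => a * y1' w + b * y2' w) z.
Proof. intros [H1 H2] [H3 H4]. split; cderive; ring. Qed.

Lemma solution_unique (qf y y1 : C -> C) (p : C) :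
  ccont qf p -> locally p (is_sol qf y y1) -> y p = 0 -> y1 p = 0 ->
  locally p (fun z => y z = 0).
Proof.
intros Cq Hl z0 z1. destruct (ccont_bounded _ _ Cq) as [d [d0 Hd]].
apply locally_Cmod in Hl. destruct Hl as [d' [d0' Hs]].
apply locally_Cmod. exists (Rmin d d'). split; [now apply Rmin_pos|]. intros z Hz.
pose (K := (Cmod (qf p) + 1)%R). assert (K1 : (1 <= K)%R) by (unfold K; pose proof (Cmod_ge_0 (qf p)); lra).
assert (near : forall t : R, (0 <= t <= 1)%R -> (Cmod (p + t * (z - p) - p) <= Cmod (z - p))%R).
{ intros t Ht. replace (p + t * (z - p) - p) with (RtoC t * (z - p)) by ring.
  rewrite Cmod_mult, Cmod_R, Rabs_right by lra. pose proof (Cmod_ge_0 (z - p)).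
  rewrite <- (Rmult_1_l (Cmod (z - p))) at 2. apply Rmult_le_compat_r; lra. }
replace z with (p + (z - p)) by ring.
apply (segment_gronwall y y1 (fun t => y1 (p + t * (z - p))%C) (fun t => qf (p + t * (z - p))%C * y (p + t * (z - p))%C) p (z - p) K); trivial.
- intros t Ht. apply Hs. eapply Rle_lt_trans; [now apply near|]. eapply Rlt_le_trans; [exact Hz|apply Rmin_r].
- intros t Ht. apply Hs. eapply Rle_lt_trans; [now apply near|]. eapply Rlt_le_trans; [exact Hz|apply Rmin_r].
- intros t Ht. assert (a := Cmod_ge_0 (y (p + t * (z - p))%C)). assert (b := Cmod_ge_0 (y1 (p + t * (z - p))%C)). nra.
- intros t Ht. rewrite Cmod_mult.
  assert (B : (Cmod (qf (p + t * (z - p))%C) <= K)%R).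
  { apply Hd. eapply Rle_lt_trans; [now apply near|]. eapply Rlt_le_trans; [exact Hz|apply Rmin_l]. }
  assert (a := Cmod_ge_0 (y (p + t * (z - p))%C)). assert (b := Cmod_ge_0 (y1 (p + t * (z - p))%C)).
  assert (Cmod (qf (p + t * (z - p))%C) * Cmod (y (p + t * (z - p))%C) <= K * Cmod (y (p + t * (z - p))%C))%R by (apply Rmult_le_compat_r; lra).
  nra.
Qed.

Lemma solution_near_locally (tau T p : C) (l : nat) (y : C -> C) :
  solution_near tau l T y p -> locally p (is_sol (q tau l T) y (C_derive y)).
Proof.
intros [y' H]. apply locally_Cmod in H. destruct H as [d [d0 Hd]].
apply locally_Cmod. exists d. split; trivial. intros w Hw.
apply solution_near_derive. exists y'. apply locally_Cmod.
exists (d - Cmod (w - p))%R. split; [lra|]. intros u Hu. apply Hd.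
replace (u - p) with ((u - w) + (w - p)) by ring.
eapply Rle_lt_trans; [apply Cmod_triangle|]. lra.
Qed.

Definition wronskian (y1 y2 : C -> C) (z : C) : C := y1 z * C_derive y2 z - C_derive y1 z * y2 z.

(** If W vanished at z0, a nonzero combination of y1 and y2 would have zero Cauchy data.  It is
    found among the rows (y2, - y1), (y2', - y1') and (1, 0), according to which is nonzero. *)
Lemma wronskian_nonzero (tau T z0 : C) (l : nat) (y1 y2 : C -> C) :
  (0 < Im tau)%R -> (1 <= l <= 3)%nat -> ~ in_half tau z0 ->
  solution_near tau l T y1 z0 -> solution_near tau l T y2 z0 ->
  lin_indep_near z0 y1 y2 ->
  wronskian y1 y2 z0 <> 0.
Proof.
intros ht Hl Hz H1 H2 Hind W0. unfold wronskian in W0.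
assert (K : forall a b, a * y1 z0 + b * y2 z0 = 0 -> a * C_derive y1 z0 + b * C_derive y2 z0 = 0 -> a = 0 /\ b = 0).
{ intros a b E1 E2. apply Hind.
  apply (solution_unique (q tau l T) (fun z => a * y1 z + b * y2 z) (fun z => a * C_derive y1 z + b * C_derive y2 z)); trivial.
  - eapply cderiv_ccont. now apply q_deriv.
  - generalize (filter_and _ _ (solution_near_locally _ _ _ _ _ H1) (solution_near_locally _ _ _ _ _ H2)).
    apply filter_imp. intros w [S1 S2]. now apply is_sol_comb. }
destruct (K (y2 z0) (- y1 z0)) as [e1 e2].
{ ring. }
{ transitivity (- (y1 z0 * C_derive y2 z0 - C_derive y1 z0 * y2 z0)); [ring|]. rewrite W0. ring. }
destruct (K (C_derive y2 z0) (- C_derive y1 z0)) as [e3 e4].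
{ rewrite <- W0. ring. }
{ ring. }
assert (y1z : y1 z0 = 0) by (replace (y1 z0) with (- - y1 z0) by ring; rewrite e2; ring).
assert (y1z' : C_derive y1 z0 = 0) by (replace (C_derive y1 z0) with (- - C_derive y1 z0) by ring; rewrite e4; ring).
destruct (K 1 0) as [e _].
{ rewrite y1z. ring. }
{ rewrite y1z'. ring. }
injection e. lra.
Qed.

(** * Monodromy and the proof of the theorem *)

Lemma Afun_period_either (tau w z : C) (l : nat) : (0 < Im tau)%R -> (1 <= l <= 3)%nat ->
  (w = 1 \/ w = tau) -> ~ in_half tau z -> Afun tau l (z + w) = Afun tau l z.
Proof.
intros ht Hl [-> | ->] Hz; destruct (Afun_period tau z l ht Hl Hz); trivial.
Qed.

Lemma in_half_period (tau w z : C) : (w = 1 \/ w = tau) -> ~ in_half tau z -> ~ in_half tau (z + w).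
Proof.
intros Hw Hz.
assert (E : exists m n, w = lattice_point tau (m + m) (n + n) / 2).
{ destruct Hw as [-> | ->]; [exists 1%Z, 0%Z|exists 0%Z, 1%Z]; rewrite lattice_point_add; unfold lattice_point; field. }
destruct E as [m [n ->]]. now apply not_half_add.
Qed.

Definition continued (y1 y2 : C -> C) (z0 w a b c d : C) : Prop :=
  y1 (z0 + w) = a * y1 z0 + b * y2 z0 /\
  y2 (z0 + w) = c * y1 z0 + d * y2 z0 /\
  C_derive y1 (z0 + w) = a * C_derive y1 z0 + b * C_derive y2 z0 /\
  C_derive y2 (z0 + w) = c * C_derive y1 z0 + d * C_derive y2 z0.

(** Differentiating the monodromy relation, which holds on a neighbourhood of z0. *)
Lemma near_line_continued (tau T z0 w : C) (l : nat) (y1 y2 : C -> C) (a b c d : C) :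
  (forall t : R, solution_near tau l T y1 (z0 + t * w) /\ solution_near tau l T y2 (z0 + t * w)) ->
  near_line z0 w (fun z => col2 (y1 (z + w)) (y2 (z + w)) = Mmult (mat2 a b c d) (col2 (y1 z) (y2 z))) ->
  continued y1 y2 z0 w a b c d.
Proof.
intros Hs Hn. specialize (Hn 0%R). replace (z0 + 0%R * w) with z0 in Hn by ring.
assert (E1 : locally z0 (fun z => a * y1 z + b * y2 z = y1 (z + w))).
{ generalize Hn. apply filter_imp. intros z Hz. rewrite Mmult_col2 in Hz. apply col2_inj in Hz. now destruct Hz. }
assert (E2 : locally z0 (fun z => c * y1 z + d * y2 z = y2 (z + w))).
{ generalize Hn. apply filter_imp. intros z Hz. rewrite Mmult_col2 in Hz. apply col2_inj in Hz. now destruct Hz. }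
destruct (Hs 0%R) as [S1 S2]. replace (z0 + 0%R * w) with z0 in S1, S2 by ring.
destruct (Hs 1%R) as [U1 U2]. replace (z0 + 1%R * w) with (z0 + w) in U1, U2 by ring.
apply solution_near_derive in S1, S2, U1, U2.
destruct S1 as [S1 _], S2 as [S2 _], U1 as [U1 _], U2 as [U2 _].
split; [|split; [|split]].
- now rewrite <- (locally_singleton _ _ E1).
- now rewrite <- (locally_singleton _ _ E2).
- apply (cderiv_unique (fun z => y1 (z + w)) z0); [now apply cderiv_shift|].
  apply cderiv_ext_loc with (1 := E1). cderive. ring.
- apply (cderiv_unique (fun z => y2 (z + w)) z0); [now apply cderiv_shift|].
  apply cderiv_ext_loc with (1 := E2). cderive. ring.
Qed.

Definition gram (tau : C) (l : nat) (T : C) (u v : C -> C) (z : C) : C :=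
  Phi (Afun tau l) (Afun tau (next_index l)) (Afun tau (next_index (next_index l))) (q tau l T) T
    u (C_derive u) v (C_derive v) z.

Lemma q_period (tau T w z : C) (l : nat) : (0 < Im tau)%R -> (1 <= l <= 3)%nat ->
  (w = 1 \/ w = tau) -> ~ in_half tau z -> q tau l T (z + w) = q tau l T z.
Proof.
intros ht Hl Hw Hz. rewrite !q_formula by (trivial; now apply in_half_period).
now rewrite Afun_period_either.
Qed.

Lemma gram_deriv (tau T z : C) (l : nat) (u v : C -> C) : (0 < Im tau)%R -> (1 <= l <= 3)%nat ->
  ~ in_half tau z -> solution_near tau l T u z -> solution_near tau l T v z ->
  cderiv (gram tau l T u v) z 0.
Proof.
intros ht Hl Hz Hu Hv. destruct (A_relations tau z l ht Hl Hz) as [HA [HB [HD _]]].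
destruct (solution_near_derive _ _ _ _ _ Hu). destruct (solution_near_derive _ _ _ _ _ Hv).
apply Phi_deriv; trivial; [now apply q_deriv|now apply q_relation].
Qed.

Lemma conserved_on_line (phi : C -> C) (z0 w : C) :
  (forall t : R, cderiv phi (z0 + t * w) 0) -> forall t : R, phi (z0 + t * w) = phi z0.
Proof.
intros H t. apply cderiv_zero_line. intros s _.
replace (z0 + s * (t * w)) with (z0 + (s * t)%R * w) by (rewrite RtoC_mult; ring). apply H.
Qed.

Lemma invariants_on_line (tau T z0 w : C) (l : nat) (y1 y2 : C -> C) :
  (0 < Im tau)%R -> (1 <= l <= 3)%nat ->
  (forall t : R, ~ in_half tau (z0 + t * w)) ->
  (forall t : R, solution_near tau l T y1 (z0 + t * w) /\ solution_near tau l T y2 (z0 + t * w)) ->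
  (forall t : R, gram tau l T y1 y1 (z0 + t * w) = gram tau l T y1 y1 z0) /\
  (forall t : R, gram tau l T y1 y2 (z0 + t * w) = gram tau l T y1 y2 z0) /\
  (forall t : R, gram tau l T y2 y2 (z0 + t * w) = gram tau l T y2 y2 z0) /\
  (forall t : R, wronskian y1 y2 (z0 + t * w) = wronskian y1 y2 z0).
Proof.
intros ht Hl Hreg Hs. split; [|split; [|split]].
- apply (conserved_on_line (gram tau l T y1 y1)). intros t. destruct (Hs t). now apply gram_deriv.
- apply (conserved_on_line (gram tau l T y1 y2)). intros t. destruct (Hs t). now apply gram_deriv.
- apply (conserved_on_line (gram tau l T y2 y2)). intros t. destruct (Hs t). now apply gram_deriv.
- apply (conserved_on_line (wronskian y1 y2)). intros t. destruct (Hs t) as [U1 U2].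
  apply solution_near_derive in U1, U2. destruct U1, U2.
  now apply wronskian_deriv with (q tau l T).
Qed.

(** The form and the Wronskian are constant along the segment from z0 to z0 + w, and their
    coefficients f, f', f'', q take the same values at both ends. *)
Lemma monodromy_preserves (tau T z0 w : C) (l : nat) (y1 y2 : C -> C) (a b c d : C) :
  (0 < Im tau)%R -> (1 <= l <= 3)%nat -> (w = 1 \/ w = tau) ->
  (forall t : R, ~ in_half tau (z0 + t * w)) ->
  (forall t : R, solution_near tau l T y1 (z0 + t * w) /\ solution_near tau l T y2 (z0 + t * w)) ->
  wronskian y1 y2 z0 <> 0 ->
  continued y1 y2 z0 w a b c d ->
  preserves (gram tau l T y1 y1 z0) (gram tau l T y1 y2 z0) (gram tau l T y2 y2 z0) (mat2 a b c d).
Proof.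
intros ht Hl Hw Hreg Hs W0 [E1 [E2 [E3 E4]]].
assert (N0 := Hreg 0%R). replace (z0 + 0%R * w) with z0 in N0 by ring.
assert (r1 := next_index_range l). assert (r2 := next_index_range (next_index l)).
destruct (invariants_on_line tau T z0 w l y1 y2 ht Hl Hreg Hs) as [G11 [G12 [G22 Wc]]].
specialize (G11 1%R). specialize (G12 1%R). specialize (G22 1%R). specialize (Wc 1%R).
replace (z0 + 1%R * w) with (z0 + w) in G11, G12, G22, Wc by ring.
assert (Hdet : a * d - b * c = 1).
{ apply Cminus_0.
  assert (P : (a * d - b * c - 1) * wronskian y1 y2 z0 = 0).
  { transitivity (wronskian y1 y2 (z0 + w) - wronskian y1 y2 z0); [|rewrite Wc; ring].
    unfold wronskian. rewrite E1, E2, E3, E4. ring. }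
  destruct (C_integral _ _ P) as [P'|P']; [trivial|contradiction]. }
exists a, b, c, d. split; [reflexivity|]. split; [exact Hdet|].
unfold gram, Phi in *.
rewrite E1, E3, !Afun_period_either, q_period in G11 by trivial.
rewrite E1, E2, E3, E4, !Afun_period_either, q_period in G12 by trivial.
rewrite E2, E4, !Afun_period_either, q_period in G22 by trivial.
split; [|split].
- etransitivity; [|exact G11]. field.
- etransitivity; [|exact G12]. field.
- etransitivity; [|exact G22]. field.
Qed.

Lemma gram_det (tau T z0 : C) (l : nat) (y1 y2 : C -> C) :
  (0 < Im tau)%R -> (1 <= l <= 3)%nat -> ~ in_half tau z0 ->
  gram tau l T y1 y2 z0 * gram tau l T y1 y2 z0 - gram tau l T y1 y1 z0 * gram tau l T y2 y2 z0
  = wronskian y1 y2 z0 * wronskian y1 y2 z0 * Q tau l T z0 / 4.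
Proof.
intros ht Hl Hz. rewrite Q_formula by trivial. unfold wronskian, gram, Phi. field.
Qed.

(** Since A_l^2 = P - c_l and zeta' = - wp, this is a primitive of 4 T^2 - A_l^2. *)
Definition Xfun (tau : C) (l : nat) (T z : C) : C :=
  zeta_comb tau ones z + (cconst tau l + 4 * (T * T)) * z.

Lemma Xfun_deriv (tau T z : C) (l : nat) : (0 < Im tau)%R -> (1 <= l <= 3)%nat -> ~ in_half tau z ->
  cderiv (Xfun tau l T) z (4 * (T * T) - Afun tau l z * Afun tau l z).
Proof.
intros ht Hl Hz. assert (H := zeta_comb_deriv tau ones z ht Hz).
rewrite (wp_sum_square tau z l ht Hl Hz) in H. unfold Xfun. cderive. ring.
Qed.

Lemma Xfun_not_periodic (tau T z : C) (l : nat) : (0 < Im tau)%R -> ~ in_half tau z ->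
  Xfun tau l T (z + 1) = Xfun tau l T z -> Xfun tau l T (z + tau) = Xfun tau l T z -> False.
Proof.
intros ht Hz H1 H2. unfold Xfun in H1, H2.
destruct (zeta_sum_period tau z ht Hz) as [K1 K2]. rewrite K1 in H1. rewrite K2 in H2.
apply Cminus_eq in H1, H2.
apply (quasi_periods_independent tau (cconst tau l + 4 * (T * T)) ht).
- rewrite <- H1. ring.
- rewrite <- H2. ring.
Qed.

(** For Y = al y1 + be y2 in the kernel of the form one has f' Y = 2 f Y' all along the line.
    The Wronskians of V with y1 and y2 return to their values at z0 + w, which leaves
    (X (z0 + w) - X (z0)) times the Wronskians of Y with y1 and y2, not both zero. *)
Lemma degenerate_X_periodic (tau T z0 w : C) (l : nat) (y1 y2 : C -> C) (sg al be : C) :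
  (0 < Im tau)%R -> (1 <= l <= 3)%nat -> (w = 1 \/ w = tau) ->
  (forall t : R, ~ in_half tau (z0 + t * w)) ->
  (forall t : R, solution_near tau l T y1 (z0 + t * w) /\ solution_near tau l T y2 (z0 + t * w)) ->
  wronskian y1 y2 z0 <> 0 ->
  sg * sg = 1 -> continued y1 y2 z0 w sg 0 0 sg ->
  (al <> 0 \/ be <> 0) ->
  al * gram tau l T y1 y1 z0 + be * gram tau l T y1 y2 z0 = 0 ->
  al * gram tau l T y1 y2 z0 + be * gram tau l T y2 y2 z0 = 0 ->
  Xfun tau l T (z0 + w) = Xfun tau l T z0.
Proof.
intros ht Hl Hw Hreg Hs W0 ss [E1 [E2 [E3 E4]]] nz K1 K2.
assert (N0 := Hreg 0%R). replace (z0 + 0%R * w) with z0 in N0 by ring.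
pose (Y := fun z => al * y1 z + be * y2 z).
pose (Y1 := fun z => al * C_derive y1 z + be * C_derive y2 z).
set (A := Afun tau l). set (B := Afun tau (next_index l)). set (D := Afun tau (next_index (next_index l))).
set (X := Xfun tau l T).
destruct (invariants_on_line tau T z0 w l y1 y2 ht Hl Hreg Hs) as [G11 [G12 [G22 Wc]]].
assert (log : forall t : R, B (z0 + t * w) * D (z0 + t * w) * Y (z0 + t * w) = 2 * (A (z0 + t * w) + 2 * T) * Y1 (z0 + t * w)).
{ intros t. specialize (G11 t). specialize (G12 t). specialize (G22 t). specialize (Wc t).
  rewrite <- G11, <- G12 in K1. rewrite <- G12, <- G22 in K2.
  rewrite <- Wc in W0. unfold gram, Phi in K1, K2. fold A B D in K1, K2. unfold wronskian in W0.
  set (p := z0 + t * w) in *. apply Cminus_0.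
  assert (P : (B p * D p * Y p - 2 * (A p + 2 * T) * Y1 p) * (y1 p * C_derive y2 p - C_derive y1 p * y2 p) = 0).
  { match type of K1 with ?e1 = _ => match type of K2 with ?e2 = _ =>
      transitivity (2 * (y2 p * e1 - y1 p * e2)); [unfold Y, Y1; field|rewrite K1, K2; ring] end end. }
  destruct (C_integral _ _ P); [trivial|contradiction]. }
assert (V : forall v, (forall t : R, solution_near tau l T v (z0 + t * w)) ->
  Vsol X Y Y1 (z0 + w) * C_derive v (z0 + w) - Vsol' A (q tau l T) T X Y Y1 (z0 + w) * v (z0 + w) =
  Vsol X Y Y1 z0 * C_derive v z0 - Vsol' A (q tau l T) T X Y Y1 z0 * v z0).
{ intros v Hv.
  apply (cderiv_zero_line (fun z => Vsol X Y Y1 z * C_derive v z - Vsol' A (q tau l T) T X Y Y1 z * v z)).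
  intros t _. destruct (A_relations tau _ l ht Hl (Hreg t)) as [HA _].
  destruct (Hs t) as [U1 U2]. apply solution_near_derive in U1, U2.
  assert (UY := is_sol_comb _ _ _ _ _ al be _ U1 U2). destruct UY as [UY UY1].
  destruct (solution_near_derive _ _ _ _ _ (Hv t)) as [V1 V2].
  apply Vsol_wronskian with B D; trivial.
  - now apply q_deriv.
  - now apply Xfun_deriv. }
assert (V1 := V y1 (fun t => proj1 (Hs t))). assert (V2 := V y2 (fun t => proj2 (Hs t))).
unfold Vsol, Vsol' in V1, V2.
(* all terms of V are multiplied by sg, except for the increment of X *)
assert (EY : Y (z0 + w) = sg * Y z0) by (unfold Y; rewrite E1, E2; ring).
assert (EY1 : Y1 (z0 + w) = sg * Y1 z0) by (unfold Y1; rewrite E3, E4; ring).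
unfold A in V1, V2.
rewrite EY, EY1, E1, E3, Afun_period_either, q_period in V1 by trivial.
rewrite EY, EY1, E2, E4, Afun_period_either, q_period in V2 by trivial.
apply Cminus_0.
assert (P1 : sg * sg * (X (z0 + w) - X z0) * be * wronskian y1 y2 z0 = 0).
{ apply Cminus_eq in V1. apply Cminus_eq in ss.
  match type of V1 with ?e1 = _ => match type of ss with ?e2 = _ =>
  transitivity (- e1 + e2 * ((2 * Y1 z0 + X z0 * Y z0) * C_derive y1 z0 -
     (2 * (q tau l T z0 * Y z0) + (4 * (T * T) - Afun tau l z0 * Afun tau l z0) * Y z0 + X z0 * Y1 z0) * y1 z0));
  [unfold wronskian, Y, Y1; ring|rewrite V1, ss; ring] end end. }
assert (P2 : sg * sg * (X (z0 + w) - X z0) * al * wronskian y1 y2 z0 = 0).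
{ apply Cminus_eq in V2. apply Cminus_eq in ss.
  match type of V2 with ?e1 = _ => match type of ss with ?e2 = _ =>
  transitivity (e1 - e2 * ((2 * Y1 z0 + X z0 * Y z0) * C_derive y2 z0 -
     (2 * (q tau l T z0 * Y z0) + (4 * (T * T) - Afun tau l z0 * Afun tau l z0) * Y z0 + X z0 * Y1 z0) * y2 z0));
  [unfold wronskian, Y, Y1; ring|rewrite V2, ss; ring] end end. }
rewrite ss, Cmult_1_l in P1, P2.
destruct (C_integral _ _ P1) as [P1'|]; [|contradiction].
destruct (C_integral _ _ P2) as [P2'|]; [|contradiction].
destruct (C_integral _ _ P1') as [|be0]; [trivial|].
destruct (C_integral _ _ P2') as [|al0]; [trivial|].
destruct nz; contradiction.
Qed.

(** Contracting the form with the solutions recovers f W^2; so f = A_l + 2 T vanishes along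
    the line and X' = (2 T + A_l) (2 T - A_l) with it. *)
Lemma zero_form_X_periodic (tau T z0 w : C) (l : nat) (y1 y2 : C -> C) :
  (0 < Im tau)%R -> (1 <= l <= 3)%nat ->
  (forall t : R, ~ in_half tau (z0 + t * w)) ->
  (forall t : R, solution_near tau l T y1 (z0 + t * w) /\ solution_near tau l T y2 (z0 + t * w)) ->
  wronskian y1 y2 z0 <> 0 ->
  gram tau l T y1 y1 z0 = 0 -> gram tau l T y1 y2 z0 = 0 -> gram tau l T y2 y2 z0 = 0 ->
  Xfun tau l T (z0 + w) = Xfun tau l T z0.
Proof.
intros ht Hl Hreg Hs W0 K11 K12 K22.
destruct (invariants_on_line tau T z0 w l y1 y2 ht Hl Hreg Hs) as [G11 [G12 [G22 Wc]]].
apply cderiv_zero_line. intros t _.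
apply (cderiv_eq _ _ (4 * (T * T) - Afun tau l (z0 + t * w) * Afun tau l (z0 + t * w))); [|now apply Xfun_deriv].
specialize (G11 t). specialize (G12 t). specialize (G22 t). specialize (Wc t).
rewrite K11 in G11. rewrite K12 in G12. rewrite K22 in G22. rewrite <- Wc in W0.
set (p := z0 + t * w) in *.
assert (P : (Afun tau l p + 2 * T) * wronskian y1 y2 p * wronskian y1 y2 p = 0).
{ transitivity (gram tau l T y1 y1 p * (y2 p * y2 p) - 2 * gram tau l T y1 y2 p * (y1 p * y2 p)
    + gram tau l T y2 y2 p * (y1 p * y1 p)).
  - unfold wronskian, gram, Phi. field.
  - rewrite G11, G12, G22. ring. }
destruct (C_integral _ _ P) as [P'|]; [|contradiction].
destruct (C_integral _ _ P') as [P''|]; [|contradiction].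
transitivity ((2 * T - Afun tau l p) * (Afun tau l p + 2 * T)); [ring|]. rewrite P''. ring.
Qed.

Lemma diagonalizable_X_periodic (tau T z0 w : C) (l : nat) (y1 y2 : C -> C) (a b c d : C)
    (P P' : @matrix C 2 2) :
  (0 < Im tau)%R -> (1 <= l <= 3)%nat -> (w = 1 \/ w = tau) ->
  (forall t : R, ~ in_half tau (z0 + t * w)) ->
  (forall t : R, solution_near tau l T y1 (z0 + t * w) /\ solution_near tau l T y2 (z0 + t * w)) ->
  wronskian y1 y2 z0 <> 0 ->
  continued y1 y2 z0 w a b c d ->
  gram tau l T y1 y2 z0 * gram tau l T y1 y2 z0 - gram tau l T y1 y1 z0 * gram tau l T y2 y2 z0 = 0 ->
  Mmult P P' = Mone -> Mmult P' P = Mone -> diagonal2 (Mmult (Mmult P (mat2 a b c d)) P') ->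
  Xfun tau l T (z0 + w) = Xfun tau l T z0.
Proof.
intros ht Hl Hw Hreg Hs W0 HC disc I1 I2 HD.
assert (HP := monodromy_preserves tau T z0 w l y1 y2 a b c d ht Hl Hw Hreg Hs W0 HC).
set (g11 := gram tau l T y1 y1 z0) in *. set (g12 := gram tau l T y1 y2 z0) in *.
set (g22 := gram tau l T y2 y2 z0) in *.
destruct (classic (g11 <> 0 \/ g22 <> 0)) as [nz|z].
- destruct (degenerate_scalar _ _ _ _ _ _ disc nz HP I1 I2 HD) as [sg [ss E]].
  apply mat2_inj in E. destruct E as [-> [-> [-> ->]]].
  (* a kernel vector of the singular Gram matrix *)
  assert (ker : exists al be : C, (al <> 0 \/ be <> 0) /\ al * g11 + be * g12 = 0 /\ al * g12 + be * g22 = 0).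
  { destruct nz as [n|n]; [exists g12, (- g11)|exists g22, (- g12)].
    - split; [right; intros e; apply n; replace g11 with (- - g11) by ring; rewrite e; ring|].
      split; [ring|]. rewrite <- disc. ring.
    - split; [now left|]. split; [|ring].
      transitivity (- (g12 * g12 - g11 * g22)); [ring|]. rewrite disc. ring. }
  destruct ker as [al [be [nzk [k1 k2]]]].
  now apply (degenerate_X_periodic tau T z0 w l y1 y2 sg al be).
- assert (z11 : g11 = 0) by (apply NNPP; intros n; apply z; now left).
  assert (z22 : g22 = 0) by (apply NNPP; intros n; apply z; now right).
  assert (z12 : g12 = 0).
  { rewrite z11, z22 in disc. assert (sq : g12 * g12 = 0) by (rewrite <- disc; ring).
    destruct (C_integral _ _ sq); trivial. }
  now apply (zero_form_X_periodic tau T z0 w l y1 y2).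
Qed.

Theorem theorem1p2 :
  forall (tau : C), (0 < Im tau)%R ->
  forall (l : nat), (1 <= l <= 3)%nat ->
  forall (T : C)
    (z0 : C) (y1 y2 : C -> C) (M1 M2 : @matrix C 2 2),
  is_monodromy tau l T z0 y1 y2 M1 M2 ->
  forall z : C, ~ singular tau z ->
  (simultaneously_diagonalizable M1 M2 <-> Q tau l T z <> RtoC 0).
Proof.
intros tau ht l Hl T z0 y1 y2 M1 M2 [Hreg [Hs [Hind [HM1 HM2]]]] z Hz.
assert (Hreg1 : forall t : R, ~ in_half tau (z0 + t * 1)).
{ intros t H. apply (proj1 (Hreg t)). now apply singular_half. }
assert (Hreg2 : forall t : R, ~ in_half tau (z0 + t * tau)).
{ intros t H. apply (proj2 (Hreg t)). now apply singular_half. }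
assert (Hs1 : forall t : R, solution_near tau l T y1 (z0 + t * 1) /\ solution_near tau l T y2 (z0 + t * 1)).
{ intros t. destruct (Hs t) as [? [? _]]. now split. }
assert (Hs2 : forall t : R, solution_near tau l T y1 (z0 + t * tau) /\ solution_near tau l T y2 (z0 + t * tau)).
{ intros t. destruct (Hs t) as [_ [_ ?]]. trivial. }
assert (N0 := Hreg1 0%R). replace (z0 + 0%R * 1) with z0 in N0 by ring.
destruct (Hs1 0%R) as [S1 S2]. replace (z0 + 0%R * 1) with z0 in S1, S2 by ring.
assert (W0 := wronskian_nonzero tau T z0 l y1 y2 ht Hl N0 S1 S2 Hind).
assert (EQ : Q tau l T z = Q tau l T z0).
{ rewrite !Q_polynomial; trivial. intros H. apply Hz. now apply singular_half. }
rewrite EQ. clear z Hz EQ.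
destruct (mat2_eta M1) as [a [b [c [d ->]]]]. destruct (mat2_eta M2) as [a' [b' [c' [d' ->]]]].
assert (C1 := near_line_continued _ _ _ _ _ _ _ _ _ _ _ Hs1 HM1).
assert (C2 := near_line_continued _ _ _ _ _ _ _ _ _ _ _ Hs2 HM2).
assert (Hdet := gram_det tau T z0 l y1 y2 ht Hl N0).
split.
- intros [P [P' [I1 [I2 [D1 D2]]]]] Q0.
  rewrite Q0 in Hdet. match type of Hdet with _ = ?r => replace r with (RtoC 0) in Hdet by field end.
  apply (Xfun_not_periodic tau T z0 l ht N0).
  + apply (diagonalizable_X_periodic tau T z0 1 l y1 y2 a b c d P P'); trivial. now left.
  + apply (diagonalizable_X_periodic tau T z0 tau l y1 y2 a' b' c' d' P P'); trivial. now right.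
- intros Q0.
  apply (nondegenerate_diagonalizable (gram tau l T y1 y1 z0) (gram tau l T y1 y2 z0) (gram tau l T y2 y2 z0)).
  + intros e. apply Q0. rewrite Hdet in e.
    set (W := wronskian y1 y2 z0) in *.
    replace (Q tau l T z0) with ((W * W * Q tau l T z0 / 4) * 4 / (W * W)) by (field; auto).
    rewrite e. field. auto.
  + apply (monodromy_preserves tau T z0 1 l); trivial. now left.
  + apply (monodromy_preserves tau T z0 tau l); trivial. now right.
Qed.
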